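(* Let $T>0$, let $Z$ be a Lévy process with characteristic triplet $(a,0,\pi)$, $\pi$ symmetric, $g(t,s)$ a deterministic measurable kernel and $Y_t=\int_0^tg(t,s)\,dZ_s$, $t\in[0,T]$. Assume that $p\ge1$, $a=0$, $\int_{\mathbb R}|x|^p\pi(dx)<\infty$, and that for some $\alpha\in\mathbb R$, $\delta>0$, $\beta>-\frac1p$, $\gamma>-\frac1p$ with $\alpha+\beta+\gamma>-\frac1p$: (B1) there is a constant $C$ with $|g(t,u)|\le Ct^\alpha u^\beta(t-u)^\gamma$ for all $0<u<t\le T$; (B2) there is a function $h(t,s,u)$ such that $|g(t,u)-g(s,u)|\le|t-s|^\delta h(t,s,u)$ for all $0<u<s<t\le T$, and $\sup_{0<s<t\le T}\int_0^s|h(t,s,u)|^p\,du<\infty$. Let $\kappa=\alpha+\beta+\gamma$ if $\alpha+\beta<0$ and $\kappa=\gamma$ if $\alpha+\beta\ge0$. Then there is a constant $C$ such that for all $0\le s<t\le T$ $$\mathbf E|Y_t-Y_s|^p\le C(t-s)^{\min\{\kappa p+1,\,\delta p\}}.$$ If $\kappa>0$ and $\delta>\frac1p$, then the trajectories of $Y$ are (up to modification) a.s. Hölder continuous up to order $\min\{\kappa,\delta-\frac1p\}$.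
   Context: $Z$ satisfies $\mathbf E e^{i\mu Z_t}=e^{t\Psi(\mu)}$ with $\Psi(\mu)=-\frac{a\mu^2}2+\int_{\mathbb R}(e^{i\mu x}-1-i\mu\tau(x))\pi(dx)$, where $\tau(x)=x$ for $|x|\le1$, $\tau(x)=x/|x|$ for $|x|>1$, $a\ge0$, and $\pi$ is a symmetric Lévy measure ($\pi(\{0\})=0$, $\int(x^2\wedge1)\pi(dx)<\infty$); the drift is zero. The integral with respect to $Z$ is understood (Rajput–Rosiński) as the limit in probability of integrals of elementary functions. ''Hölder continuous up to order $\rho$'' means Hölder continuous of every order in $(0,\rho)$. *)

(* Defs.v *)
From HB Require Import structures.
From mathcomp Require Import all_boot all_order all_algebra.
From mathcomp Require Import complex.
From mathcomp Require Import all_classical all_reals all_analysis.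

Set Implicit Arguments.
Unset Strict Implicit.
Unset Printing Implicit Defensive.

Import Order.TTheory GRing.Theory Num.Theory.
Import numFieldNormedType.Exports.
Import HBSimple.

Local Open Scope complex_scope.
Local Open Scope classical_set_scope.
Local Open Scope ring_scope.

Definition Cexp (R : realType) (z : R[i]) : R[i] :=
  let: x +i* y := z in (expR x * cos y) +i* (expR x * sin y).

Definition Cintegral (d : measure_display) (E : measurableType d)
    (R : realType) (mu : {measure set E -> \bar R}) (f : E -> R[i]) : R[i] :=
  (\int[mu]_x complex.Re (f x)) +i* (\int[mu]_x complex.Im (f x)).

Definition char_fun (d : measure_display) (Omega : measurableType d)
    (R : realType) (P : probability Omega R) (X : Omega -> R) (u : R) : R[i] :=
  Cintegral P (fun w => Cexp (0 +i* (u * X w))).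

Definition levy_measure (R : realType) (nu : {measure set R -> \bar R}) : Prop :=
  nu [set 0] = 0%E /\
  (\int[nu]_x (Num.min (x ^+ 2) 1)%:E < +oo)%E.

Definition symmetric_measure (R : realType) (nu : {measure set R -> \bar R}) :
    Prop :=
  forall A : set R, measurable A -> nu ((@GRing.opp R) @^-1` A) = nu A.

Definition levy_trunc (R : realType) (x : R) : R :=
  if `|x| <= 1 then x else x / `|x|.

Definition levy_exponent (R : realType) (a b : R)
    (nu : {measure set R -> \bar R}) (u : R) : R[i] :=
  (0 +i* (u * b)) - (a * u ^+ 2 / 2)%:C
  + Cintegral nu (fun x => Cexp (0 +i* (u * x)) - 1 - (0 +i* (u * levy_trunc x))).

Section processes.
Context (d : measure_display) (Omega : measurableType d) (R : realType)
  (P : probability Omega R).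

Definition mutually_independent (I : eqType) (X : I -> Omega -> R) : Prop :=
  forall (s : seq I) (B : I -> set R), uniq s ->
    (forall i, measurable (B i)) ->
    P (\bigcap_(i in [set` s]) (X i @^-1` B i)) =
    (\prod_(i <- s) P (X i @^-1` B i))%E.

Definition cvg_in_prob (X : nat -> Omega -> R) (Y : Omega -> R) : Prop :=
  forall eps : R, 0 < eps ->
    P [set w | eps <= `|X n w - Y w|] @[n --> \oo] --> 0%E.

(* A Levy process in law on the time interval [0, T]: no path regularity is
   imposed, so this covers both conventions (with or without a cadlag version)
   as well as restrictions to [0, T] of processes indexed by [0, +oo[.  The
   values of Z outside [0, T] are irrelevant. *)
Definition levy_process (T : R) (Z : R -> {RV P >-> R}) : Prop :=
  [/\ {ae P, forall w, Z 0 w = 0},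
      forall (n : nat) (t : nat -> R),
        (forall i, (i <= n)%N -> 0 <= t i <= T) ->
        (forall i, (i < n)%N -> t i <= t i.+1) ->
        mutually_independent (fun i : 'I_n => Z (t i.+1) \- Z (t i)),
      forall s t : R, 0 <= s -> s <= t -> t <= T ->
        forall B : set R, measurable B ->
        P ((Z t \- Z s) @^-1` B) = P (Z (t - s) @^-1` B)
    & forall t : R, 0 <= t <= T -> forall eps : R, 0 < eps ->
        P [set w | eps <= `|Z s w - Z t w|]
          @[s --> within `[0, T] (nbhs t)] --> 0%E].

Definition has_triplet (T : R) (Z : R -> {RV P >-> R}) (a b : R)
    (nu : {measure set R -> \bar R}) : Prop :=
  forall t u : R, 0 <= t <= T ->
    char_fun P (Z t) u = Cexp (t%:C * levy_exponent a b nu u).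

(* The independently scattered random measure on the Borel subsets of ]0, t]
   generated by Z; it is unique up to null sets. *)
Definition generated_random_measure (Z : R -> {RV P >-> R}) (t : R)
    (M : set R -> {RV P >-> R}) : Prop :=
  (forall r s : R, 0 <= r -> r <= s -> s <= t ->
     {ae P, forall w, M `]r, s]%classic w = Z s w - Z r w}) /\
  (forall A : nat -> set R,
     (forall n, measurable (A n)) -> (forall n, A n `<=` `]0, t]%classic) ->
     trivIset setT A ->
     mutually_independent (fun n => M (A n)) /\
     {ae P, forall w,
        (\sum_(i < n) M (A i) w) @[n --> \oo] --> M (\bigcup_i A i) w}).

(* A simple function with distinct values y_j on disjoint sets A_j is
   integrated over A as \sum_j y_j * M (A `&` A_j). *)
Definition simple_integral (M : set R -> {RV P >-> R}) (A : set R)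
    (f : {sfun R >-> R}) (w : Omega) : R :=
  \sum_(y \in range f) y * M (A `&` f @^-1` [set y]) w.

(* X is (a version of) the integral of f over ]0, t] with respect to Z, in the
   sense of Rajput and Rosinski.  Almost everywhere refers to Lebesgue measure:
   the control measure of the random measure generated by a Levy process is a
   multiple of it. *)
Definition is_levy_integral (Z : R -> {RV P >-> R}) (t : R) (f : R -> R)
    (X : {RV P >-> R}) : Prop :=
  exists2 M : set R -> {RV P >-> R}, generated_random_measure Z t M &
  measurable_fun `]0, t]%classic f /\
  exists phi : nat -> {sfun R >-> R},
    [/\ {ae lebesgue_measure, forall u, `]0, t]%classic u ->
           phi n u @[n --> \oo] --> f u},
        forall A : set R, measurable A -> A `<=` `]0, t]%classic ->
          exists XA : {RV P >-> R},
            cvg_in_prob (fun n => simple_integral M A (phi n)) XA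
      & cvg_in_prob (fun n => simple_integral M `]0, t]%classic (phi n)) X].

Definition is_modification (D : set R) (Y' Y : R -> {RV P >-> R}) : Prop :=
  forall t, D t -> {ae P, forall w, Y' t w = Y t w}.

End processes.

Definition holder_up_to (R : realType) (D : set R) (rho : R) (f : R -> R) :
    Prop :=
  forall r : R, 0 < r -> r < rho ->
    exists K : R, forall s t : R, D s -> D t ->
      `|f t - f s| <= K * `|t - s| `^ r.

(* Main.v *)
(* Since [nu] is symmetric, the characteristic function of the integral of a
   deterministic [f] is [exp (- int psi (u f))] with
   [psi u = int (1 - cos (u x)) nu(dx)]; it extends from simple functions to the
   limits in probability because [E (1 - cos (u (X_n - X_m)))] controls
   [int psi (u (f_n - f_m))], and Fatou's lemma then applies.  So [Y_t - Y_s] has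
   the law of a compensated Poisson integral of [k(u, x) = f(u) x], where
   [f = g(t, .) 1_]0, t] - g(s, .) 1_]0, s]].
   For [p < 2], [E |X| ^ p <= C int |k| ^ p] follows by integrating
   [E (1 - cos (u X)) <= int (1 - cos (u k))] against [u ^ (-1 - p) du].  For
   [p >= 2] one uses the Stein identity [E (X h(X)) = int k E (h(X + k))] with
   [h y = (1 - cos (v y)) ^ n sin (v y)], which bounds [E |X| ^ q] by
   [int k ^ 2 * E |X| ^ (q - 2) + int |k| ^ q], inductively in [q].
   By (B1) and (B2) the integral of [|f| ^ p] is of the order of
   [(t - s) ^ min (kappa p + 1, delta p)]: compare with a Beta integral on
   [[s, t]].  The Hoelder regularity is then Kolmogorov's criterion along dyadic
   points. *)

Require Import Defs.
From HB Require Import structures.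
From mathcomp Require Import all_boot all_order all_algebra.
From mathcomp Require Import all_classical all_reals all_analysis.
From mathcomp Require Import measurable_realfun ring lra.

Set Implicit Arguments.
Unset Strict Implicit.
Unset Printing Implicit Defensive.

Import Order.TTheory GRing.Theory Num.Theory.
Import numFieldNormedType.Exports.

Local Open Scope classical_set_scope.
Local Open Scope ring_scope.

(** * Trigonometric inequalities and power integrals *)

(** The law of an increment is known only through its real characteristic function, so every moment
    must be extracted from it. Integrating [(1 - cos (u * x)) ^+ m] against [u ^ (-1 - p)] over
    [u > 0] gives a multiple of [|x|^p], but converges at 0 only for [p < 2 * m]: larger moments
    force higher powers of [1 - cos]. The mean of such a power is controlled through its derivative
    in [u], a multiple of [E (X h(X))] for the [h] of the Stein identity. For [h = sin] this
    identity is the derivative of the characteristic function; products of cosines and sines are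
    combinations of sines, whence the other cases. As [E h(X) = 0], this mean can be subtracted, and
    [h(X + k) - h(X)] supplies a second factor [k]: hence [k ^ 2], integrable where [k] may fail to
    be. Another obstacle is that [Y_s] and [Y_t] may come from different random measures; uniqueness
    up to null sets reduces the increment to one integral. Limits are handled through the mean of
    [1 - cos], since convergence in probability gives no moments. *)

Section trigonometry.
Context {R : realType}.
Implicit Types x y a b : R.

(** No order of [a] and [b] is imposed, so that shifts of either sign are covered; of the
    intermediate point only its distance to [a] is kept. *)
Lemma mean_value (f df : R -> R) a b :
  (forall x, is_derive x 1 f (df x)) ->
  exists2 c, `|c - a| <= `|b - a| & f b - f a = df c * (b - a).
Proof.
move=> fd.
have cf x y : {within `[x, y], continuous f}.
  by apply: derivable_within_continuous => z _; exact: ex_derive.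
have [ab|ba] := leP a b.
  have [c] := @MVT_segment R f df a b ab (fun x _ => fd x) (cf a b).
  rewrite in_itv /= => /andP[ac cb] E; exists c => //.
  by rewrite !ger0_norm ?subr_ge0 // lerB.
have [c] := @MVT_segment R f df b a (ltW ba) (fun x _ => fd x) (cf b a).
rewrite in_itv /= => /andP[bc ca] E; exists c.
  by rewrite !ler0_norm ?subr_le0 ?(ltW ba) // lerN2 lerB.
by rewrite -opprB E; ring.
Qed.

Lemma normr_sin_le x : `|sin x| <= `|x|.
Proof.
have [c _] := @mean_value sin cos 0 x (fun x => is_derive_sin x).
rewrite sin0 !subr0 => ->; rewrite normrM.
by rewrite ler_piMl // cos_max.
Qed.

Lemma one_sub_cos x : 1 - cos x = 2 * sin (x / 2) ^+ 2.
Proof.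
have -> : cos x = cos (x / 2 + x / 2) by congr cos; lra.
by rewrite cosD; have := cos2Dsin2 (x / 2); rewrite !expr2 => H; lra.
Qed.

Lemma one_sub_cos_ge0 x : 0 <= 1 - cos x.
Proof. by rewrite subr_ge0 cos_le1. Qed.

Lemma one_sub_cos_le x : 1 - cos x <= x ^+ 2.
Proof.
rewrite one_sub_cos -real_normK ?num_real //.
have H : `|sin (x / 2)| <= `|x| / 2.
  by apply: (le_trans (normr_sin_le _)); rewrite normrM (ger0_norm (_ : 0 <= 2^-1)).
have : `|sin (x / 2)| ^+ 2 <= (`|x| / 2) ^+ 2 by rewrite lerXn2r ?nnegrE ?divr_ge0.
rewrite expr_div_n !real_normK ?num_real //; have := sqr_ge0 x; move: (x ^+ 2) => *; nra.
Qed.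

(** Unlike [1 - cos x], the upper bound is monotone in [|x|], which later allows means at different
    frequencies to be compared. *)
Lemma one_sub_cos_le_min x : 1 - cos x <= 2 * Num.min 1 (x ^+ 2).
Proof.
have := one_sub_cos_le x; have := cos_geN1 x; have := sqr_ge0 x.
by case: (leP 1 (x ^+ 2)) => ? ? ? ?; lra.
Qed.

(** Since [1 - cos x] is half of [|exp(ix) - 1|^2], this is the triangle inequality for
    [|exp(ix) - 1|], squared; the factor 2 is the price of squaring. *)
Lemma one_sub_cosD_le x y : 1 - cos (x + y) <= 2 * (1 - cos x) + 2 * (1 - cos y).
Proof.
rewrite cosD.
have := cos2Dsin2 x; have := cos2Dsin2 y.
have := sqr_ge0 (sin x - sin y); have := sqr_ge0 (cos x + cos y - 2).
rewrite !expr2; lra.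
Qed.

Lemma one_sub_cosB_le x y : 1 - cos (x - y) <= 2 * (1 - cos x) + 2 * (1 - cos y).
Proof. by rewrite -(cosN y); exact: one_sub_cosD_le. Qed.

(* [sin b sin (a - b)] is split by AM-GM with weight [e]. *)
Lemma normr_cosB_le (e : R) a b : 0 < e ->
  `|cos a - cos b| <= e * (1 - cos b) + (1 + e^-1) * (1 - cos (a - b)).
Proof.
move=> e0; set c := a - b.
have -> : cos a = cos b * cos c - sin b * sin c.
  by rewrite -cosD; congr cos; rewrite /c; ring.
have sb : sin b ^+ 2 <= 2 * (1 - cos b).
  have := cos2Dsin2 b; have := cos_geN1 b; have := cos_le1 b; rewrite !expr2; nra.
have sc : sin c ^+ 2 <= 2 * (1 - cos c).
  have := cos2Dsin2 c; have := cos_geN1 c; have := cos_le1 c; rewrite !expr2; nra.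
have H : `|sin b * sin c| <= e * (1 - cos b) + e^-1 * (1 - cos c).
  have ei : 0 < e^-1 by rewrite invr_gt0.
  have key : 2 * `|sin b * sin c| <= e * sin b ^+ 2 + e^-1 * sin c ^+ 2.
    rewrite normrM -(@real_normK _ (sin b)) ?num_real // -(@real_normK _ (sin c)) ?num_real //.
    move: `|sin b| `|sin c| => p q.
    have : 0 <= e * (p - e^-1 * q) ^+ 2 by rewrite mulr_ge0 ?sqr_ge0 // ltW.
    have -> : e * (p - e^-1 * q) ^+ 2 = e * p ^+ 2 + e^-1 * q ^+ 2 - 2 * (p * q).
      by field; rewrite gt_eqF.
    by move=> ?; lra.
  have := ler_wpM2l (ltW e0) sb; have := ler_wpM2l (ltW ei) sc; lra.
have K : `|cos b * (1 - cos c)| <= 1 - cos c.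
  by rewrite normrM (ger0_norm (one_sub_cos_ge0 _)) ler_piMl ?one_sub_cos_ge0 // cos_max.
have -> : cos b * cos c - sin b * sin c - cos b =
  - (cos b * (1 - cos c)) - sin b * sin c by ring.
apply: (le_trans (ler_normB _ _)); rewrite normrN; lra.
Qed.

(** Here [|x|] lies in [[0, pi]], where the cosine decreases. This is the only range of [u * x] kept
    in the lower bound of the integral over [u]. *)
Lemma one_sub_cos_gt0 x : 1 <= `|x| <= 2 -> 1 - cos 1 <= 1 - cos x.
Proof.
move=> /andP[x1 x2]; rewrite lerD2l lerN2.
have -> : cos x = cos `|x|.
  by case: (ler0P x) => // _; rewrite cosN.
have p2 := pi_ge2 R.
rewrite le_eqVlt; have [<-|ne] := eqVneq (1:R) `|x|; first by rewrite eqxx.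
by rewrite ltr_cos ?in_itv /= ?lt_neqAle ?ne ?x1 ?orbT //; apply/andP; split; lra.
Qed.

Lemma cos1_lt1 : 0 < 1 - cos 1 :> R.
Proof.
rewrite subr_gt0 -[ltRHS](@cos0 R) ltr_cos // in_itv /=; apply/andP; split;
  have := pi_ge2 R; lra.
Qed.

End trigonometry.

Section power_integrals.
Context {R : realType}.
Local Notation mu := (@lebesgue_measure R).

(** The fundamental theorem of calculus is applied on compact subintervals that exhaust []a, b[], so
    [f] may be singular at the endpoints, as negative powers are; only the increments of [F] inside
    the interval matter. *)
Lemma integral_derive_le (F f : R -> R) (a b K : R) : a < b ->
  (forall x, a < x -> x < b -> is_derive x 1 F (f x)) ->
  (forall x, a < x -> x < b -> {for x, continuous f}) ->
  (forall x, a < x -> x < b -> 0 <= f x) ->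
  (forall x y, a < x -> x <= y -> y < b -> F y - F x <= K) ->
  (\int[mu]_(x in `]a, b[) (f x)%:E <= K%:E)%E.
Proof.
move=> ab dF cf f0 FK.
(* The denominator starts at 3 so that [a + e n < b - e n] already for [n = 0]. *)
pose e n : R := (b - a) / n.+3%:R.
have ba0 : 0 < b - a by rewrite subr_gt0.
have e0 n : 0 < e n by rewrite divr_gt0 // ltr0n.
have e2 n : e n * 3 <= b - a.
  rewrite /e mulrAC ler_pdivrMr ?ltr0n // ler_pM2l // ler_nat //.
have e_dec : forall m n, (m <= n)%N -> e n <= e m.
  by move=> m n mn; rewrite ler_pM2l // lef_pV2 ?posrE ?ltr0n // ler_nat !ltnS.
pose S n := `[a + e n, b - e n]%classic.
have mS n : measurable (S n) by exact: measurable_itv.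
have SE : `]a, b[%classic = \bigcup_n S n.
  rewrite eqEsubset; split => x /=; last first.
    move=> [n _]; rewrite /S /= !in_itv /= => /andP[? ?].
    have ? := e0 n. apply/andP; split; lra.
  rewrite in_itv /= => /andP[ax xb].
  pose r := Num.min (x - a) (b - x).
  have r0 : 0 < r by rewrite lt_min !subr_gt0 ax xb.
  have [n nP] : exists n : nat, (b - a) / r < n%:R.
    by exists (Num.truncn ((b - a) / r)).+1; rewrite truncnS_gt.
  exists n => //; rewrite /S /= in_itv /=.
  have : e n <= r.
    rewrite /e ler_pdivrMr ?ltr0n // mulrC -ler_pdivrMr //; apply: (le_trans (ltW nP)).
    by rewrite ler_nat -addn3 leq_addr.
  by rewrite le_min => /andP[? ?]; apply/andP; split; lra.
have fS n x : S n x -> a < x /\ x < b.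
  by rewrite /S /= in_itv /= => /andP[? ?]; have := e0 n; split; lra.
have mf : measurable_fun (`]a, b[%classic : set R) f.
  apply: open_continuous_measurable_fun; first exact: interval_open.
  by move=> x; rewrite inE /= in_itv /= => /andP[? ?]; exact: cf.
have cvg : (\int[mu]_(x in S i) (f x)%:E @[i --> \oo] -->
    \int[mu]_(x in `]a, b[) (f x)%:E)%E.
  rewrite SE; apply: ge0_nondecreasing_set_cvg_integral.
  - move=> m n mn; apply/subsetPset => x; rewrite /S /= !in_itv /= => /andP[? ?].
    by have ? := e_dec _ _ mn; apply/andP; split; lra.
  - exact: mS.
  - move=> n; apply/measurable_EFinP; apply: measurable_funS mf => //.
    by rewrite SE; exact: bigcup_sup.
  - by move=> n x /fS[? ?]; rewrite lee_fin f0.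
apply: (@closed_cvg _ _ _ eventually_filter
  (fun n => \int[mu]_(x in S n) (f x)%:E)%E (fun z => z <= K%:E)%E).
- exact: closed_ereal_ge_ereal.
- apply: nearW => n /=.
  rewrite (@continuous_FTC2 R f F (a + e n) (b - e n)).
  + rewrite -EFinB lee_fin; apply: FK; have := e0 n; have := e2 n; lra.
  + by have := e0 n; have := e2 n; lra.
  + apply: continuous_in_subspaceT => x; rewrite inE => /(fS n)[? ?]; exact: cf.
  + have cF x : a < x -> x < b -> {for x, continuous F}.
      move=> ax xb; apply: differentiable_continuous; apply/derivable1_diffP.
      by apply: ex_derive; exact: dF.
    split.
    * move=> x; rewrite in_itv /= => /andP[? ?]; apply: ex_derive; apply: dF;
      have := e0 n; lra.
    * by apply: cvg_at_right_filter; apply: cF; have := e0 n; have := e2 n; lra.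
    * by apply: cvg_at_left_filter; apply: cF; have := e0 n; have := e2 n; lra.
  + move=> x; rewrite in_itv /= => /andP[? ?]; rewrite derive1E.
    by apply: derive_val; apply: dF; have := e0 n; lra.
- exact: cvg.
Qed.

Lemma integral_derive_ley (F f : R -> R) (a K : R) :
  (forall x, a < x -> is_derive x 1 F (f x)) ->
  (forall x, a < x -> {for x, continuous f}) ->
  (forall x, a < x -> 0 <= f x) ->
  (forall x y, a < x -> x <= y -> F y - F x <= K) ->
  (\int[mu]_(x in `]a, +oo[) (f x)%:E <= K%:E)%E.
Proof.
move=> dF cf f0 FK.
pose S n := `]a, a + n.+1%:R[%classic.
have SE : `]a, +oo[%classic = \bigcup_n S n.
  rewrite eqEsubset; split => x /=; last first.
    by move=> [n _]; rewrite /S /= !in_itv /= => /andP[-> _].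
  rewrite in_itv /= andbT => ax.
  exists (Num.truncn (x - a)) => //; rewrite /S /= in_itv /= ax /=.
  by rewrite -ltrBlDl truncnS_gt.
have mf : measurable_fun (`]a, +oo[%classic : set R) f.
  apply: open_continuous_measurable_fun; first exact: interval_open.
  by move=> x; rewrite inE /= in_itv /= andbT => ?; exact: cf.
have cvg : (\int[mu]_(x in S i) (f x)%:E @[i --> \oo] -->
    \int[mu]_(x in `]a, +oo[) (f x)%:E)%E.
  rewrite SE; apply: ge0_nondecreasing_set_cvg_integral.
  - move=> m n mn; apply/subsetPset => x; rewrite /S /= !in_itv /= => /andP[-> xm] /=.
    by apply: (lt_le_trans xm); rewrite lerD2l ler_nat ltnS.
  - by move=> n; exact: measurable_itv.
  - move=> n; apply/measurable_EFinP; apply: measurable_funS mf => //.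
    by rewrite SE; exact: bigcup_sup.
  - by move=> n x; rewrite /S /= in_itv /= => /andP[? _]; rewrite lee_fin f0.
apply: (@closed_cvg _ _ _ eventually_filter
  (fun n => \int[mu]_(x in S n) (f x)%:E)%E (fun z => z <= K%:E)%E).
- exact: closed_ereal_ge_ereal.
- apply: nearW => n /=; apply: (@integral_derive_le F) => //.
  + by rewrite ltrDl ltr0n.
  + by move=> x ? _; exact: dF.
  + by move=> x ? _; exact: cf.
  + by move=> x ? _; exact: f0.
  + by move=> x y ? ? _; exact: FK.
- exact: cvg.
Qed.

Lemma integral_powR_subl_le (s t q : R) : s < t -> -1 < q ->
  (\int[mu]_(u in `]s, t[) ((u - s) `^ q)%:E <= ((t - s) `^ (q + 1) / (q + 1))%:E)%E.
Proof.
move=> st q1; have q0 : 0 < q + 1 by lra.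
apply: (@integral_derive_le (fun u => (q + 1)^-1 * (u - s) `^ (q + 1))) => //.
- move=> x sx _; have xs : 0 < x - s by rewrite subr_gt0.
  have := is_derive1_powR (q + 1) xs; rewrite addrK => H.
  have H2 : is_derive x 1 (fun u : R => u - s) 1.
    by have := is_deriveB (is_derive_id x (1 : R)) (is_derive_cst s x (1 : R)); rewrite subr0.
  have H1 := is_derive1_comp (g := fun u => u - s) H H2.
  have := is_deriveZ (q + 1)^-1 H1.
  by rewrite mulr1 /GRing.scale /= mulrA mulVf ?gt_eqF // mul1r.
- move=> x sx _; have xs : 0 < x - s by rewrite subr_gt0.
  change {for x, continuous ((@powR R ^~ q) \o (fun u : R => u - s))}.
  apply: continuous_comp.
    by apply: cvgB; [exact: cvg_id|exact: cvg_cst].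
  by apply: differentiable_continuous; apply/derivable1_diffP; apply: derivable_powR;
    rewrite in_itv /= xs.
- by move=> *; exact: powR_ge0.
- move=> x y sx xy yt.
  rewrite ![_^-1 * _]mulrC.
  have H1 : 0 <= (x - s) `^ (q + 1) / (q + 1) by rewrite divr_ge0 ?powR_ge0 // ltW.
  suff : (y - s) `^ (q + 1) / (q + 1) <= (t - s) `^ (q + 1) / (q + 1) by lra.
  rewrite ler_pM2r ?invr_gt0 //; apply: ge0_ler_powR; rewrite ?nnegrE ?subr_ge0; lra.
Qed.

Lemma integral_powR_subr_le (s t q : R) : s < t -> -1 < q ->
  (\int[mu]_(u in `]s, t[) ((t - u) `^ q)%:E <= ((t - s) `^ (q + 1) / (q + 1))%:E)%E.
Proof.
move=> st q1; have q0 : 0 < q + 1 by lra.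
apply: (@integral_derive_le (fun u => - (q + 1)^-1 * (t - u) `^ (q + 1))) => //.
- move=> x sx xt; have xs : 0 < t - x by rewrite subr_gt0.
  have := is_derive1_powR (q + 1) xs; rewrite addrK => H.
  have H2 : is_derive x 1 (fun u : R => t - u) (-1).
    by have := is_deriveB (is_derive_cst t x (1 : R)) (is_derive_id x (1 : R)); rewrite sub0r.
  have H1 := is_derive1_comp (g := fun u => t - u) H H2.
  have := is_deriveZ (- (q + 1)^-1) H1.
  by rewrite mulrN1 /GRing.scale /= mulrNN mulrA mulVf ?gt_eqF // mul1r.
- move=> x sx xt; have xs : 0 < t - x by rewrite subr_gt0.
  change {for x, continuous ((@powR R ^~ q) \o (fun u : R => t - u))}.
  apply: continuous_comp.
    by apply: cvgB; [exact: cvg_cst|exact: cvg_id].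
  by apply: differentiable_continuous; apply/derivable1_diffP; apply: derivable_powR;
    rewrite in_itv /= xs.
- by move=> *; exact: powR_ge0.
- move=> x y sx xy yt.
  rewrite !mulNr ![_^-1 * _]mulrC.
  have H1 : 0 <= (t - y) `^ (q + 1) / (q + 1) by rewrite divr_ge0 ?powR_ge0 // ltW.
  suff : (t - x) `^ (q + 1) / (q + 1) <= (t - s) `^ (q + 1) / (q + 1) by lra.
  rewrite ler_pM2r ?invr_gt0 //; apply: ge0_ler_powR; rewrite ?nnegrE ?subr_ge0; lra.
Qed.

Lemma integral_powR_y_le (a p : R) : 0 < a -> 0 < p ->
  (\int[mu]_(u in `]a, +oo[) (u `^ (- 1 - p))%:E <= (a `^ (- p) / p)%:E)%E.
Proof.
move=> a0 p0.
apply: (@integral_derive_ley (fun u => - p^-1 * u `^ (- p))) => //.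
- move=> x ax; have x0 : 0 < x by exact: lt_trans ax.
  have := is_derive1_powR (- p) x0 => H1.
  have := is_deriveZ (- p^-1) H1.
  by rewrite /GRing.scale /= mulrA mulrNN mulVf ?gt_eqF // mul1r addrC.
- move=> x ax; have x0 : 0 < x by exact: lt_trans ax.
  by apply: differentiable_continuous; apply/derivable1_diffP; apply: derivable_powR;
    rewrite in_itv /= x0.
- by move=> *; exact: powR_ge0.
- move=> x y ax xy; have x0 : 0 < x by exact: lt_trans ax.
  rewrite !mulNr ![p^-1 * _]mulrC.
  have H1 : 0 <= y `^ (- p) / p by rewrite divr_ge0 ?powR_ge0 // ltW.
  suff : x `^ (- p) / p <= a `^ (- p) / p by lra.
  rewrite ler_pM2r ?invr_gt0 // !powRN lef_pV2 ?posrE ?powR_gt0 //.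
  by apply: ge0_ler_powR; rewrite ?nnegrE; lra.
Qed.

End power_integrals.

Section kernels.
Context {R : realType}.
Local Notation mu := (@lebesgue_measure R).

Lemma powRD_gt0 (x r s : R) : 0 < x -> x `^ (r + s) = x `^ r * x `^ s.
Proof. by move=> x0; rewrite powRD // (gt_eqF x0) implybT. Qed.

Lemma measurable_power_kernel (f : R -> R) m (q x : R) : measurable_fun [set: R] f ->
  measurable_fun [set: R] (fun u : R => f (u * x) ^+ m * u `^ q).
Proof.
move=> mf; apply: measurable_funM; last exact: measurable_powR.
apply: measurable_funX; apply: measurableT_comp => //.
exact: measurable_funM.
Qed.

Lemma measurable_one_sub_cos : measurable_fun [set: R] (fun y : R => 1 - cos y).
Proof.
apply: measurable_funB => //; apply: continuous_measurable_fun; exact: continuous_cos.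
Qed.

Lemma measurable_min1sqr : measurable_fun [set: R] (fun y : R => Num.min 1 (y ^+ 2)).
Proof. by apply: measurable_minr => //; exact: measurable_funX. Qed.

(** The integral is split at [u = |x|^-1], where the minimum changes branch. Below, the integrand is
    at most [|x|^(2m) u^(2m - 1 - p)], integrable at 0 because [p < 2 * m]; above, it is at most
    [u^(-1 - p)]. The two pieces give the two summands of the constant. *)
Lemma integral_min1sqr_le m (p x : R) : 0 < p -> p < 2 * m%:R ->
  (\int[mu]_(u in `]0%R, +oo[) (Num.min 1 ((u * x) ^+ 2) ^+ m * u `^ (-1 - p))%:E
   <= (((2 * m%:R - p)^-1 + p^-1) * `|x| `^ p)%:E)%E.
Proof.
move=> p0 pm; pose f u : R := Num.min 1 ((u * x) ^+ 2) ^+ m * u `^ (-1 - p).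
have mf : measurable_fun [set: R] f by exact: measurable_power_kernel measurable_min1sqr.
have y0 (y : R) : 0 <= Num.min 1 (y ^+ 2) by rewrite le_min ler01 sqr_ge0.
have f0 u : 0 <= f u by rewrite mulr_ge0 ?exprn_ge0 ?powR_ge0.
have [->|x0] := eqVneq x 0.
  rewrite normr0 powR0 ?gt_eqF // mulr0 integral0_eq // => u _.
  rewrite /f mulr0 expr0n /=; case: m pm {f mf f0} => [|m] pm; first by exfalso; lra.
  by rewrite min_r ?ler01 // expr0n /= mul0r.
have ax : 0 < `|x| by rewrite normr_gt0.
pose a : R := `|x|^-1; have a0 : 0 < a by rewrite invr_gt0.
have -> : `]0%R, +oo[%classic = `]0%R, a[%classic `|` `[a, +oo[%classic :> set R.
  rewrite -itv_bndbnd_setU //= ?bnd_simp //; exact: ltW.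
rewrite ge0_integral_setU //=; last 3 first.
- by apply/measurable_EFinP; exact: measurable_funTS.
- by move=> u _; rewrite lee_fin f0.
- rewrite disj_set2E; apply/eqP; rewrite -subset0 => u [] /=.
  by rewrite !in_itv /= andbT => /andP[_ ua] au; move: (lt_le_trans ua au); rewrite ltxx.
rewrite mulrDl EFinD; apply: leeD.
- pose q := 2 * m%:R - 1 - p.
  apply: (@le_trans _ _ (\int[mu]_(u in `]0%R, a[) (`|x| ^+ (2 * m) * (u - 0) `^ q)%:E)%E).
    apply: ge0_le_integral => //=.
    + by move=> u _; rewrite lee_fin f0.
    + by apply/measurable_EFinP; exact: measurable_funTS.
    + apply/measurable_EFinP; apply: measurable_funTS; apply: measurable_funM => //.
      by apply: (measurableT_comp (measurable_powR _)); exact: measurable_funB.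
    + move=> u; rewrite in_itv /= => /andP[u0 ua]; rewrite lee_fin /f subr0.
      have -> : u `^ q = u ^+ (2 * m) * u `^ (-1 - p).
        rewrite -powR_mulrn ?ltW // -powRD_gt0 //.
        by congr powR; rewrite /q natrM; ring.
      rewrite mulrA ler_wpM2r ?powR_ge0 //.
      have -> : `|x| ^+ (2 * m) * u ^+ (2 * m) = ((u * x) ^+ 2) ^+ m.
        by rewrite -exprMn exprM exprMn real_normK ?num_real // -exprMn [x * u]mulrC.
      by rewrite lerXn2r ?nnegrE ?sqr_ge0 // ge_min lexx orbT.
  under eq_integral do rewrite EFinM.
  have q1 : -1 < q by rewrite /q; lra.
  rewrite ge0_integralZl_EFin //=; last 2 first.
  + by move=> u _; rewrite lee_fin powR_ge0.
  + apply/measurable_EFinP; apply: measurable_funTS.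
    by apply: (measurableT_comp (measurable_powR _)); exact: measurable_funB.
  apply: (@le_trans _ _ (((`|x| ^+ (2 * m))%:E * ((a - 0) `^ (q + 1) / (q + 1))%:E)%E)).
    by apply: lee_wpmul2l; [rewrite lee_fin exprn_ge0|exact: integral_powR_subl_le].
  rewrite subr0 -EFinM lee_fin /q.
  have -> : 2 * m%:R - 1 - p + 1 = 2 * m%:R - p by ring.
  rewrite mulrA [leRHS]mulrC ler_pM2r ?invr_gt0 ?subr_gt0 //.
  rewrite /a -(powR_inv1 (ltW ax)) -powRrM -powR_mulrn // -powRD_gt0 //.
  by rewrite natrM; have -> : 2 * m%:R + -1 * (2 * m%:R - p) = p by ring.
- rewrite -integral_itv_obnd_cbnd; last first.
    by apply/measurable_EFinP; exact: measurable_funTS.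
  apply: (@le_trans _ _ (\int[mu]_(u in `]a, +oo[) (u `^ (-1 - p))%:E)%E).
    apply: ge0_le_integral => //=.
    + by move=> u _; rewrite lee_fin f0.
    + by apply/measurable_EFinP; exact: measurable_funTS.
    + by apply/measurable_EFinP; apply: measurable_funTS; exact: measurable_powR.
    + move=> u _; rewrite lee_fin /f ler_piMl ?powR_ge0 // exprn_ile1 //.
      by rewrite ge_min lexx.
  apply: (le_trans (integral_powR_y_le a0 p0)).
  rewrite lee_fin mulrC ler_pM2l ?invr_gt0 // /a -(powR_inv1 (ltW ax)) -powRrM.
  by have -> : -1 * - p = p by ring.
Qed.

(** Only the window [[a, 2a]] with [a = |x|^-1] is kept: there [1 <= |u * x| <= 2], the power of [u]
    is at least [(2a)^(-1 - p)], and the window has length [a]. *)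
Lemma integral_one_sub_cos_ge m (p x : R) : 0 < p ->
  (((1 - cos 1) ^+ m * 2 `^ (-1 - p) * `|x| `^ p)%:E <=
   \int[mu]_(u in `]0%R, +oo[) ((1 - cos (u * x)) ^+ m * u `^ (-1 - p))%:E)%E.
Proof.
move=> p0; pose f u : R := (1 - cos (u * x)) ^+ m * u `^ (-1 - p).
have mf : measurable_fun [set: R] f.
  exact: (@measurable_power_kernel (fun y => 1 - cos y)) measurable_one_sub_cos.
have f0 u : 0 <= f u by rewrite mulr_ge0 ?exprn_ge0 ?powR_ge0 ?one_sub_cos_ge0.
have [->|x0] := eqVneq x 0.
  rewrite normr0 powR0 ?gt_eqF // mulr0; apply: integral_ge0 => u _.
  by rewrite lee_fin mulr_ge0 ?exprn_ge0 ?powR_ge0 ?one_sub_cos_ge0.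
have ax : 0 < `|x| by rewrite normr_gt0.
pose a : R := `|x|^-1; have a0 : 0 < a by rewrite invr_gt0.
pose c : R := (1 - cos 1) ^+ m * (2 * a) `^ (-1 - p).
apply: (@le_trans _ _ (\int[mu]_(u in `[a, (2 * a)%R]) c%:E)%E).
  rewrite integral_cst //= lebesgue_measure_itv /= lte_fin ifT; last by lra.
  rewrite -EFinB -EFinM lee_fin /c powRM // ?(ltW a0) // -!mulrA ler_pM2l; last first.
    by rewrite exprn_gt0 // cos1_lt1.
  rewrite ler_pM2l ?powR_gt0 //.
  have -> : 2 * a - a = a `^ 1 by rewrite powRr1 ?ltW //; ring.
  rewrite -powRD_gt0 //.
  have -> : -1 - p + 1 = - p by ring.
  by rewrite /a -(powR_inv1 (ltW ax)) -powRrM mulN1r opprK.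
apply: (@le_trans _ _ (\int[mu]_(u in `[a, (2 * a)%R]) (f u)%:E)%E).
  have u0 u : a <= u -> 0 < u by exact: lt_le_trans.
  apply: ge0_le_integral => //=.
  - by move=> u _; rewrite lee_fin mulr_ge0 ?exprn_ge0 ?powR_ge0 ?one_sub_cos_ge0.
  - by apply/measurable_EFinP; exact: measurable_funTS.
  - move=> u; rewrite in_itv /= => /andP[au ua]; rewrite lee_fin /f /c.
    apply: ler_pM; rewrite ?exprn_ge0 ?powR_ge0 ?one_sub_cos_ge0 //.
      rewrite lerXn2r ?nnegrE ?one_sub_cos_ge0 //; apply: one_sub_cos_gt0.
      rewrite normrM (gtr0_norm (u0 _ au)); apply/andP; split.
        by rewrite -ler_pdivrMr // div1r.
      by rewrite -ler_pdivlMr.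
    have -> : -1 - p = - (1 + p) by ring.
    have h1 := u0 _ au; have h2 : 0 < 2 * a by lra.
    rewrite !powRN lef_pV2 ?posrE ?powR_gt0 //.
    by apply: ge0_ler_powR; rewrite ?nnegrE; lra.
apply: ge0_subset_integral => //=.
- by apply/measurable_EFinP; exact: measurable_funTS.
- by move=> u _; rewrite lee_fin.
- by move=> u /=; rewrite !in_itv /= andbT => /andP[au _]; exact: lt_le_trans au.
Qed.

End kernels.

(** * Integrability and derivatives under the integral sign *)

Section integrable.
Context d (T : measurableType d) (R : realType) (mu : {measure set T -> \bar R}).
Implicit Types f g : T -> R.

Lemma integrable_normr_le f g : measurable_fun setT f ->
  (forall x, `|f x| <= g x) -> mu.-integrable setT (EFin \o g) ->
  mu.-integrable setT (EFin \o f).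
Proof.
move=> mf fg; apply: le_integrable => //; first exact/measurable_EFinP.
by move=> x _; rewrite /= lee_fin (le_trans (fg x)) // ler_norm.
Qed.

Lemma integrable_ge0 f : measurable_fun setT f -> (forall x, 0 <= f x) ->
  (\int[mu]_x (f x)%:E < +oo)%E -> mu.-integrable setT (EFin \o f).
Proof.
move=> mf f0 foo; apply/integrableP; split; first exact/measurable_EFinP.
by under eq_integral => x _ do rewrite gee0_abs ?lee_fin //.
Qed.

Lemma EFin_Rintegral f : mu.-integrable setT (EFin \o f) ->
  (\int[mu]_x f x)%:E = (\int[mu]_x (f x)%:E)%E.
Proof. by move=> intf; rewrite /Rintegral fineK //; exact: integrable_fin_num. Qed.

Lemma ge0_integralZl_fin (c : R) f : 0 <= c -> measurable_fun setT f ->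
  (forall x, 0 <= f x) -> (\int[mu]_x (c * f x)%:E = c%:E * \int[mu]_x (f x)%:E)%E.
Proof.
move=> c0 mf f0; under eq_integral do rewrite EFinM.
by rewrite ge0_integralZl_EFin //=; [move=> x _; rewrite lee_fin|exact/measurable_EFinP].
Qed.

Lemma normr_Rintegral_le f g : mu.-integrable setT (EFin \o f) ->
  mu.-integrable setT (EFin \o g) -> (forall x, `|f x| <= g x) ->
  `|\int[mu]_x f x| <= \int[mu]_x g x.
Proof.
move=> intf intg fg; apply: (le_trans (le_normr_Rintegral _ _)) => //.
by apply: le_Rintegral => //; exact: integrable_norm.
Qed.

End integrable.

Section derivative_under_integral.
Context d (T : measurableType d) (R : realType) (mu : {measure set T -> \bar R}).

Lemma is_derive_measurable (h dh : R -> R) : (forall x : R, is_derive x 1 h (dh x)) ->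
  measurable_fun setT h.
Proof.
move=> hd; apply: continuous_measurable_fun => x.
by apply: differentiable_continuous; apply/derivable1_diffP; exact: ex_derive.
Qed.

Lemma is_derive_scale (h dh : R -> R) (c v : R) : (forall x : R, is_derive x 1 h (dh x)) ->
  is_derive v 1 (fun v : R => h (v * c)) (c * dh (v * c)).
Proof.
move=> hd.
have H1 : is_derive v 1 (fun v : R => v * c) c.
  have := is_deriveZ c (is_derive_id v (1 : R)).
  rewrite /GRing.scale /= mulr1 => H; rewrite (_ : (fun v => v * c) = (c \*: id)) //.
  by apply/funext => y /=; rewrite mulrC.
have := is_derive1_comp (g := fun v : R => v * c) (hd (v * c)) H1.
by rewrite mulrC.
Qed.

(* Quadratic growth of [h] makes [h (v * k)] integrable even though [mu] may be
   infinite. *)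
Lemma is_derive_integral_scale (k : T -> R) (h dh : R -> R) (L : R) :
  measurable_fun setT k -> (forall x : R, is_derive x 1 h (dh x)) -> h 0 = 0 ->
  0 <= L -> (forall y, `|dh y| <= L * `|y|) ->
  (\int[mu]_x (k x ^+ 2)%:E < +oo)%E ->
  forall v : R, is_derive v 1 (fun v => \int[mu]_x h (v * k x))
    (\int[mu]_x (k x * dh (v * k x))).
Proof.
move=> mk hd h0 L0 dhL k2 v.
have ik2 : mu.-integrable setT (EFin \o (fun x => k x ^+ 2)).
  by apply: integrable_ge0 => // [|x]; [exact: measurable_funX|exact: sqr_ge0].
have icl (c : R) : mu.-integrable setT (EFin \o (fun x => c * k x ^+ 2)).
  by have := integrableZl measurableT c ik2.
have hL y : `|h y| <= L * y ^+ 2.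
  have [c cy] := mean_value 0 y hd; rewrite h0 !subr0 in cy * => ->.
  rewrite normrM (le_trans (ler_wpM2r _ (dhL c))) // -mulrA ler_wpM2l //.
  by rewrite -[y ^+ 2]real_normK ?num_real // expr2 ler_wpM2r.
have mh := is_derive_measurable hd.
have intf (x : R) : mu.-integrable setT (EFin \o (fun y => h (x * k y))).
  apply: (integrable_normr_le _ _ (icl (L * x ^+ 2))) => [|y].
    by apply: measurableT_comp => //; exact: measurable_funM.
  by rewrite (le_trans (hL _)) // exprMn mulrA.
have der (x : R) y : derivable (fun x : R => h (x * k y)) x 1.
  by have H := is_derive_scale (k y) x hd; exact: ex_derive.
have d1 (x : R) y : partial1of2 (fun (x : R) y => h (x * k y)) x y = k y * dh (x * k y).
  rewrite partial1of2E; have H := is_derive_scale (k y) x hd; exact: derive_val.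
have vI : `]v - 1, v + 1[%classic v by rewrite /= in_itv /=; apply/andP; split; lra.
(* For [x] within distance 1 of [v] one has [|x| <= |v| + 1], so the linear bound on [dh] makes [G]
   dominate the derivative [k y * dh (x * k y)]. *)
pose G y := L * (`|v| + 1) * k y ^+ 2.
have G0 y : 0 <= G y by rewrite mulr_ge0 ?sqr_ge0 // mulr_ge0 // addr_ge0.
have Gub (x : R) y : `]v - 1, v + 1[%classic x -> setT y ->
    `|partial1of2 (fun (x : R) y => h (x * k y)) x y| <= G y.
  rewrite /= in_itv /= d1 => /andP[vx xv] _.
  rewrite normrM (le_trans (ler_wpM2l _ (dhL _))) // normrM /G.
  rewrite mulrCA -mulrA ler_wpM2l // mulrCA -expr2 real_normK ?num_real //.
  rewrite ler_wpM2r ?sqr_ge0 // -[x](subrK v) addrC (le_trans (ler_normD _ _)) //.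
  by rewrite lerD2l ler_norml; apply/andP; split; lra.
have iG : mu.-integrable setT (EFin \o G) by exact: icl.
have D := @derivable_under_integral R _ _ mu (fun (x : R) y => h (x * k y)) setT measurableT
  v (v - 1) (v + 1) vI (fun x _ => intf x) (fun x y _ _ => der x y) G G0 iG Gub.
have E := @differentiation_under_integral R _ _ mu (fun (x : R) y => h (x * k y)) setT measurableT
  v (v - 1) (v + 1) vI (fun x _ => intf x) (fun x y _ _ => der x y) G G0 iG Gub.
apply: DeriveDef => //; rewrite -derive1E E.
by apply: eq_Rintegral => y _; exact: d1.
Qed.

End derivative_under_integral.

Section probability_integrable.
Context d (Omega : measurableType d) (R : realType) (P : probability Omega R).

Lemma bounded_integrable (f : Omega -> R) (M : R) : measurable_fun setT f ->
  (forall x, `|f x| <= M) -> P.-integrable setT (EFin \o f).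
Proof.
move=> mf fM; apply: (integrable_normr_le mf fM).
exact: finite_measure_integrable_cst.
Qed.

Lemma Rintegral_cst1 (c : R) : \int[P]_w c = c.
Proof.
by rewrite Rintegral_cst //= (@probability_setT _ _ _ P) mulr1.
Qed.

End probability_integrable.

(** * Moments of symmetric infinitely divisible laws *)

Section stein.
Context d (Omega : measurableType d) (R : realType) (P : probability Omega R).
Context d' (E : measurableType d') (rho : {measure set E -> \bar R}).
Variables (X : Omega -> R) (k : E -> R).
Hypotheses (mX : measurable_fun setT X) (mk : measurable_fun setT k).
Hypothesis cosX : forall u : R,
  \int[P]_w cos (u * X w) = expR (- \int[rho]_x (1 - cos (u * k x))).
Hypothesis sinX : forall u : R, \int[P]_w sin (u * X w) = 0.
Hypothesis k2 : (\int[rho]_x (k x ^+ 2)%:E < +oo)%E.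

Lemma measurable_cos_scale d0 (T : measurableType d0) (Y : T -> R) (u : R) :
  measurable_fun setT Y -> measurable_fun setT (fun w => cos (u * Y w)).
Proof.
move=> mY; apply: measurableT_comp; last exact: measurable_funM.
by apply: continuous_measurable_fun; exact: continuous_cos.
Qed.

Lemma measurable_sin_scale d0 (T : measurableType d0) (Y : T -> R) (u : R) :
  measurable_fun setT Y -> measurable_fun setT (fun w => sin (u * Y w)).
Proof.
move=> mY; apply: measurableT_comp; last exact: measurable_funM.
by apply: continuous_measurable_fun; exact: continuous_sin.
Qed.

Lemma integrable_one_sub_cos_rv (Y : Omega -> R) (u : R) : measurable_fun setT Y ->
  P.-integrable setT (EFin \o (fun w => 1 - cos (u * Y w))).
Proof.
move=> mY; apply: (@bounded_integrable _ _ _ _ _ 2).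
  by apply: measurable_funB => //; exact: measurable_cos_scale.
by move=> w; rewrite ger0_norm ?one_sub_cos_ge0 //; have := cos_geN1 (u * Y w); lra.
Qed.

Lemma integrable_sqr : rho.-integrable setT (EFin \o (fun x => k x ^+ 2)).
Proof.
by apply: integrable_ge0 => // [|x]; [exact: measurable_funX|exact: sqr_ge0].
Qed.

Lemma integrable_one_sub_cos (u : R) :
  rho.-integrable setT (EFin \o (fun x => 1 - cos (u * k x))).
Proof.
have := integrableZl measurableT (u ^+ 2) integrable_sqr.
apply: integrable_normr_le => [|x /=].
  by apply: measurable_funB => //; exact: measurable_cos_scale.
by rewrite ger0_norm ?one_sub_cos_ge0 // -exprMn one_sub_cos_le.
Qed.

Lemma expectation_one_sub_cos (u : R) :
  \int[P]_w (1 - cos (u * X w)) = 1 - expR (- \int[rho]_x (1 - cos (u * k x))).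
Proof.
rewrite RintegralB //; last 2 first.
- by apply: (@bounded_integrable _ _ _ _ _ 1) => // x; rewrite normr1.
- apply: (@bounded_integrable _ _ _ _ _ 1); first exact: measurable_cos_scale.
  by move=> x; exact: cos_max.
by rewrite Rintegral_cst1 cosX.
Qed.

Lemma expectation_one_sub_cos_le (u : R) :
  \int[P]_w (1 - cos (u * X w)) <= \int[rho]_x (1 - cos (u * k x)).
Proof.
rewrite expectation_one_sub_cos.
by have := expR_ge1Dx (- \int[rho]_x (1 - cos (u * k x))); lra.
Qed.

(** By the mean value theorem [sin (y / 2)] equals [cos c * (y / 2)] with [|c| <= 1], and
    [cos c >= cos 1] there; the constant follows from the half-angle formula. *)
Lemma cos1_sqr_le (y : R) : `|y| <= 1 -> cos 1 ^+ 2 / 2 * y ^+ 2 <= 1 - cos y.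
Proof.
move=> y1; rewrite one_sub_cos.
have [c] := mean_value 0 (y / 2) (@is_derive_sin R).
rewrite sin0 !subr0 => cy ->.
have c1 : `|c| <= 1.
  by rewrite (le_trans cy) // normrM (ger0_norm (_ : 0 <= 2^-1)) //; lra.
have cc : cos 1 <= cos c.
  have -> : cos c = cos `|c| by case: (ler0P c) => // _; rewrite cosN.
  have p2 := pi_ge2 R.
  rewrite le_eqVlt; have [<-|ne] := eqVneq (1:R) `|c|; first by rewrite eqxx.
  have c0 : 0 <= `|c| by [].
  by rewrite ltr_cos ?in_itv /= ?lt_neqAle ?[_ == 1]eq_sym ?ne ?c1 ?orbT //;
    apply/andP; split; lra.
have c0 : 0 <= cos 1 :> R by exact: ltW (cos1_gt0 R).
have : cos 1 ^+ 2 <= cos c ^+ 2 by rewrite lerXn2r ?nnegrE // (le_trans c0).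
rewrite exprMn expr_div_n; have := sqr_ge0 y; move: (y ^+ 2) (cos c ^+ 2) (cos 1 ^+ 2) => a b e; nra.
Qed.

(** Finiteness of the second moment is not known beforehand, so the characteristic function cannot
    be differentiated twice. Instead, on [|X| <= 1 / u] the square of [X] is at most a multiple of
    [u^-2 (1 - cos (u X))], whose mean is bounded by the integral of [k ^+ 2] uniformly in [u]; then
    [u = 1 / (n + 1)] tends to 0. *)
Lemma second_moment_le :
  (\int[P]_w (X w ^+ 2)%:E <= (2 / cos 1 ^+ 2)%:E * \int[rho]_x (k x ^+ 2)%:E)%E.
Proof.
pose A n := [set w | `|X w| <= n.+1%:R].
have mA n : measurable (A n).
  rewrite /A -[X in measurable X]setTI.
  by apply: measurable_fun_le => //; exact: measurableT_comp.
have AT : \bigcup_n A n = setT.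
  rewrite -subTset => w _; exists (Num.truncn `|X w|) => //=.
  by rewrite /A /= ltW // truncnS_gt.
have c0 : 0 < cos 1 ^+ 2 / 2 :> R by rewrite divr_gt0 // exprn_gt0 // cos1_gt0.
have := @ge0_nondecreasing_set_cvg_integral _ _ _ A (fun w => (X w ^+ 2)%:E) P.
rewrite AT => cvg.
apply: (@closed_cvg _ _ _ eventually_filter
  (fun n => \int[P]_(w in A n) (X w ^+ 2)%:E)%E (fun z => z <= _)%E).
- exact: closed_ereal_ge_ereal.
- apply: nearW => n /=; set u : R := n.+1%:R^-1.
  have u0 : 0 < u by rewrite invr_gt0 ltr0n.
  have cn : cos 1 != 0 :> R by rewrite gt_eqF // cos1_gt0.
  have pt w : A n w -> X w ^+ 2 <= 2 / cos 1 ^+ 2 * u ^- 2 * (1 - cos (u * X w)).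
    move=> Aw.
    have uX : `|u * X w| <= 1.
      by rewrite normrM gtr0_norm // /u mulrC ler_pdivrMr ?ltr0n // mul1r.
    have := cos1_sqr_le uX; rewrite exprMn -ler_pdivlMl // invf_div => H.
    rewrite -(ler_pM2l (_ : 0 < u ^+ 2)) ?exprn_gt0 //; apply: (le_trans H).
    by rewrite [leRHS](_ : _ = 2 / cos 1 ^+ 2 * (1 - cos (u * X w))) //; field;
      rewrite ?cn ?(gt_eqF u0).
  pose f w := 2 / cos 1 ^+ 2 * u ^- 2 * (1 - cos (u * X w)).
  have f0 w : 0 <= f w.
    by rewrite mulr_ge0 ?one_sub_cos_ge0 // mulr_ge0 ?invr_ge0 ?exprn_ge0 // ?divr_ge0
      ?exprn_ge0 ?(ltW u0) // ltW // cos1_gt0.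
  have mf : measurable_fun setT f.
    by apply: measurable_funM => //; apply: measurable_funB => //; exact: measurable_cos_scale.
  apply: (@le_trans _ _ (\int[P]_w (f w)%:E)%E).
    apply: (@le_trans _ _ (\int[P]_(w in A n) (f w)%:E)%E).
      apply: ge0_le_integral => //=.
      + by move=> w _; rewrite lee_fin sqr_ge0.
      + by apply/measurable_EFinP; apply: measurable_funTS; exact: measurable_funX.
      + by apply/measurable_EFinP; exact: measurable_funTS.
    apply: ge0_subset_integral => //=; first exact/measurable_EFinP.
    by move=> w _; rewrite lee_fin.
  have i1 := integrable_one_sub_cos_rv u mX.
  have iF : P.-integrable setT (EFin \o f).
    by have := integrableZl measurableT (2 / cos 1 ^+ 2 * u ^- 2) i1.
  rewrite -(EFin_Rintegral iF) -(EFin_Rintegral integrable_sqr) -EFinM lee_fin.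
  rewrite /f RintegralZl //.
  rewrite -[_ / u ^+ 2 * _]mulrA ler_wpM2l //; first by rewrite divr_ge0 ?exprn_ge0 // ltW // cos1_gt0.
  rewrite ler_pdivrMl ?exprn_gt0 // -RintegralZl ?integrable_sqr //.
  apply: (le_trans (expectation_one_sub_cos_le _)).
  apply: le_Rintegral => //; first exact: integrable_one_sub_cos.
    by have := integrableZl measurableT (u ^+ 2) integrable_sqr.
  by move=> x _; rewrite -exprMn one_sub_cos_le.
- apply: cvg => //.
  + move=> m n mn; apply/subsetPset => w; rewrite /A /= => /le_trans; apply.
    by rewrite ler_nat ltnS.
  + by move=> n; apply/measurable_EFinP; apply: measurable_funTS; exact: measurable_funX.
  + by move=> n w _; rewrite lee_fin sqr_ge0.
Qed.

Lemma second_moment_lty : (\int[P]_w (X w ^+ 2)%:E < +oo)%E.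
Proof.
apply: (le_lt_trans second_moment_le); apply: lte_mul_pinfty => //.
by rewrite lee_fin divr_ge0 // exprn_ge0 // ltW // cos1_gt0.
Qed.

Lemma integrable_rv : P.-integrable setT (EFin \o X).
Proof.
have i1 : P.-integrable setT (EFin \o (fun w => 1 + X w ^+ 2)).
  rewrite (_ : EFin \o _ = (EFin \o cst 1) \+ (EFin \o (fun w => X w ^+ 2)))//.
  apply: integrableD => //; first exact: finite_measure_integrable_cst.
  apply: integrable_ge0 second_moment_lty; first exact: measurable_funX.
  by move=> w; exact: sqr_ge0.
apply: integrable_normr_le i1 => // w.
rewrite -[X w ^+ 2]real_normK ?num_real // expr2.
by have : 0 <= `|X w| by []; move: `|X w| => y y0; nra.
Qed.

(** The full identity has [f (X + k) - f (X)] on the right; the subtracted term has mean 0 by the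
    first clause. Integrability is bundled in so that the class of such [f] is closed under linear
    combinations. *)
Definition stein_identity (f : R -> R) : Prop :=
  [/\ \int[P]_w f (X w) = 0,
      rho.-integrable setT (EFin \o (fun x => k x * \int[P]_w f (X w + k x)))
    & \int[P]_w (X w * f (X w)) = \int[rho]_x (k x * \int[P]_w f (X w + k x))].

Lemma is_derive_one_sub_cos (x : R) : is_derive x 1 (fun y : R => 1 - cos y) (sin x).
Proof.
have := is_deriveB (is_derive_cst (1 : R) x (1 : R)) (is_derive_cos x).
by rewrite sub0r opprK.
Qed.

(** Both sides are the derivative at [w] of the mean of [1 - cos (w X)]: once under the expectation,
    once through the exponential formula. Using [1 - cos] instead of [cos] gives a function that
    vanishes at 0, as an infinite [rho] requires. *)
Lemma expectation_mul_sin (w : R) : \int[P]_x (X x * sin (w * X x)) =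
  expR (- \int[rho]_x (1 - cos (w * k x))) * \int[rho]_x (k x * sin (w * k x)).
Proof.
have H1 := @is_derive_integral_scale _ _ _ P X (fun y => 1 - cos y) sin 1 mX
  is_derive_one_sub_cos _ ler01 _ second_moment_lty w.
have H2 := @is_derive_integral_scale _ _ _ rho k (fun y => 1 - cos y) sin 1 mk
  is_derive_one_sub_cos _ ler01 _ k2 w.
have {}H1 := H1 (ltac:(by rewrite cos0 subrr)) (ltac:(by move=> y; rewrite mul1r normr_sin_le)).
have {}H2 := H2 (ltac:(by rewrite cos0 subrr)) (ltac:(by move=> y; rewrite mul1r normr_sin_le)).
have H3 := is_derive1_comp (g := - (fun v => \int[rho]_x (1 - cos (v * k x))))
  (is_derive_expR _) (is_deriveN H2).
have H4 := is_deriveB (is_derive_cst (1 : R) w (1 : R)) H3.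
rewrite sub0r mulrN opprK in H4.
have FE : (fun v => \int[P]_w (1 - cos (v * X w))) =
    cst 1 - (expR \o - (fun v => \int[rho]_x (1 - cos (v * k x)))).
  by apply/funext => v; rewrite expectation_one_sub_cos.
rewrite -FE in H4.
by rewrite -(@derive_val _ _ _ _ _ _ _ H1) (@derive_val _ _ _ _ _ _ _ H4).
Qed.

Lemma bounded_integral_shift (f : R -> R) (M : R) : measurable_fun setT f ->
  (forall y, `|f y| <= M) -> forall x : R, P.-integrable setT (EFin \o (fun w => f (X w + x))).
Proof.
move=> mf fM x; apply: (@bounded_integrable _ _ _ _ _ M) => //.
by apply: measurableT_comp => //; exact: measurable_funD.
Qed.

Lemma bounded_integral_mul (f : R -> R) (M : R) : measurable_fun setT f ->
  (forall y, `|f y| <= M) -> P.-integrable setT (EFin \o (fun w => X w * f (X w))).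
Proof.
move=> mf fM; have iX := integrable_norm integrable_rv.
have := integrableZl measurableT M iX; apply: integrable_normr_le => [|w /=].
  by apply: measurable_funM => //; exact: measurableT_comp.
by rewrite normrM mulrC ler_wpM2r.
Qed.

Lemma stein_identity_lin (f g : R -> R) (a b M : R) :
  measurable_fun setT f -> (forall y, `|f y| <= M) ->
  measurable_fun setT g -> (forall y, `|g y| <= M) ->
  stein_identity f -> stein_identity g ->
  stein_identity (fun y => a * f y + b * g y).
Proof.
move=> mf fM mg gM [f1 f2 f3] [g1 g2 g3].
have sf := bounded_integral_shift mf fM; have sg := bounded_integral_shift mg gM.
have L x : \int[P]_w (a * f (X w + x) + b * g (X w + x)) =
    a * \int[P]_w f (X w + x) + b * \int[P]_w g (X w + x).
  rewrite RintegralD //; last 2 first.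
  - by have := integrableZl measurableT a (sf x).
  - by have := integrableZl measurableT b (sg x).
  by rewrite !RintegralZl.
have kL : (fun x => k x * \int[P]_w (a * f (X w + k x) + b * g (X w + k x))) =
    (fun x => a * (k x * \int[P]_w f (X w + k x)) + b * (k x * \int[P]_w g (X w + k x))).
  by apply/funext => x; rewrite L; ring.
have i1 : rho.-integrable setT (EFin \o (fun x => a * (k x * \int[P]_w f (X w + k x)))).
  by have := integrableZl measurableT a f2.
have i2 : rho.-integrable setT (EFin \o (fun x => b * (k x * \int[P]_w g (X w + k x)))).
  by have := integrableZl measurableT b g2.
split.
- have E0 (h : R -> R) : \int[P]_w h (X w + 0) = \int[P]_w h (X w).
    by apply: eq_Rintegral => w _; rewrite addr0.
  have := L 0; rewrite (E0 f) (E0 g) f1 g1 !mulr0 addr0 => <-.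
  exact/esym/(E0 (fun y => a * f y + b * g y)).
- rewrite kL (_ : EFin \o _ = (EFin \o (fun x => a * (k x * \int[P]_w f (X w + k x)))) \+
    (EFin \o (fun x => b * (k x * \int[P]_w g (X w + k x))))) //.
  exact: integrableD.
- rewrite kL RintegralD // !RintegralZl // -f3 -g3.
  under eq_Rintegral do rewrite mulrDr mulrCA [X in _ + X]mulrCA.
  have j1 := bounded_integral_mul mf fM; have j2 := bounded_integral_mul mg gM.
  rewrite RintegralD ?RintegralZl //.
  + by have := integrableZl measurableT a j1.
  + by have := integrableZl measurableT b j2.
Qed.

(** Because the mean of [sin (w X)] is 0, the addition formula leaves only [sin (w x)] times the
    characteristic function at [w] for the mean of [sin (w (X + x))]; the claim is then
    [expectation_mul_sin]. *)
Lemma stein_identity_sin (w : R) : stein_identity (fun y => sin (w * y)).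
Proof.
have F x : \int[P]_a sin (w * (X a + x)) =
    expR (- \int[rho]_x (1 - cos (w * k x))) * sin (w * x).
  under eq_Rintegral do rewrite mulrDr sinD.
  have ic : P.-integrable setT (EFin \o (fun a => cos (w * X a))).
    by apply: (@bounded_integrable _ _ _ _ _ 1) => [|y]; [exact: measurable_cos_scale|exact: cos_max].
  have is_ : P.-integrable setT (EFin \o (fun a => sin (w * X a))).
    by apply: (@bounded_integrable _ _ _ _ _ 1) => [|y]; [exact: measurable_sin_scale|exact: sin_max].
  rewrite RintegralD //; last 2 first.
  - by have := integrableZr measurableT (cos (w * x)) is_.
  - by have := integrableZr measurableT (sin (w * x)) ic.
  by rewrite !RintegralZr // sinX cosX mul0r add0r.
have isn : rho.-integrable setT (EFin \o (fun x => k x * sin (w * k x))).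
  have := integrableZl measurableT `|w| integrable_sqr.
  apply: integrable_normr_le => [|x /=].
    by apply: measurable_funM => //; exact: measurable_sin_scale.
  rewrite normrM -[k x ^+ 2]real_normK ?num_real // expr2 mulrCA ler_wpM2l //.
  by rewrite (le_trans (normr_sin_le _)) // normrM.
have kF : (fun x => k x * \int[P]_a sin (w * (X a + k x))) =
    (fun x => expR (- \int[rho]_x (1 - cos (w * k x))) * (k x * sin (w * k x))).
  by apply/funext => x; rewrite F mulrCA.
split; first exact: sinX.
- rewrite kF.
  by have := integrableZl measurableT (expR (- \int[rho]_x (1 - cos (w * k x)))) isn.
- by rewrite kF RintegralZl // expectation_mul_sin.
Qed.

(** The case of interest is [w = v]; the frequency of the sine is kept separate because the
    induction on [n] shifts it by [v] in both directions. *)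
Definition trig n (v w y : R) := (1 - cos (v * y)) ^+ n * sin (w * y).

Lemma measurable_trig n v w : measurable_fun setT (trig n v w).
Proof.
apply: measurable_funM; last exact: measurable_sin_scale.
by apply: measurable_funX; apply: measurable_funB => //; exact: measurable_cos_scale.
Qed.

Lemma trig_bounded n v w y : `|trig n v w y| <= 2 ^+ n.
Proof.
rewrite normrM -[leRHS]mulr1 ler_pM ?sin_max // normrX lerXn2r ?nnegrE //.
by rewrite ger0_norm ?one_sub_cos_ge0 //; have := cos_geN1 (v * y); lra.
Qed.

(** Multiplying [sin (w y)] by [1 - cos (v y)] gives a linear combination of sines with frequencies
    [w], [w + v] and [w - v], so the induction runs over all [w] at once and rests on linearity. *)
Lemma stein_identity_trig n v w : stein_identity (trig n v w).
Proof.
elim: n w => [|n IH] w.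
  rewrite (_ : trig 0 v w = fun y => sin (w * y)); first exact: stein_identity_sin.
  by apply/funext => y; rewrite /trig expr0 mul1r.
have H : trig n.+1 v w = fun y => 1 * trig n v w y +
    (- 2^-1) * (1 * trig n v (w + v) y + 1 * trig n v (w - v) y).
  apply/funext => y; rewrite /trig exprSr.
  have -> : sin ((w + v) * y) = sin (w * y) * cos (v * y) + cos (w * y) * sin (v * y).
    by rewrite mulrDl sinD.
  have -> : sin ((w - v) * y) = sin (w * y) * cos (v * y) - cos (w * y) * sin (v * y).
    by rewrite mulrBl sinD cosN sinN mulrN.
  by field.
rewrite H; pose M : R := 2 ^+ n + 2 ^+ n.
have tM u y : `|trig n v u y| <= M.
  by rewrite (le_trans (trig_bounded _ _ _ _)) // lerDl exprn_ge0.
apply: (@stein_identity_lin _ _ _ _ M) => //.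
- exact: measurable_trig.
- apply: measurable_funD; apply: measurable_funM => //; exact: measurable_trig.
- move=> y; rewrite !mul1r (le_trans (ler_normD _ _)) // lerD ?trig_bounded //.
- apply: (@stein_identity_lin _ _ _ _ M) => //; exact: measurable_trig.
Qed.

Local Notation m1 y := (Num.min 1 (y ^+ 2)).

(** Up to the factor [2 ^+ n] this dominates the mean of [(1 - cos (v X)) ^+ n], and in contrast to
    it is nondecreasing in [|v|]. *)
Definition truncated_moment n (v : R) := \int[P]_w m1 (v * X w) ^+ n.

Lemma min1sqr_ge0 (y : R) : 0 <= m1 y.
Proof. by rewrite le_min ler01 sqr_ge0. Qed.

Lemma min1sqr_exp_le1 n (y : R) : m1 y ^+ n <= 1.
Proof. by rewrite exprn_ile1 ?min1sqr_ge0 // ge_min lexx. Qed.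

Lemma min1sqr_homo n (a b : R) : `|a| <= `|b| -> m1 a ^+ n <= m1 b ^+ n.
Proof.
move=> ab; rewrite lerXn2r ?nnegrE ?min1sqr_ge0 // le_min2 // -[a ^+ 2]real_normK ?num_real //.
by rewrite -[b ^+ 2]real_normK ?num_real // lerXn2r ?nnegrE.
Qed.

Lemma is_derive_trig n (z : R) : is_derive z 1 (fun y : R => (1 - cos y) ^+ n * sin y)
  ((1 - cos z) ^+ n * cos z + n%:R * (1 - cos z) ^+ n.-1 * sin z ^+ 2).
Proof.
have H := is_deriveM (is_deriveX n (is_derive_one_sub_cos z)) (is_derive_sin z).
rewrite (_ : (fun y => _) = (fun y : R => 1 - cos y) ^+ n * sin); last first.
  by apply/funext => y; rewrite !fctE.
apply: (@is_derive_eq _ _ _ _ _ _ _ _ H).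
by rewrite !fctE /GRing.scale /= expr2; ring.
Qed.

Lemma derive_trig_le n (z : R) :
  `|(1 - cos z) ^+ n * cos z + n%:R * (1 - cos z) ^+ n.-1 * sin z ^+ 2| <=
  n.*2.+1%:R * (1 - cos z) ^+ n.
Proof.
have c0 := one_sub_cos_ge0 z.
apply: (le_trans (ler_normD _ _)).
have H1 : `|(1 - cos z) ^+ n * cos z| <= (1 - cos z) ^+ n.
  by rewrite normrM ger0_norm ?exprn_ge0 // ler_piMr ?exprn_ge0 ?cos_max.
have H2 : `|n%:R * (1 - cos z) ^+ n.-1 * sin z ^+ 2| <= n.*2%:R * (1 - cos z) ^+ n.
  rewrite ger0_norm; last by rewrite mulr_ge0 ?sqr_ge0 // mulr_ge0 ?exprn_ge0.
  have : sin z ^+ 2 <= (1 - cos z) * 2.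
    have := cos2Dsin2 z; have := cos_geN1 z; have := cos_le1 z; rewrite !expr2; nra.
  move: (sin z ^+ 2) => s hs.
  case: n {H1} => [|n]; first by rewrite !mul0r.
  rewrite -[n.+1.-1]/n exprSr -mul2n natrM [2 * _]mulrC -!mulrA ler_wpM2l //.
  by rewrite mulrCA ler_wpM2l ?exprn_ge0 // mulrC.
by rewrite -natr1 mulrDl mul1r addrC; exact: lerD.
Qed.

(** The mean value point is within [|b|] of [a], so [1 - cos] there is at most 4 times the sum of
    the two minima. The factor [8 ^+ n] is [4 ^+ n] times the [2 ^+ n] lost in splitting the power
    of that sum. *)
Lemma trig_shift_le n (a b : R) :
  `|(1 - cos (a + b)) ^+ n * sin (a + b) - (1 - cos a) ^+ n * sin a| <=
  n.*2.+1%:R * 8 ^+ n * `|b| * (m1 a ^+ n + m1 b ^+ n).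
Proof.
have [c] := mean_value a (a + b) (is_derive_trig n).
rewrite [a + b]addrC addrK => cb ->; rewrite normrM.
rewrite -[leRHS]mulrA [leRHS]mulrCA [leRHS]mulrC ler_wpM2r //.
apply: (le_trans (derive_trig_le n c)); rewrite -mulrA ler_wpM2l //.
have H1 : 1 - cos c <= 4 * (m1 a + m1 b).
  have := one_sub_cosD_le a (c - a); rewrite [a + (c - a)]addrC subrK => H.
  have := one_sub_cos_le_min a; have := one_sub_cos_le_min (c - a).
  have := @min1sqr_homo 1 _ _ cb; rewrite !expr1; lra.
have H2 : (m1 a + m1 b) ^+ n <= 2 ^+ n * (m1 a ^+ n + m1 b ^+ n).
  have := min1sqr_ge0 a; have := min1sqr_ge0 b; move: (m1 a) (m1 b) => s t t0 s0.
  have [st|ts] := leP s t.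
  - apply: (@le_trans _ _ ((2 * t) ^+ n)).
      by rewrite lerXn2r ?nnegrE ?addr_ge0 ?mulr_ge0 //; lra.
    by rewrite exprMn ler_wpM2l ?exprn_ge0 // lerDr exprn_ge0.
  - apply: (@le_trans _ _ ((2 * s) ^+ n)).
      by rewrite lerXn2r ?nnegrE ?addr_ge0 ?mulr_ge0 //; lra.
    by rewrite exprMn ler_wpM2l ?exprn_ge0 // lerDl exprn_ge0.
apply: (@le_trans _ _ ((4 * (m1 a + m1 b)) ^+ n)).
  by rewrite lerXn2r ?nnegrE ?one_sub_cos_ge0 // mulr_ge0 ?addr_ge0 ?min1sqr_ge0.
rewrite exprMn (_ : 8 = 4 * 2); last by rewrite -natrM.
by rewrite [X in _ <= X * _]exprMn -mulrA ler_wpM2l ?exprn_ge0.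
Qed.

Lemma measurable_m1 d0 (T : measurableType d0) (Y : T -> R) n (v : R) :
  measurable_fun setT Y -> measurable_fun setT (fun w => m1 (v * Y w) ^+ n).
Proof.
move=> mY; apply: measurable_funX.
apply: (measurableT_comp (@measurable_min1sqr R)); exact: measurable_funM.
Qed.

Lemma integrable_m1 n (v : R) : P.-integrable setT (EFin \o (fun w => m1 (v * X w) ^+ n)).
Proof.
apply: (@bounded_integrable _ _ _ _ _ 1); first exact: measurable_m1.
by move=> w; rewrite ger0_norm ?exprn_ge0 ?min1sqr_ge0 // min1sqr_exp_le1.
Qed.

Lemma truncated_moment_ge0 n v : 0 <= truncated_moment n v.
Proof. by apply: Rintegral_ge0 => w _; rewrite exprn_ge0 ?min1sqr_ge0. Qed.

(** Since [trig n v v (X)] has mean 0 it may be subtracted under the expectation. The gain is the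
    factor [|v * x|], which joins the factor [k] of the Stein identity to form [k ^+ 2]. *)
Lemma expectation_trig_shift_le n (v x : R) :
  `|\int[P]_w trig n v v (X w + x)| <=
  n.*2.+1%:R * 8 ^+ n * `|v * x| * (truncated_moment n v + m1 (v * x) ^+ n).
Proof.
have [E0 _ _] := stein_identity_trig n v v.
have mt := @measurable_trig n v v.
have bt := @trig_bounded n v v.
have i1 := bounded_integral_shift mt bt x.
have i0 : P.-integrable setT (EFin \o (fun w => trig n v v (X w))).
  apply: (@bounded_integrable _ _ _ _ _ (2 ^+ n)) => //.
  by apply: measurableT_comp => //; exact: measurable_trig.
have -> : \int[P]_w trig n v v (X w + x) =
    \int[P]_w (trig n v v (X w + x) - trig n v v (X w)).
  by rewrite RintegralB // E0 subr0.
have i2 : P.-integrable setT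
    (EFin \o (fun w => m1 (v * X w) ^+ n + m1 (v * x) ^+ n)).
  rewrite (_ : EFin \o _ = (EFin \o (fun w => m1 (v * X w) ^+ n)) \+
    (EFin \o cst (m1 (v * x) ^+ n))) //.
  apply: integrableD => //; first exact: integrable_m1.
  exact: finite_measure_integrable_cst.
set c := (X in _ <= X * _).
apply: (@le_trans _ _ (\int[P]_w (c * (m1 (v * X w) ^+ n + m1 (v * x) ^+ n)))).
  apply: normr_Rintegral_le.
  - exact: (integrableB measurableT i1 i0).
  - by have := integrableZl measurableT c i2.
  - move=> w; rewrite /trig mulrDr; exact: trig_shift_le.
rewrite RintegralZl // RintegralD ?integrable_m1 //; last first.
  exact: finite_measure_integrable_cst.
by rewrite Rintegral_cst1.
Qed.

Lemma is_derive_one_sub_cosX n (x : R) :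
  is_derive x 1 (fun y : R => (1 - cos y) ^+ n.+1) (n.+1%:R * (1 - cos x) ^+ n * sin x).
Proof.
rewrite (_ : (fun y => _) = (fun y : R => 1 - cos y) ^+ n.+1); last first.
  by apply/funext => y; rewrite !fctE.
by have := is_deriveX n.+1 (is_derive_one_sub_cos x); rewrite /GRing.scale.
Qed.

(** The left side vanishes at [u = 0], and its derivative at an intermediate [v] is given by the
    Stein identity for [trig n v v]. Monotonicity in [|v| <= u] then replaces [v] by [u]. One factor
    [u] is the length of the interval, the other comes from [|v * k| <= u * |k|]. *)
Lemma expectation_one_sub_cosX_le n (u : R) : 0 < u ->
  ((\int[P]_w (1 - cos (u * X w)) ^+ n.+1)%:E <=
  (n.+1%:R * (n.*2.+1%:R * 8 ^+ n) * u ^+ 2)%:E *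
  \int[rho]_x (k x ^+ 2 * (truncated_moment n u + m1 (u * k x) ^+ n))%:E)%E.
Proof.
move=> u0; pose c : R := n.+1%:R * (n.*2.+1%:R * 8 ^+ n) * u ^+ 2; rewrite -/c.
pose h x := k x ^+ 2 * (truncated_moment n u + m1 (u * k x) ^+ n).
have h0 x : 0 <= h x.
  by rewrite mulr_ge0 ?sqr_ge0 // addr_ge0 ?truncated_moment_ge0 // exprn_ge0 ?min1sqr_ge0.
have mh : measurable_fun setT h.
  apply: measurable_funM; first exact: measurable_funX.
  by apply: measurable_funD => //; exact: measurable_m1.
have ih : rho.-integrable setT (EFin \o h).
  have := integrableZr measurableT (truncated_moment n u + 1) integrable_sqr.
  apply: integrable_normr_le => // x /=.
  by rewrite ger0_norm // ler_wpM2l ?sqr_ge0 // lerD2l min1sqr_exp_le1.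
rewrite -(EFin_Rintegral ih) -EFinM lee_fin.
have dD := @is_derive_integral_scale _ _ _ P X (fun y => (1 - cos y) ^+ n.+1)
  (fun x => n.+1%:R * (1 - cos x) ^+ n * sin x) (n.+1%:R * 2 ^+ n) mX
  (is_derive_one_sub_cosX n) _ _ _ second_moment_lty.
have [||z|v vu] := mean_value 0 u (dD _ _ _).
- by rewrite cos0 subrr expr0n.
- by rewrite mulr_ge0 ?exprn_ge0.
- rewrite !normrM ler_pM ?mulr_ge0 ?normr_sin_le // ger0_norm // ler_wpM2l //.
  rewrite normrX lerXn2r ?nnegrE // ger0_norm ?one_sub_cos_ge0 //.
  by have := cos_geN1 z; lra.
under [X in _ - X = _ -> _]eq_Rintegral do rewrite mul0r cos0 subrr expr0n.
rewrite Rintegral_cst1 !subr0 in vu * => ->.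
have [_ S2 S3] := stein_identity_trig n v v.
have -> : \int[P]_x (X x * (n.+1%:R * (1 - cos (v * X x)) ^+ n * sin (v * X x))) =
    n.+1%:R * \int[rho]_x (k x * \int[P]_w trig n v v (X w + k x)).
  rewrite -S3 -RintegralZl //; last first.
    exact: bounded_integral_mul (@measurable_trig n v v) (@trig_bounded n v v).
  by apply: eq_Rintegral => x _; rewrite /trig; ring.
have vu' : `|v| <= u by rewrite (le_trans vu) // gtr0_norm.
have tv : truncated_moment n v <= truncated_moment n u.
  apply: le_Rintegral => //; try exact: integrable_m1.
  move=> w _; apply: min1sqr_homo; rewrite !normrM ler_wpM2r //.
pose e : R := n.*2.+1%:R * 8 ^+ n * u.
have e0 : 0 <= e by rewrite mulr_ge0 ?mulr_ge0 ?exprn_ge0 // ltW.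
have H : `|\int[rho]_x (k x * \int[P]_w trig n v v (X w + k x))| <= e * \int[rho]_x h x.
  rewrite -RintegralZl //; apply: normr_Rintegral_le => //.
    by have := integrableZl measurableT e ih.
  move=> x; rewrite normrM.
  apply: (le_trans (ler_wpM2l _ (expectation_trig_shift_le n v (k x)))) => //.
  rewrite /e /h normrM -[k x ^+ 2]real_normK ?num_real //.
  set A := n.*2.+1%:R * 8 ^+ n; set B := truncated_moment n v + _.
  have A0 : 0 <= A by rewrite mulr_ge0 ?exprn_ge0.
  have -> : `|k x| * (A * (`|v| * `|k x|) * B) = (A * `|k x| ^+ 2) * (`|v| * B) by ring.
  set B' := truncated_moment n u + _.
  have -> : A * u * (`|k x| ^+ 2 * B') = (A * `|k x| ^+ 2) * (u * B') by ring.
  rewrite ler_wpM2l ?mulr_ge0 ?sqr_ge0 // ler_pM //.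
    by rewrite addr_ge0 ?truncated_moment_ge0 // exprn_ge0 ?min1sqr_ge0.
  apply: lerD => //; apply: min1sqr_homo; rewrite !normrM ler_wpM2r //.
have -> : c * \int[rho]_x h x = n.+1%:R * (e * \int[rho]_x h x) * u.
  by rewrite /c /e; ring.
by rewrite ler_wpM2r ?(ltW u0) // ler_wpM2l // (le_trans _ H) // ler_norm.
Qed.

End stein.

(** * Moments as integrals over frequencies *)

Section tonelli.
Context d (T : measurableType d) (R : realType).
Variable mu : {sigma_finite_measure set T -> \bar R}.
Local Notation leb := (@lebesgue_measure R).
Variables (a k : T -> R) (f : R -> R) (m : nat) (q : R).
Hypotheses (ma : measurable_fun setT a) (mk : measurable_fun setT k)
  (mf : measurable_fun setT f) (a0 : forall x, 0 <= a x) (f0 : forall y, 0 <= f y).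

Local Notation D := (`]0%R, +oo[%classic : set R).

(** The half-line of frequencies is carried by an indicator, so that Tonelli's theorem applies on
    the whole product space. *)
Let g (z : T * R) : \bar R :=
  (a z.1 * (f (z.2 * k z.1) ^+ m * z.2 `^ q) * \1_D z.2)%:E.

Let mg : measurable_fun setT g.
Proof.
apply/measurable_EFinP; apply: measurable_funM; last first.
  have mD : measurable_fun setT (\1_D : R -> R).
    by apply: measurable_indic; exact: measurable_itv.
  exact: (measurableT_comp mD measurable_snd).
apply: measurable_funM; first exact: (measurableT_comp ma).
apply: measurable_funM.
  apply: measurable_funX; apply: (measurableT_comp mf).
  by apply: measurable_funM => //; exact: (measurableT_comp mk).
exact: (measurableT_comp (measurable_powR q)).
Qed.

Let g0 z : (0 <= g z)%E.
Proof. by rewrite lee_fin !mulr_ge0 ?exprn_ge0 ?powR_ge0. Qed.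

Let gE x u : g (x, u) = if u \in D then (a x * (f (u * k x) ^+ m * u `^ q))%:E else 0%E.
Proof. by rewrite /g /= indicE; case: (u \in D); rewrite ?mulr1 // mulr0. Qed.

Lemma tonelli_kernel :
  (\int[leb]_(u in D) \int[mu]_x (a x * (f (u * k x) ^+ m * u `^ q))%:E =
   \int[mu]_x \int[leb]_(u in D) (a x * (f (u * k x) ^+ m * u `^ q))%:E)%E.
Proof.
have := @fubini_tonelli _ _ _ _ _ mu leb g mg g0.
under eq_integral => x _.
  rewrite (_ : (\int[leb]_y g (x, y))%E =
    (\int[leb]_(u in D) (a x * (f (u * k x) ^+ m * u `^ q))%:E)%E); last first.
    rewrite [RHS]integral_mkcond; apply: eq_integral => u _.
    by rewrite patchE gE.
  over.
move=> ->; rewrite [LHS]integral_mkcond; apply: eq_integral => u _.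
rewrite patchE; under [RHS]eq_integral do rewrite gE.
by case: (u \in D) => //; rewrite integral0.
Qed.

Lemma measurable_integral_tonelli :
  measurable_fun D (fun u => \int[mu]_x (a x * (f (u * k x) ^+ m * u `^ q))%:E)%E.
Proof.
have := @measurable_fun_fubini_tonelli_G _ _ _ _ _ mu g mg g0.
move=> /(measurable_funS measurableT (@subsetT _ D)); apply: eq_measurable_fun => u uD.
by rewrite /fubini_G; apply: eq_integral => x _; rewrite gE uD.
Qed.

Lemma measurable_tonelli_integral :
  measurable_fun setT (fun x => \int[leb]_(u in D) (a x * (f (u * k x) ^+ m * u `^ q))%:E)%E.
Proof.
have := @measurable_fun_fubini_tonelli_F _ _ _ _ _ leb g mg g0.
apply: eq_measurable_fun => x _; rewrite /fubini_F [RHS]integral_mkcond.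
by apply: eq_integral => u _; rewrite patchE gE.
Qed.

End tonelli.

Section moment_kernels.
Context d (T : measurableType d) (R : realType).
Variable mu : {sigma_finite_measure set T -> \bar R}.
Local Notation leb := (@lebesgue_measure R).
Local Notation D := (`]0%R, +oo[%classic : set R).
Local Notation m1 y := (Num.min 1 (y ^+ 2)).

Lemma measurable_normr_powR (k : T -> R) (p : R) : measurable_fun setT k ->
  measurable_fun setT (fun x => `|k x| `^ p).
Proof.
move=> mk; apply: (measurableT_comp (measurable_powR p)).
exact: measurableT_comp.
Qed.

(** The weight [a] serves for constants and for the factor [k ^+ 2] produced by the Stein
    identity. *)
Lemma moment_kernel_le (a k : T -> R) m (p : R) : measurable_fun setT a ->
  measurable_fun setT k -> (forall x, 0 <= a x) -> 0 < p -> p < 2 * m%:R ->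
  (\int[leb]_(u in D) \int[mu]_x (a x * (m1 (u * k x) ^+ m * u `^ (-1 - p)))%:E <=
   ((2 * m%:R - p)^-1 + p^-1)%:E * \int[mu]_x (a x * `|k x| `^ p)%:E)%E.
Proof.
move=> ma mk a0 p0 pm.
rewrite (tonelli_kernel mu m (-1 - p) ma mk (@measurable_min1sqr R) a0 (@min1sqr_ge0 R)).
have K0 : 0 <= (2 * m%:R - p)^-1 + p^-1 by rewrite addr_ge0 ?invr_ge0 ?subr_ge0 // ltW.
have mak : measurable_fun setT (fun x => (a x * `|k x| `^ p)%:E).
  apply/measurable_EFinP; apply: measurable_funM => //; exact: measurable_normr_powR.
have ak0 x : (0 <= (a x * `|k x| `^ p)%:E)%E by rewrite lee_fin mulr_ge0 ?powR_ge0.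
rewrite -ge0_integralZl_EFin //=.
have mker (x : R) := @measurable_power_kernel R (fun y => m1 y) m (-1 - p) x (@measurable_min1sqr R).
have ker0 (x u : R) : 0 <= m1 (u * x) ^+ m * u `^ (-1 - p).
  by rewrite mulr_ge0 ?powR_ge0 ?exprn_ge0 ?min1sqr_ge0.
apply: ge0_le_integral => //=.
- by move=> x _; apply: integral_ge0 => u _; rewrite lee_fin mulr_ge0.
- exact: (measurable_tonelli_integral m (-1 - p) ma mk (@measurable_min1sqr R) a0 (@min1sqr_ge0 R)).
- by apply: measurable_funeM.
- move=> x _; under eq_integral do rewrite EFinM.
  rewrite ge0_integralZl_EFin //=; last 2 first.
  + by move=> u _; rewrite lee_fin.
  + by apply/measurable_EFinP; apply: measurable_funTS; exact: mker.
  rewrite EFinM muleCA; apply: lee_wpmul2l; first by rewrite lee_fin.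
  by rewrite -EFinM; exact: integral_min1sqr_le.
Qed.

Lemma moment_kernel_ge (k : T -> R) m (p : R) : measurable_fun setT k -> 0 < p ->
  (((1 - cos 1) ^+ m * 2 `^ (-1 - p))%:E * \int[mu]_x (`|k x| `^ p)%:E <=
   \int[leb]_(u in D) \int[mu]_x (1 * ((1 - cos (u * k x)) ^+ m * u `^ (-1 - p)))%:E)%E.
Proof.
move=> mk p0.
have m1 := @measurable_cst _ _ T R setT (1 : R).
rewrite (tonelli_kernel mu m (-1 - p) m1 mk (@measurable_one_sub_cos R) (fun _ => ler01)
  (@one_sub_cos_ge0 R)).
have mkp : measurable_fun setT (fun x => (`|k x| `^ p)%:E).
  by apply/measurable_EFinP; exact: measurable_normr_powR.
rewrite -ge0_integralZl_EFin //=.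
apply: ge0_le_integral => //=.
- by apply: measurable_funeM; apply/measurable_EFinP; exact: measurable_normr_powR.
- exact: (measurable_tonelli_integral m (-1 - p) m1 mk (@measurable_one_sub_cos R)
    (fun _ => ler01) (@one_sub_cos_ge0 R)).
- move=> x _; under [X in (_ <= X)%E]eq_integral do rewrite mul1r.
  by rewrite -EFinM; exact: integral_one_sub_cos_ge.
Qed.

End moment_kernels.

Section moments.
Context d (Omega : measurableType d) (R : realType) (P : probability Omega R).
Context d' (E : measurableType d') (rho : {sigma_finite_measure set E -> \bar R}).
Local Notation leb := (@lebesgue_measure R).
Local Notation D := (`]0%R, +oo[%classic : set R).
Local Notation m1 y := (Num.min 1 (y ^+ 2)).

(* [X] has the law of the Poisson integral of [k] against a symmetrised Poisson
   random measure with intensity [rho]. *)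
Definition symmetric_id_law (X : Omega -> R) (k : E -> R) : Prop :=
  [/\ measurable_fun setT X, measurable_fun setT k,
      forall u : R, \int[P]_w cos (u * X w) = expR (- \int[rho]_x (1 - cos (u * k x)))
    & forall u : R, \int[P]_w sin (u * X w) = 0].

Lemma symmetric_id_law_scale (c : R) X k : symmetric_id_law X k ->
  symmetric_id_law (fun w => c * X w) (fun x => c * k x).
Proof.
move=> [mX mk cX sX]; split; [exact: measurable_funM|exact: measurable_funM|..] => u.
- under eq_Rintegral do rewrite mulrA.
  by rewrite cX; under eq_Rintegral do rewrite -mulrA.
- by under eq_Rintegral do rewrite mulrA; rewrite sX.
Qed.

Lemma moment_lt2 X k (p : R) : symmetric_id_law X k -> 0 < p -> p < 2 ->
  (((1 - cos 1) ^+ 1 * 2 `^ (-1 - p))%:E * \int[P]_w (`|X w| `^ p)%:E <=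
   (2 * ((2 * 1%:R - p)^-1 + p^-1))%:E * \int[rho]_x (`|k x| `^ p)%:E)%E.
Proof.
move=> [mX mk cX sX] p0 p2.
apply: (le_trans (moment_kernel_ge P 1 mX p0)).
have m2 := @measurable_cst _ _ E R setT (2 : R).
have m1' := @measurable_cst _ _ Omega R setT (1 : R).
have p2' : p < 2 * 1%:R by rewrite mulr1.
have := moment_kernel_le rho m2 mk (fun _ => ler0n _ 2) p0 p2'.
have -> : (\int[rho]_x (cst 2 x * `|k x| `^ p)%:E = 2%:E * \int[rho]_x (`|k x| `^ p)%:E)%E.
  by rewrite ge0_integralZl_fin //; exact: measurable_normr_powR.
rewrite muleA -EFinM [_ * 2]mulrC; apply: le_trans.
apply: ge0_le_integral => //=.
- move=> u _; apply: integral_ge0 => w _.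
  by rewrite lee_fin mul1r mulr_ge0 ?powR_ge0 ?exprn_ge0 ?one_sub_cos_ge0.
- exact: (measurable_integral_tonelli P 1 (-1 - p) m1' mX (@measurable_one_sub_cos R)
    (fun _ => ler01) (@one_sub_cos_ge0 R)).
- exact: (measurable_integral_tonelli rho 1 (-1 - p) m2 mk (@measurable_min1sqr R)
    (fun _ => ler0n _ 2) (@min1sqr_ge0 R)).
move=> u _; set v := u `^ _; have v0 : 0 <= v by exact: powR_ge0.
have ic : P.-integrable setT (EFin \o (fun w => 1 - cos (u * X w))).
  apply: (@bounded_integrable _ _ _ _ _ 2).
    by apply: measurable_funB => //; exact: measurable_cos_scale.
  by move=> w; rewrite ger0_norm ?one_sub_cos_ge0 //; have := cos_geN1 (u * X w); lra.
have -> : (\int[P]_x (1 * ((1 - cos (u * X x)) ^+ 1 * v))%:E =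
    ((\int[P]_x (1 - cos (u * X x))) * v)%:E)%E.
  rewrite -RintegralZr // EFin_Rintegral; last by have := integrableZr measurableT v ic.
  by apply: eq_integral => w _; rewrite mul1r expr1.
apply: (@le_trans _ _ (v%:E * \int[rho]_x (1 - cos (u * k x))%:E)%E); last first.
  have mc : measurable_fun setT (fun x => 1 - cos (u * k x)).
    by apply: measurable_funB => //; exact: measurable_cos_scale.
  rewrite -ge0_integralZl_fin //.
  apply: ge0_le_integral => //=.
  - by move=> x _; rewrite lee_fin mulr_ge0 ?one_sub_cos_ge0.
  - by apply/measurable_EFinP; exact: measurable_funM.
  - apply/measurable_EFinP; apply: measurable_funM => //; apply: measurable_funM => //.
    exact: measurable_m1.
  - move=> x _; rewrite lee_fin expr1 mulrC mulrA ler_wpM2r //.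
    exact: one_sub_cos_le_min.
rewrite mulrC EFinM; apply: lee_wpmul2l; first by rewrite lee_fin.
apply: (@le_trans _ _ (\int[rho]_x (1 - cos (u * k x)))%:E).
  rewrite lee_fin RintegralB //; last 2 first.
  - exact: finite_measure_integrable_cst.
  - apply: (@bounded_integrable _ _ _ _ _ 1); first exact: measurable_cos_scale.
    by move=> w; exact: cos_max.
  rewrite Rintegral_cst1 cX.
  by have := expR_ge1Dx (- \int[rho]_x (1 - cos (u * k x))); lra.
(* Were [1 - cos (u * k)] of infinite integral, its [Rintegral] would take the default value 0 and
   the extended integral would be [+oo]; the comparison holds in either case. *)
rewrite /Rintegral; set I := (\int[rho]_x _)%E.
have : (0 <= I)%E by apply: integral_ge0 => x _; rewrite lee_fin one_sub_cos_ge0.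
by case: I => [r| |] //=; rewrite ?leey.
Qed.

Lemma sqr_mul_powR (q y : R) : 2 < q -> y ^+ 2 * `|y| `^ (q - 2) = `|y| `^ q.
Proof.
move=> q2; have [->|y0] := eqVneq y 0.
  by rewrite normr0 expr0n /= mul0r powR0 // gt_eqF //; lra.
rewrite -[y ^+ 2]real_normK ?num_real // -powR_mulrn // -powRD_gt0 ?normr_gt0 //.
by congr powR; ring.
Qed.

(** The bound on the mean of [(1 - cos (u X)) ^+ n.+1] is integrated against [u^(-1 - q)]. Its
    factor [u ^+ 2] turns the weight into that of exponent [q - 2]: the truncated moment becomes the
    moment of order [q - 2], and [k ^+ 2] times the kernel of order [q - 2] becomes [|k|^q]. *)
Lemma moment_step X k (q : R) n : symmetric_id_law X k ->
  (\int[rho]_x (k x ^+ 2)%:E < +oo)%E -> 2 < q -> q - 2 < 2 * n%:R ->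
  (((1 - cos 1) ^+ n.+1 * 2 `^ (-1 - q))%:E * \int[P]_w (`|X w| `^ q)%:E <=
   (n.+1%:R * (n.*2.+1%:R * 8 ^+ n) * ((2 * n%:R - (q - 2))^-1 + (q - 2)^-1))%:E *
   (\int[rho]_x (k x ^+ 2)%:E * \int[P]_w (`|X w| `^ (q - 2))%:E +
    \int[rho]_x (`|k x| `^ q)%:E))%E.
Proof.
move=> [mX mk cX sX] k2 q2 qn.
have q0 : 0 < q by lra.
apply: (le_trans (moment_kernel_ge P n.+1 mX q0)).
set K2 := (\int[rho]_x (k x ^+ 2)%:E)%E.
have K20 : (0 <= K2)%E by apply: integral_ge0 => x _; rewrite lee_fin sqr_ge0.
have [c0 c0E] : exists c0 : R, c0 = n.+1%:R * (n.*2.+1%:R * 8 ^+ n) by eexists.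
rewrite -c0E; have c00 : 0 <= c0 by rewrite c0E mulr_ge0 // mulr_ge0 // exprn_ge0.
pose A u := (\int[P]_w (1 * (m1 (u * X w) ^+ n * u `^ (-1 - (q - 2))))%:E)%E.
pose B u := (\int[rho]_x (k x ^+ 2 * (m1 (u * k x) ^+ n * u `^ (-1 - (q - 2))))%:E)%E.
have A0 u : (0 <= A u)%E.
  apply: integral_ge0 => w _.
  by rewrite lee_fin mul1r mulr_ge0 ?powR_ge0 ?exprn_ge0 ?min1sqr_ge0.
have B0 u : (0 <= B u)%E.
  apply: integral_ge0 => w _.
  by rewrite lee_fin mulr_ge0 ?sqr_ge0 // mulr_ge0 ?powR_ge0 ?exprn_ge0 ?min1sqr_ge0.
have m1' := @measurable_cst _ _ Omega R setT (1 : R).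
have mk2 : measurable_fun setT (fun x => k x ^+ 2) by exact: measurable_funX.
have mA : measurable_fun D A.
  exact: (measurable_integral_tonelli P n (-1 - (q - 2)) m1' mX (@measurable_min1sqr R)
    (fun _ => ler01) (@min1sqr_ge0 R)).
have mB : measurable_fun D B.
  exact: (measurable_integral_tonelli rho n (-1 - (q - 2)) mk2 mk (@measurable_min1sqr R)
    (fun _ => sqr_ge0 _) (@min1sqr_ge0 R)).
have mKA : measurable_fun D (fun u => K2 * A u)%E by exact: measurable_funeM.
apply: (@le_trans _ _ (\int[leb]_(u in D) (c0%:E * (K2 * A u + B u)))%E).
  apply: ge0_le_integral => //=.
  - move=> u _; apply: integral_ge0 => w _.
    by rewrite lee_fin mul1r mulr_ge0 ?powR_ge0 ?exprn_ge0 ?one_sub_cos_ge0.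
  - exact: (measurable_integral_tonelli P n.+1 (-1 - q) m1' mX (@measurable_one_sub_cos R)
      (fun _ => ler01) (@one_sub_cos_ge0 R)).
  - by apply: measurable_funeM; exact: emeasurable_funD.
  move=> u; rewrite in_itv /= andbT => u0.
  have H := expectation_one_sub_cosX_le mX mk cX sX k2 n u0; rewrite -c0E in H.
  set v := u `^ (-1 - q); have v0 : 0 <= v by exact: powR_ge0.
  have ic : P.-integrable setT (EFin \o (fun w => (1 - cos (u * X w)) ^+ n.+1)).
    apply: (@bounded_integrable _ _ _ _ _ (2 ^+ n.+1)).
      by apply: measurable_funX; apply: measurable_funB => //; exact: measurable_cos_scale.
    move=> w; rewrite normrX lerXn2r ?nnegrE //.
    by rewrite ger0_norm ?one_sub_cos_ge0 //; have := cos_geN1 (u * X w); lra.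
  have -> : (\int[P]_x (1 * ((1 - cos (u * X x)) ^+ n.+1 * v))%:E =
      v%:E * (\int[P]_x (1 - cos (u * X x)) ^+ n.+1)%:E)%E.
    rewrite -EFinM mulrC -RintegralZr // EFin_Rintegral; last first.
      by have := integrableZr measurableT v ic.
    by apply: eq_integral => w _; rewrite mul1r.
  apply: (le_trans (lee_wpmul2l _ H)); first by rewrite lee_fin.
  have uv : u `^ (-1 - (q - 2)) = v * u ^+ 2.
    rewrite -(powR_mulrn 2 (ltW u0)) -powRD_gt0 //; congr powR; ring.
  set tm := truncated_moment P X n u.
  have tm0 : 0 <= tm by exact: truncated_moment_ge0.
  have mm1 : measurable_fun setT (fun x => m1 (u * k x) ^+ n) by exact: measurable_m1.
  have -> : (\int[rho]_x (k x ^+ 2 * (tm + m1 (u * k x) ^+ n))%:E =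
      K2 * tm%:E + \int[rho]_x (k x ^+ 2 * m1 (u * k x) ^+ n)%:E)%E.
    under eq_integral do rewrite mulrDr EFinD EFinM.
    rewrite ge0_integralD //=.
    - by rewrite ge0_integralZr // => [|x _]; [exact/measurable_EFinP|rewrite lee_fin sqr_ge0].
    - by move=> x _; rewrite -EFinM lee_fin mulr_ge0 ?sqr_ge0.
    - by apply/measurable_EFinP; exact: measurable_funM.
    - by move=> x _; rewrite lee_fin mulr_ge0 ?sqr_ge0 ?exprn_ge0 ?min1sqr_ge0.
    - by apply/measurable_EFinP; exact: measurable_funM.
  have AE : (A u = (u `^ (-1 - (q - 2)))%:E * tm%:E)%E.
    rewrite -EFinM mulrC /tm /truncated_moment -RintegralZr ?integrable_m1 //.
    rewrite EFin_Rintegral; last first.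
      by have := integrableZr measurableT (u `^ (-1 - (q - 2))) (integrable_m1 P mX n u).
    by apply: eq_integral => w _; rewrite mul1r.
  have BE : B u = ((u `^ (-1 - (q - 2)))%:E *
      \int[rho]_x (k x ^+ 2 * m1 (u * k x) ^+ n)%:E)%E.
    rewrite -ge0_integralZl_fin ?powR_ge0 //.
    - by apply: eq_integral => x _; congr EFin; ring.
    - exact: measurable_funM.
    - by move=> x; rewrite mulr_ge0 ?sqr_ge0 ?exprn_ge0 ?min1sqr_ge0.
  set J := (\int[rho]_x _)%E in BE *.
  have J0 : (0 <= J)%E.
    by apply: integral_ge0 => x _; rewrite lee_fin mulr_ge0 ?sqr_ge0 ?exprn_ge0 ?min1sqr_ge0.
  rewrite AE BE uv (muleCA K2) -ge0_muleDr ?mule_ge0 ?lee_fin // !muleA -!EFinM.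
  by rewrite (_ : v * (c0 * u ^+ 2) = c0 * (v * u ^+ 2)) //; ring.
rewrite ge0_integralZl_EFin //=; last 2 first.
- by move=> u _; rewrite adde_ge0 ?mule_ge0.
- exact: emeasurable_funD.
rewrite EFinM -muleA; apply: lee_wpmul2l; first by rewrite lee_fin.
rewrite ge0_integralD //=; last by move=> u _; rewrite mule_ge0.
rewrite ge0_integralZl //=.
have q20 : 0 < q - 2 by lra.
have H1 := moment_kernel_le P m1' mX (fun _ => ler01) q20 qn.
have H2 := moment_kernel_le rho mk2 mk (fun _ => sqr_ge0 _) q20 qn.
set K := ((_^-1 + _^-1)%:E)%E in H1 H2 *.
have K0 : (0 <= K)%E by rewrite lee_fin addr_ge0 ?invr_ge0 ?subr_ge0 // ltW.
rewrite [X in (_ <= X)%E]ge0_muleDr; last 2 first.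
- by rewrite mule_ge0 // integral_ge0 // => w _; rewrite lee_fin powR_ge0.
- by apply: integral_ge0 => w _; rewrite lee_fin powR_ge0.
apply: leeD.
- rewrite muleCA; apply: lee_wpmul2l => //; apply: (le_trans H1).
  by under eq_integral do rewrite mul1r.
- apply: (le_trans H2); apply: lee_wpmul2l => //; rewrite le_eqVlt; apply/orP; left.
  by apply/eqP; apply: eq_integral => x _; rewrite sqr_mul_powR.
Qed.

(** The constant is fixed before [X] and [k]; the later rescaling of the integrand relies on this
    uniformity. *)
Definition moment_bound (p K q C : R) : Prop := forall X k, symmetric_id_law X k ->
  (\int[rho]_x (k x ^+ 2)%:E <= K%:E)%E ->
  (\int[rho]_x (`|k x| `^ p)%:E <= K%:E)%E ->
  (\int[P]_w (`|X w| `^ q)%:E <= C%:E)%E.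

Lemma powR_le1Dsqr (q y : R) : 0 < q -> q <= 2 -> `|y| `^ q <= 1 + y ^+ 2.
Proof.
move=> q0 q2; have [y1|y1] := leP `|y| 1.
  apply: (@le_trans _ _ 1); last by rewrite lerDl sqr_ge0.
  have : `|y| `^ q <= 1 `^ q by rewrite ge0_ler_powR ?nnegrE // ltW.
  by rewrite powR1.
apply: (@le_trans _ _ (y ^+ 2)); last by rewrite lerDr.
rewrite -[y ^+ 2]real_normK ?num_real // -powR_mulrn //.
by apply: ler_powR => //; exact: ltW.
Qed.

Lemma powR_le_sqrD (q p y : R) : 2 <= q -> q <= p -> `|y| `^ q <= y ^+ 2 + `|y| `^ p.
Proof.
move=> q2 qp; have [y1|y1] := leP `|y| 1.
  apply: (@le_trans _ _ (y ^+ 2)); last by rewrite lerDl powR_ge0.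
  have [->|y0] := eqVneq y 0; first by rewrite normr0 powR0 ?expr0n //= gt_eqF //; lra.
  rewrite -[y ^+ 2]real_normK ?num_real // -powR_mulrn //.
  by apply: ger_powR => //; rewrite normr_gt0 y0.
apply: (@le_trans _ _ (`|y| `^ p)); last by rewrite lerDr sqr_ge0.
by apply: ler_powR => //; exact: ltW.
Qed.

Lemma moment_bound_le2 (p K q : R) : 0 <= K -> 0 < q -> q <= 2 ->
  moment_bound p K q (1 + 2 / cos 1 ^+ 2 * K).
Proof.
move=> K0 q0 q2 X k [mX mk cX sX] k2 _.
have k2y : (\int[rho]_x (k x ^+ 2)%:E < +oo)%E by rewrite (le_lt_trans k2) ?ltry.
apply: (@le_trans _ _ (\int[P]_w (1 + X w ^+ 2)%:E)%E).
  apply: ge0_le_integral => //=.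
  - by apply/measurable_EFinP; exact: measurable_normr_powR.
  - by apply/measurable_EFinP; apply: measurable_funD => //; exact: measurable_funX.
  - by move=> w _; rewrite lee_fin powR_le1Dsqr.
under eq_integral do rewrite EFinD.
rewrite ge0_integralD //=; last 2 first.
- by move=> w _; rewrite lee_fin sqr_ge0.
- by apply/measurable_EFinP; exact: measurable_funX.
rewrite integral_cst //= (@probability_setT _ _ _ P) mul1e EFinD leeD2l //.
apply: (le_trans (second_moment_le mX mk cX k2y)).
rewrite [leRHS]EFinM; apply: lee_wpmul2l => //.
by rewrite lee_fin divr_ge0 // exprn_ge0 // ltW // cos1_gt0.
Qed.

(** Each use of [moment_step] lowers the exponent by 2, down to the range where the second moment
    suffices; [N] counts these steps. Intermediate powers obey [|k|^q <= k^2 + |k|^p], so the two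
    integrals bounded by [K] control them all. *)
Lemma moment_bound_exists (p K : R) : 2 <= p -> 0 <= K -> forall N (q : R),
  0 < q -> q <= 2 * N%:R -> q <= p -> exists C, moment_bound p K q C.
Proof.
move=> p2 K0; elim=> [|N IH] q q0 qN qp; first by exfalso; lra.
have [q2|q2] := leP q 2; first by eexists; exact: moment_bound_le2.
have [||| C HC] := IH (q - 2); [lra| |lra|].
  by move: qN; rewrite -natr1 => qN; lra.
(* Only [q - 2 < 2 * n] matters, the condition for the frequency integral to converge at 0. *)
pose n := (Num.truncn q).+1.
have qn : q < n%:R by exact: truncnS_gt.
pose c : R := (1 - cos 1) ^+ n.+1 * 2 `^ (-1 - q).
have c0 : 0 < c by rewrite mulr_gt0 ?powR_gt0 // exprn_gt0 // cos1_lt1.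
pose c' : R := n.+1%:R * (n.*2.+1%:R * 8 ^+ n) * ((2 * n%:R - (q - 2))^-1 + (q - 2)^-1).
have c'0 : 0 <= c'.
  rewrite mulr_ge0 ?mulr_ge0 ?exprn_ge0 // addr_ge0 ?invr_ge0 //; lra.
exists (c' * (K * C + (K + K)) / c) => X k XK k2 kp.
have k2y : (\int[rho]_x (k x ^+ 2)%:E < +oo)%E by rewrite (le_lt_trans k2) ?ltry.
have qn' : q - 2 < 2 * n%:R by lra.
have := moment_step XK k2y q2 qn'; rewrite -/c -/c' => H.
rewrite -(@lee_pmul2l _ c%:E) ?lte_fin //; apply: (le_trans H).
rewrite -EFinM (_ : c * _ = c' * (K * C + (K + K))); last by field; rewrite gt_eqF.
rewrite [leRHS]EFinM; apply: lee_wpmul2l; first by rewrite lee_fin.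
rewrite EFinD; apply: leeD.
- rewrite EFinM; apply: lee_pmul => //.
  + by apply: integral_ge0 => x _; rewrite lee_fin sqr_ge0.
  + by apply: integral_ge0 => x _; rewrite lee_fin powR_ge0.
  + exact: HC XK k2 kp.
- have [_ mk _ _] := XK.
  apply: (@le_trans _ _ (\int[rho]_x (k x ^+ 2 + `|k x| `^ p)%:E)%E).
    apply: ge0_le_integral => //=.
    + by apply/measurable_EFinP; exact: measurable_normr_powR.
    + apply/measurable_EFinP; apply: measurable_funD; last exact: measurable_normr_powR.
      exact: measurable_funX.
    + by move=> w _; rewrite lee_fin powR_le_sqrD // ltW.
  under eq_integral do rewrite EFinD.
  rewrite ge0_integralD //=.
  + by rewrite EFinD; exact: leeD.
  + by move=> w _; rewrite lee_fin sqr_ge0.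
  + by apply/measurable_EFinP; exact: measurable_funX.
  + by apply/measurable_EFinP; exact: measurable_normr_powR.
Qed.

End moments.

(** * Characteristic functions of random measures *)

Section bounded_expectation.
Context d (Omega : measurableType d) (R : realType) (P : probability Omega R).

Lemma cvg_Rintegral d0 (T : measurableType d0) (mu : {measure set T -> \bar R})
    (f_ : nat -> T -> R) (f g : T -> R) :
  (forall n, measurable_fun setT (f_ n)) -> measurable_fun setT f ->
  mu.-integrable setT (EFin \o g) -> (forall n x, `|f_ n x| <= g x) ->
  {ae mu, forall x, f_ n x @[n --> \oo] --> f x} ->
  \int[mu]_x f_ n x @[n --> \oo] --> \int[mu]_x f x.
Proof.
move=> mf_ mf ig fg ff.
have [] := @dominated_convergence _ _ _ mu setT measurableT
  (fun n x => (f_ n x)%:E) (EFin \o f) (EFin \o g).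
- by move=> n; exact/measurable_EFinP.
- exact/measurable_EFinP.
- by apply: filterS ff => x fx _; apply: cvg_EFin; [exact: nearW|exact: fx].
- exact: ig.
- by apply: aeW => x n _; rewrite /= lee_fin.
move=> intf _ cf; apply: fine_cvg.
by move: cf => /=; rewrite -(fineK (integrable_fin_num measurableT intf)).
Qed.

Lemma cvg_bounded_expectation (f_ : nat -> Omega -> R) (f : Omega -> R) (M : R) :
  (forall n, measurable_fun setT (f_ n)) -> measurable_fun setT f ->
  (forall n w, `|f_ n w| <= M) -> {ae P, forall w, f_ n w @[n --> \oo] --> f w} ->
  \int[P]_w f_ n w @[n --> \oo] --> \int[P]_w f w.
Proof.
move=> mf_ mf fM; apply: (@cvg_Rintegral _ _ _ _ _ (cst M)) => //.
exact: finite_measure_integrable_cst.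
Qed.

Lemma Rintegral_indic (A : set Omega) : measurable A ->
  \int[P]_w \1_A w = fine (P A).
Proof. by move=> mA; rewrite /Rintegral integral_indic // setIT. Qed.

Section test_functions.
Import HBNNSimple.
Variables (W X : Omega -> R) (c K : R).
Hypotheses (mW : measurable_fun setT W) (mX : measurable_fun setT X).
Hypothesis WK : forall w, `|W w| <= K.
Hypothesis WX : forall B : set R, measurable B ->
  \int[P]_w (W w * \1_B (X w)) = c * \int[P]_w \1_B (X w).

Let mcomp (h : R -> R) : measurable_fun setT h -> measurable_fun setT (fun w => h (X w)).
Proof. by move=> mh; exact: measurableT_comp. Qed.

Let K0 : 0 <= K.
Proof. by rewrite (le_trans _ (WK point)). Qed.

Let iW (h : R -> R) H : measurable_fun setT h -> (forall y, `|h y| <= H) ->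
  P.-integrable setT (EFin \o (fun w => W w * h (X w))).
Proof.
move=> mh hH; apply: (@bounded_integrable _ _ _ _ _ (K * H)).
  by apply: measurable_funM => //; exact: mcomp.
by move=> w; rewrite normrM ler_pM.
Qed.

Let ih (h : R -> R) H : measurable_fun setT h -> (forall y, `|h y| <= H) ->
  P.-integrable setT (EFin \o (fun w => h (X w))).
Proof.
by move=> mh hH; apply: (@bounded_integrable _ _ _ _ _ H) => //; exact: mcomp.
Qed.

Let seq_indic (s : seq R) (B : R -> set R) : (forall y, measurable (B y)) ->
  \int[P]_w (W w * \sum_(y <- s) y * \1_(B y) (X w)) =
  c * \int[P]_w \sum_(y <- s) y * \1_(B y) (X w).
Proof.
move=> mB.
have mi y : measurable_fun setT (\1_(B y) : R -> R) by exact: measurable_indic.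
have bi y x : `|\1_(B y) x| <= 1 :> R by rewrite indicE; case: (_ \in _); rewrite ?normr0 ?normr1.
have ms s' : measurable_fun setT (fun x : R => \sum_(y <- s') y * \1_(B y) x).
  by apply: measurable_sum => y; exact: measurable_funM.
have bs s' x : `|\sum_(y <- s') y * \1_(B y) x| <= \sum_(y <- s') `|y|.
  apply: (le_trans (ler_norm_sum _ _ _)); apply: ler_sum => y _.
  by rewrite normrM ler_piMr.
elim: s => [|y s IH].
  under eq_Rintegral do rewrite big_nil mulr0.
  under [in RHS]eq_Rintegral do rewrite big_nil.
  by rewrite Rintegral_cst1 mulr0.
under eq_Rintegral do rewrite big_cons mulrDr mulrCA.
under [in RHS]eq_Rintegral do rewrite big_cons.
have i1 := iW (mi y) (bi y); have i2 := ih (mi y) (bi y).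
rewrite RintegralD //; last 2 first.
- by have := integrableZl measurableT y i1.
- exact: iW (ms s) (bs s).
rewrite IH RintegralZl // WX // RintegralD //; last 2 first.
- by have := integrableZl measurableT y i2.
- exact: ih (ms s) (bs s).
by rewrite RintegralZl // mulrDr mulrCA.
Qed.

Let nonneg (h : R -> R) H : measurable_fun setT h -> (forall y, 0 <= h y <= H) ->
  \int[P]_w (W w * h (X w)) = c * \int[P]_w h (X w).
Proof.
move=> mh hH.
have mhE : measurable_fun setT (EFin \o h) by exact/measurable_EFinP.
pose g := nnsfun_approx measurableT mhE.
have gcvg x : g n x @[n --> \oo] --> h x.
  have cv : (EFin \o (fun n => g n x)) @ \oo --> (h x)%:E.
    by apply: (@cvg_nnsfun_approx _ _ _ setT measurableT (EFin \o h) mhE _ x Logic.I) => y _; rewrite lee_fin; case/andP: (hH y).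
  exact: (fine_cvg cv).
have gle n x : 0 <= g n x <= H.
  apply/andP; split; first exact: fun_ge0.
  case/andP: (hH x) => _; apply: le_trans.
  have nd : nondecreasing_seq (fun n => g n x).
    by move=> i j ij; exact/lefP/nd_nnsfun_approx.
  rewrite -(cvg_lim _ (gcvg x)) //; apply: nondecreasing_cvgn_le => //.
  by apply/cvg_ex; exists (h x); exact: gcvg.
have gn n x : `|g n x| <= H.
  by case/andP: (gle n x) => g0 gH; rewrite ger0_norm.
have H1 n : \int[P]_w (W w * g n (X w)) = c * \int[P]_w g n (X w).
  under eq_Rintegral => w _.
    rewrite (fimfunE (g n)) fsbig_finite //=; over.
  under [in RHS]eq_Rintegral => w _.
    rewrite (fimfunE (g n)) fsbig_finite //=; over.
  by apply: (seq_indic _ (B := fun y => g n @^-1` [set y])) => y.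
have c1 : \int[P]_w (W w * g n (X w)) @[n --> \oo] --> \int[P]_w (W w * h (X w)).
  apply: (@cvg_bounded_expectation _ _ (K * H)).
  - by move=> n; apply: measurable_funM => //; exact: mcomp.
  - by apply: measurable_funM => //; exact: mcomp.
  - by move=> n w; rewrite normrM ler_pM.
  - by apply: aeW => w; apply: cvgM; [exact: cvg_cst|exact: gcvg].
have c2 : \int[P]_w g n (X w) @[n --> \oo] --> \int[P]_w h (X w).
  apply: (@cvg_bounded_expectation _ _ H) => //.
  - by move=> n; exact: mcomp.
  - exact: mcomp.
  - by apply: aeW => w; exact: gcvg.
have c3 : c * \int[P]_w g n (X w) @[n --> \oo] --> c * \int[P]_w h (X w).
  by apply: cvgM => //; exact: cvg_cst.
rewrite -(cvg_lim _ c1) // -(cvg_lim _ c3) //; congr (lim _).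
by under eq_fun do rewrite H1.
Qed.

(** Independence is given on events but needed for trigonometric functions. The identity passes from
    indicators to simple functions, then to nonnegative bounded ones by dominated convergence, and
    finally to [h] through [h + H]. *)
Lemma bounded_test_function (h : R -> R) H : measurable_fun setT h ->
  (forall y, `|h y| <= H) -> \int[P]_w (W w * h (X w)) = c * \int[P]_w h (X w).
Proof.
move=> mh hH.
have E1 := @nonneg (fun y => h y + H) (H + H).
have E2 := @nonneg (fun=> H) H.
have H0 : 0 <= H by rewrite (le_trans _ (hH 0)).
have {}E1 := E1 (measurable_funD mh (measurable_cst _)).
have {}E1 : \int[P]_w (W w * (h (X w) + H)) = c * \int[P]_w (h (X w) + H).
  by apply: E1 => y; have := hH y; rewrite ler_norml => /andP[hl hr]; rewrite lerD2r hr andbT addrC -lerBlDl sub0r.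
have {}E2 : \int[P]_w (W w * H) = c * \int[P]_w H.
  by apply: E2 => // y; rewrite lexx H0.
have iH : P.-integrable setT (EFin \o (fun w => W w * H)).
  apply: (@iW (fun=> H) H) => // y; by rewrite ger0_norm.
move: E1; under eq_Rintegral do rewrite mulrDr.
have j1 := iW mh hH; have j2 := ih mh hH.
have j3 : P.-integrable setT (EFin \o (fun=> H)) by exact: finite_measure_integrable_cst.
by rewrite (RintegralD measurableT j1 iH) (RintegralD measurableT j2 j3) E2 mulrDr => /addIr.
Qed.

End test_functions.

(** All sine means vanish, so in the addition formulas only the product of cosine means survives,
    and no complex-valued expectation is needed. *)
Lemma charfun_sum (X : nat -> Omega -> R) (theta c : nat -> R) (N : nat) :
  (forall i, measurable_fun setT (X i)) -> mutually_independent P X ->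
  (forall i, \int[P]_w cos (theta i * X i w) = c i) ->
  (forall i, \int[P]_w sin (theta i * X i w) = 0) ->
  \int[P]_w cos (\sum_(i < N) theta i * X i w) = \prod_(i < N) c i /\
  \int[P]_w sin (\sum_(i < N) theta i * X i w) = 0.
Proof.
move=> mX ind cE sE.
pose S n w := \sum_(i < n) theta i * X i w.
pose I n (B : nat -> set R) w : R := \prod_(n <= i < N) \1_(B i) (X i w).
have mS n : measurable_fun setT (S n).
  by apply: measurable_sum => i; exact: measurable_funM.
have mcS n : measurable_fun setT (fun w => cos (S n w)).
  by apply: measurableT_comp => //; apply: continuous_measurable_fun; exact: continuous_cos.
have msS n : measurable_fun setT (fun w => sin (S n w)).
  by apply: measurableT_comp => //; apply: continuous_measurable_fun; exact: continuous_sin.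
have mI n B : (forall i, measurable (B i)) -> measurable_fun setT (I n B).
  move=> mB; apply: measurable_prod => i _.
  by apply: measurableT_comp => //; exact: measurable_indic.
have bI n B w : `|I n B w| <= 1.
  rewrite /I; elim/big_ind : _ => [|x y x1 y1|i _]; first by rewrite normr1.
    by rewrite normrM mulr_ile1.
  by rewrite indicE; case: (_ \in _); rewrite ?normr0 ?normr1.
(* The first [n] variables enter through the cosine or sine of their sum, the others still through
   indicators. Each step of the induction trades one indicator for a trigonometric function. *)
suff J n : (n <= N)%N -> forall B : nat -> set R, (forall i, measurable (B i)) ->
    \int[P]_w (cos (S n w) * I n B w) =
      \prod_(i < n) c i * \prod_(n <= i < N) fine (P (X i @^-1` B i)) /\
    \int[P]_w (sin (S n w) * I n B w) = 0.
  have [] := J N (leqnn N) (fun=> setT) (fun=> measurableT).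
  rewrite [X in _ * X]big_geq // mulr1.
  by under eq_Rintegral do rewrite /I big_geq // mulr1; under [X in _ -> X = 0 -> _]eq_Rintegral do rewrite /I big_geq // mulr1.
elim: n => [_|n IH nN] B mB.
  have S0 w : S 0%N w = 0 by rewrite /S big_ord0.
  split; last first.
    by under eq_Rintegral do rewrite S0 sin0 mul0r; rewrite Rintegral_cst1.
  under eq_Rintegral do rewrite S0 cos0 mul1r.
  rewrite big_ord0 mul1r.
  have mXB i : measurable (X i @^-1` B i) by rewrite -[X in measurable X]setTI; exact: mX.
  have IE w : I 0%N B w = \1_(\bigcap_(i in [set` index_iota 0 N]) (X i @^-1` B i)) w.
    rewrite /I; elim: (index_iota 0 N) => [|i s IHs].
      by rewrite big_nil indicE mem_set.
    rewrite big_cons IHs !indicE -natrM mulnb; congr (_%:R); congr nat_of_bool.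
    apply/andP/idP; rewrite !inE.
      move=> [Bi Bs] j /=; rewrite inE => /orP[/eqP -> //|js]; exact: Bs.
    move=> Bs; split; first by apply: (Bs i) => /=; rewrite inE eqxx.
    by move=> j /= js; apply: Bs => /=; rewrite inE js orbT.
  under eq_Rintegral do rewrite IE.
  rewrite Rintegral_indic; last first.
    by rewrite bigcap_mkcond; apply: bigcapT_measurable => i; case: ifP.
  rewrite ind ?iota_uniq //.
  rewrite (_ : (\prod_(i <- _) _)%E = (\prod_(0 <= i < N) fine (P (X i @^-1` B i)))%:E) //.
  rewrite -prodEFin; apply: eq_bigr => i _; rewrite fineK //; exact: fin_num_measure.
have nN' : (n <= N)%N by exact: ltnW.
have WX (trg : R -> R) (tm : R) : (forall y, `|trg y| <= 1) ->
    measurable_fun setT (fun w => trg (S n w)) ->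
    (forall B, (forall i, measurable (B i)) ->
     \int[P]_w (trg (S n w) * I n B w) = tm * \prod_(n <= i < N) fine (P (X i @^-1` B i))) ->
    forall h : R -> R, measurable_fun setT h -> (forall y, `|h y| <= 1) ->
    \int[P]_w (trg (S n w) * I n.+1 B w * h (X n w)) =
    tm * \prod_(n.+1 <= i < N) fine (P (X i @^-1` B i)) * \int[P]_w h (X n w).
  move=> bt mt HB h mh hb.
  apply: (@bounded_test_function _ _ _ 1 _ _ _ _ h 1) => //.
  - by apply: measurable_funM => //; exact: mI.
  - by move=> w; rewrite normrM mulr_ile1.
  - move=> B' mB'.
    (* Letting the [n]-th set vary in the induction hypothesis yields the identity on indicators
       that [bounded_test_function] extends. *)
    pose B1 i := if i == n then B' else B i.
    have mB1 i : measurable (B1 i) by rewrite /B1; case: ifP.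
    have B1n : B1 n = B' by rewrite /B1 eqxx.
    have := HB B1 mB1; rewrite (big_ltn nN) B1n.
    have -> : \prod_(n.+1 <= i < N) fine (P (X i @^-1` B1 i)) =
        \prod_(n.+1 <= i < N) fine (P (X i @^-1` B i)).
      apply: eq_big_nat => i /andP[ni _]; rewrite /B1; case: eqP => // E.
      by rewrite E ltnn in ni.
    have -> : \int[P]_w \1_B' (X n w) = fine (P (X n @^-1` B')).
      have <- : \int[P]_w \1_(X n @^-1` B') w = fine (P (X n @^-1` B')).
        by rewrite Rintegral_indic // -[X in measurable X]setTI; exact: mX.
      by apply: eq_Rintegral => w _; rewrite !indicE.
    rewrite -mulrA [_ * fine _]mulrC => <-; apply: eq_Rintegral => w _.
    rewrite /I (big_ltn nN) B1n -mulrA [_ * \1_B' _]mulrC; congr (_ * (_ * _)).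
    apply: eq_big_nat => i /andP[ni _]; rewrite /B1; case: eqP => // E.
    by rewrite E ltnn in ni.
have mcosn : measurable_fun setT (fun y : R => cos (theta n * y)).
  exact: measurable_cos_scale.
have msinn : measurable_fun setT (fun y : R => sin (theta n * y)).
  exact: measurable_sin_scale.
have Ec := WX cos (\prod_(i < n) c i) (@cos_max R) (mcS n)
  (fun B mB => (IH nN' B mB).1).
have Es := WX sin 0 (@sin_max R) (msS n)
  (fun B mB => etrans (IH nN' B mB).2 (esym (mul0r _))).
have Ecc := Ec _ mcosn (fun y => cos_max _); have Ecs := Ec _ msinn (fun y => sin_max _).
have Esc := Es _ mcosn (fun y => cos_max _); have Ess := Es _ msinn (fun y => sin_max _).
rewrite cE in Ecc Esc; rewrite sE mulr0 in Ecs Ess; rewrite !mul0r in Esc Ess.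
have SS w : S n.+1 w = S n w + theta n * X n w by rewrite /S big_ord_recr.
have int3 (f g : R -> R) (k : nat) : measurable_fun setT (fun w => f (S n w)) ->
    (forall y, `|f y| <= 1) -> measurable_fun setT g -> (forall y, `|g y| <= 1) ->
    P.-integrable setT (EFin \o (fun w => f (S n w) * I k B w * g (X n w))).
  move=> mf bf mg bg; apply: (@bounded_integrable _ _ _ _ _ 1).
    by apply: measurable_funM; [apply: measurable_funM => //; exact: mI|exact: measurableT_comp].
  by move=> w; rewrite !normrM mulr_ile1 // ?mulr_ge0 // mulr_ile1.
split.
- have -> : \int[P]_w (cos (S n.+1 w) * I n.+1 B w) =
      \int[P]_w (cos (S n w) * I n.+1 B w * cos (theta n * X n w) -
                 sin (S n w) * I n.+1 B w * sin (theta n * X n w)).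
    by apply: eq_Rintegral => w _; rewrite SS cosD; ring.
  rewrite RintegralB //; [|by apply: (int3 cos _ _ (mcS n) (@cos_max R) mcosn) => y; exact: cos_max
    |by apply: (int3 sin _ _ (msS n) (@sin_max R) msinn) => y; exact: sin_max].
  by rewrite Ecc Ess subr0 big_ord_recr /=; ring.
- have -> : \int[P]_w (sin (S n.+1 w) * I n.+1 B w) =
      \int[P]_w (sin (S n w) * I n.+1 B w * cos (theta n * X n w) +
                 cos (S n w) * I n.+1 B w * sin (theta n * X n w)).
    by apply: eq_Rintegral => w _; rewrite SS sinD; ring.
  rewrite RintegralD //; [|by apply: (int3 sin _ _ (msS n) (@sin_max R) mcosn) => y; exact: cos_max
    |by apply: (int3 cos _ _ (mcS n) (@cos_max R) msinn) => y; exact: sin_max].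
  by rewrite Esc Ecs addr0.
Qed.

End bounded_expectation.

Section symmetric_levy.
Context d (Omega : measurableType d) (R : realType) (P : probability Omega R).

Definition levy_symbol (nu : {measure set R -> \bar R}) (u : R) : R :=
  \int[nu]_x (1 - cos (u * x)).

Lemma ge0_integral_opp (nu : {measure set R -> \bar R}) (f : R -> \bar R) :
  symmetric_measure nu -> measurable_fun setT f -> (forall x, 0 <= f x)%E ->
  (\int[nu]_x f (- x)%R = \int[nu]_x f x)%E.
Proof.
move=> snu mf f0.
have mN : measurable_fun [set: R] (@GRing.opp R) by exact: measurable_funN.
transitivity (\int[pushforward nu (@GRing.opp R)]_x f x)%E.
  by rewrite (ge0_integral_pushforward mN nu measurableT mf).
by apply: eq_measure_integral => A mA _; exact: snu.
Qed.

(** By symmetry the positive and negative parts have the same integral. If it is infinite, their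
    difference is still an infinity by convention, and its [fine] value is 0. *)
Lemma Rintegral_odd (nu : {measure set R -> \bar R}) (f : R -> R) :
  symmetric_measure nu -> measurable_fun setT f -> (forall x, f (- x) = - f x) ->
  \int[nu]_x f x = 0.
Proof.
move=> snu mf fN; rewrite /Rintegral integralE.
have mfE : measurable_fun setT (EFin \o f) by exact/measurable_EFinP.
have -> : (\int[nu]_x (EFin \o f)^\- x = \int[nu]_x (EFin \o f)^\+ x)%E.
  rewrite -(ge0_integral_opp snu (measurable_funepos mfE)) //.
  by apply: eq_integral => x _; rewrite funenegE funeposE /= fN.
have : (0 <= \int[nu]_x (EFin \o f)^\+ x)%E.
  by apply: integral_ge0 => x _; exact: funepos_ge0.
by case: (\int[nu]_x _)%E => [r| |] // _; rewrite -EFinB subrr.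
Qed.

Lemma levy_truncE (x : R) : levy_trunc x = Num.max (-1) (Num.min 1 x).
Proof.
rewrite /levy_trunc; have [x1|x1] := leP `|x| 1.
  by move: x1; rewrite ler_norml => /andP[x1 x2]; rewrite min_r // max_r.
have [x0|x0] := leP 0 x.
  rewrite ger0_norm // in x1 *; rewrite divff ?gt_eqF // ?(lt_trans ltr01) //.
  by rewrite min_l ?max_r ?(ltW x1) //; lra.
rewrite ltr0_norm // in x1 *; rewrite invrN mulrN divff ?lt_eqF //.
by rewrite min_r ?max_l //; lra.
Qed.

Lemma measurable_levy_trunc : measurable_fun setT (@levy_trunc R).
Proof.
rewrite (_ : @levy_trunc R = fun x => Num.max (-1) (Num.min 1 x)).
  by apply: measurable_maxr => //; exact: measurable_minr.
by apply/funext => x; exact: levy_truncE.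
Qed.

Lemma levy_truncN (x : R) : levy_trunc (- x) = - levy_trunc x.
Proof. by rewrite /levy_trunc normrN; case: ifP => // _; rewrite mulNr. Qed.

Lemma eq_law_Rintegral (X Y : Omega -> R) (h : R -> R) (H : R) :
  measurable_fun setT X -> measurable_fun setT Y -> measurable_fun setT h ->
  (forall y, `|h y| <= H) ->
  (forall B, measurable B -> P (X @^-1` B) = P (Y @^-1` B)) ->
  \int[P]_w h (X w) = \int[P]_w h (Y w).
Proof.
move=> mX mY mh hH XY; congr fine.
have mhE : measurable_fun setT (EFin \o h) by exact/measurable_EFinP.
have i V : measurable_fun setT V -> P.-integrable (V @^-1` setT) ((EFin \o h) \o V).
  move=> mV; rewrite preimage_setT.
  by apply: (@bounded_integrable _ _ _ P (fun w => h (V w)) H) => //; exact: measurableT_comp.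
have EX := integral_pushforward mX mhE (i X mX) measurableT.
have EY := integral_pushforward mY mhE (i Y mY) measurableT.
rewrite preimage_setT in EX EY; rewrite -[LHS]EX -[RHS]EY.
by apply: eq_measure_integral => A mA _; exact: XY.
Qed.

(** The imaginary part of the exponent is the integral of [sin (u x) - u * levy_trunc x], an odd
    function, and so vanishes for symmetric [nu]; the real part is [- levy_symbol nu u]. *)
Lemma levy_charfun (T : R) (Z : R -> {RV P >-> R}) (nu : {measure set R -> \bar R}) (t u : R) :
  has_triplet T Z 0 0 nu -> symmetric_measure nu -> 0 <= t <= T ->
  \int[P]_w cos (u * Z t w) = expR (- (t * levy_symbol nu u)) /\
  \int[P]_w sin (u * Z t w) = 0.
Proof.
move=> hZ snu tT; have := hZ t u tT.
rewrite /char_fun /Cintegral /levy_exponent /Cexp /=.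
set I := \int[nu]_x (expR 0 * cos (u * x) - 1 - 0).
set J := \int[nu]_x (expR 0 * sin (u * x) - 0 - u * levy_trunc x).
have -> : I = - levy_symbol nu u.
  rewrite /I /levy_symbol /Rintegral.
  under eq_integral do rewrite expR0 mul1r subr0 -opprB EFinN.
  by rewrite integral_ge0N ?fineN // => x _; rewrite lee_fin one_sub_cos_ge0.
have -> : J = 0.
  apply: (Rintegral_odd snu).
    apply: measurable_funB; last exact: measurable_funM measurable_levy_trunc.
    by apply: measurable_funB => //; apply: measurable_funM => //; exact: measurable_sin_scale.
  by move=> x; rewrite levy_truncN mulrN sinN; ring.
rewrite expR0 !mul0r !mulr0 !sub0r !subr0 !addr0 ?add0r ?oppr0 ?mulr0 ?add0r ?addr0.
rewrite cos0 sin0 !mulr1 mulr0 mulrN => -[Hc Hs]; split.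
  by rewrite -Hc; apply: eq_Rintegral => w _; rewrite mul1r.
by rewrite -Hs; apply: eq_Rintegral => w _; rewrite mul1r.
Qed.

Lemma levy_increment_charfun (T : R) (Z : R -> {RV P >-> R}) (nu : {measure set R -> \bar R})
    (r s u : R) :
  levy_process T Z -> has_triplet T Z 0 0 nu -> symmetric_measure nu ->
  0 <= r -> r <= s -> s <= T ->
  \int[P]_w cos (u * (Z s w - Z r w)) = expR (- ((s - r) * levy_symbol nu u)) /\
  \int[P]_w sin (u * (Z s w - Z r w)) = 0.
Proof.
move=> [_ _ st _] hZ snu r0 rs sT.
have sr : 0 <= s - r <= T by rewrite subr_ge0 rs /=; lra.
have [<- <-] := levy_charfun u hZ snu sr.
have mD : measurable_fun setT (fun w => Z s w - Z r w) by exact: measurable_funB.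
split.
- apply: (@eq_law_Rintegral _ (Z (s - r)) (fun y => cos (u * y)) 1) => //.
  + exact: measurable_cos_scale.
  + by move=> y; exact: cos_max.
  + exact: st.
- apply: (@eq_law_Rintegral _ (Z (s - r)) (fun y => sin (u * y)) 1) => //.
  + exact: measurable_sin_scale.
  + by move=> y; exact: sin_max.
  + exact: st.
Qed.

End symmetric_levy.

Section ae_trigonometric.
Context d (Omega : measurableType d) (R : realType) (P : probability Omega R).

Lemma ae_eq_trig (u : R) (X Y : Omega -> R) :
  measurable_fun setT X -> measurable_fun setT Y -> {ae P, forall w, X w = Y w} ->
  \int[P]_w cos (u * X w) = \int[P]_w cos (u * Y w) /\
  \int[P]_w sin (u * X w) = \int[P]_w sin (u * Y w).
Proof.
move=> mX mY XY; split; congr fine; apply: ae_eq_integral => //.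
- by apply/measurable_EFinP; exact: measurable_cos_scale.
- by apply/measurable_EFinP; exact: measurable_cos_scale.
- by apply: filterS XY => w E _; rewrite /= E.
- by apply/measurable_EFinP; exact: measurable_sin_scale.
- by apply/measurable_EFinP; exact: measurable_sin_scale.
- by apply: filterS XY => w E _; rewrite /= E.
Qed.

Lemma mutually_independent_mul (X : nat -> Omega -> R) (f g : R -> R) :
  (forall i, measurable_fun setT (X i)) -> mutually_independent P X ->
  measurable_fun setT f -> (forall y, `|f y| <= 1) ->
  measurable_fun setT g -> (forall y, `|g y| <= 1) ->
  \int[P]_w (f (X 0%N w) * g (X 1%N w)) = \int[P]_w f (X 0%N w) * \int[P]_w g (X 1%N w).
Proof.
move=> mX ind mf bf mg bg.
have mXB i (B : set R) : measurable B -> measurable (X i @^-1` B).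
  by move=> mB; rewrite -[X in measurable X]setTI; exact: mX.
have mi (B : set R) : measurable B -> measurable_fun setT (\1_B : R -> R).
  by move=> mB; exact: measurable_indic.
have bi (B : set R) x : `|\1_B x| <= 1 :> R.
  by rewrite indicE; case: (_ \in _); rewrite ?normr0 ?normr1.
have EP i (B : set R) : measurable B -> \int[P]_w \1_B (X i w) = fine (P (X i @^-1` B)).
  move=> mB; rewrite -Rintegral_indic; last exact: mXB.
  by apply: eq_Rintegral => w _; rewrite !indicE.
apply: (@bounded_test_function _ _ _ P (fun w => f (X 0%N w)) _ _ 1 _ _ _ _ g 1) => //.
  by apply: measurableT_comp => //.
move=> B mB; rewrite [RHS]mulrC.
under eq_Rintegral do rewrite mulrC.
apply: (@bounded_test_function _ _ _ P (fun w => \1_B (X 1%N w)) _ _ 1 _ _ _ _ f 1) => //.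
  by apply: measurableT_comp => //; exact: mi.
move=> A mA; rewrite !EP //.
pose BB i := if i == 0%N then A else B.
have mBB i : measurable (BB i) by rewrite /BB; case: ifP.
have := ind [:: 0%N; 1%N] BB isT mBB; rewrite !big_cons big_nil mule1 /BB /=.
have -> : \bigcap_(i in [set` [:: 0%N; 1%N]]) (X i @^-1` (if i == 0%N then A else B)) =
    (X 1%N @^-1` B) `&` (X 0%N @^-1` A).
  apply/seteqP; split => w /=.
    by move=> H; split; [exact: (H 1%N)|exact: (H 0%N)].
  by move=> [HB HA] i; rewrite /= !inE => /orP[/eqP ->|/eqP ->].
move=> E; have -> : \int[P]_w (\1_B (X 1%N w) * \1_A (X 0%N w)) =
    fine (P ((X 1%N @^-1` B) `&` (X 0%N @^-1` A))).
  rewrite -Rintegral_indic; last by apply: measurableI; exact: mXB.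
  by apply: eq_Rintegral => w _; rewrite indicI /= !indicE.
by rewrite E fineM ?fin_num_measure //; [exact: mulrC|exact: mXB|exact: mXB].
Qed.

End ae_trigonometric.

Section random_measure.
Context d (Omega : measurableType d) (R : realType) (P : probability Omega R).
Variables (Z : R -> {RV P >-> R}) (t : R) (M : set R -> {RV P >-> R}).
Hypotheses (t0 : 0 <= t) (hM : generated_random_measure Z t M).
Local Notation I := (`]0%R, t]%classic : set R).

Lemma lebesgue_itvoc : lebesgue_measure I = t%:E.
Proof.
rewrite lebesgue_measure_itv /= lte_fin; have [_|t0'] := ltP 0 t; first by rewrite oppr0 adde0.
by rewrite (_ : t = 0) //; apply/eqP; rewrite eq_le t0 t0'.
Qed.

Lemma lebesgue_itvoc_fin_num (B : set R) : measurable B -> B `<=` I ->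
  lebesgue_measure B \is a fin_num.
Proof.
move=> mB BI; rewrite ge0_fin_numE //.
apply: (@le_lt_trans _ _ (lebesgue_measure I)); last by rewrite lebesgue_itvoc ltry.
by apply: le_measure => //; rewrite inE.
Qed.

Lemma random_measure0 : {ae P, forall w, M set0 w = 0}.
Proof.
have := hM.1 0 0 (lexx 0) (lexx 0) t0; rewrite set_itvoc0.
by apply: filterS => w; rewrite subrr.
Qed.

Lemma random_measure_sum (F : nat -> set R) (N : nat) :
  (forall i, measurable (F i)) -> (forall i, F i `<=` I) -> trivIset setT F ->
  (forall i, (N <= i)%N -> F i = set0) ->
  {ae P, forall w, M (\bigcup_i F i) w = \sum_(i < N) M (F i) w}.
Proof.
move=> mF FI tF F0; have [_ cv] := hM.2 F mF FI tF.
apply: filterS2 random_measure0 cv => w M0 cv.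
rewrite -(cvg_lim _ cv) //; apply: lim_near_cst => //.
near=> n; have Nn : (N <= n)%N by near: n; exact: nbhs_infty_ge.
rewrite -!(big_mkord xpredT (fun i => M (F i) w)) (big_cat_nat _ Nn) //=.
rewrite [X in _ + X]big1_seq ?addr0 // => i /andP[_]; rewrite mem_index_iota => /andP[Ni _].
by rewrite F0.
Unshelve. all: by end_near. Qed.

Lemma random_measureU (A B : set R) : measurable A -> measurable B ->
  A `<=` I -> B `<=` I -> A `&` B = set0 ->
  {ae P, forall w, M (A `|` B) w = M A w + M B w}.
Proof.
move=> mA mB AI BI AB; have := @random_measure_sum (bigcup2 A B) 2.
rewrite bigcup2E => H.
have {H} : {ae P, forall w, M (A `|` B) w = \sum_(i < 2) M (bigcup2 A B i) w}.
  by apply: H => [[|[|i]]|[|[|i]]||[|[|i]]] //=; rewrite -?trivIset_bigcup2.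
by apply: filterS => w ->; rewrite big_ord_recl big_ord1.
Qed.

(** This is Dynkin's pi-lambda theorem relative to []0, t]]: every set is replaced by its trace on
    that interval, and complements are taken inside it. *)
Lemma itvoc_induction (Q : set R -> Prop) :
  (forall r s : R, 0 <= r -> r <= s -> s <= t -> Q `]r, s]%classic) ->
  (forall A, measurable A -> A `<=` I -> Q A -> Q (I `\` A)) ->
  (forall F : nat -> set R, (forall n, measurable (F n)) -> (forall n, F n `<=` I) ->
    trivIset setT F -> (forall n, Q (F n)) -> Q (\bigcup_n F n)) ->
  forall A, measurable A -> A `<=` I -> Q A.
Proof.
move=> Qitv QD QU A mA AI.
suff : Q (A `&` I) by rewrite setIidl.
apply: (@dynkin_induction _ (measurableTypeR R) (@ocitv R) (fun S => Q (S `&` I))) => //.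
- exact: ocitvI.
- by rewrite setTI; exact: Qitv.
- move=> _ [[a b] _ <-] /=.
  have [ab|ba] := leP (Num.max a 0) (Num.min b t).
    have -> : `]a, b]%classic `&` I = `]Num.max a 0, Num.min b t]%classic.
      by apply/seteqP; split => x /=; rewrite !in_itv /= gt_max le_min;
        [move=> [/andP[-> ->] /andP[-> ->]]|move=> /andP[/andP[-> ->] /andP[-> ->]]].
    by apply: Qitv => //; [rewrite le_max lexx orbT|rewrite ge_min lexx orbT].
  (* An empty trace is written as []0, 0]], so that the hypothesis on intervals covers it. *)
  have -> : `]a, b]%classic `&` I = `]0, 0]%classic.
    rewrite set_itvoc0; apply/seteqP; split => x //=; rewrite !in_itv /=.
    move=> [/andP[ax xb] /andP[x0 xt]]; move: ba; rewrite ltNge => /negP; apply.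
    by rewrite ge_max !le_min; apply/andP; split; apply/andP; split; lra.
  exact: Qitv.
- move=> S mS QS; have -> : ~` S `&` I = I `\` (S `&` I).
    by rewrite setDE setCI setIUr setICr setU0 setIC.
  apply: QD QS; [exact: measurableI|exact: subIsetr].
- move=> F mF tF QF; rewrite setI_bigcupl; apply: QU.
  + by move=> n; apply: measurableI; [exact: mF|exact: measurable_itv].
  + by move=> n; exact: subIsetr.
  + exact: trivIset_setIr.
  + exact: QF.
Qed.

(** On intervals the measure is an increment of [Z]. For a complement, the values on [A] and on the
    rest are independent with sum an increment over []0, t]], so the characteristic function of the
    rest is a quotient, the exponential being nonzero. Disjoint unions follow from finite products
    by dominated convergence. *)
Lemma random_measure_charfun (psi : R -> R) :
  (forall r s u : R, 0 <= r -> r <= s -> s <= t ->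
    \int[P]_w cos (u * (Z s w - Z r w)) = expR (- ((s - r) * psi u)) /\
    \int[P]_w sin (u * (Z s w - Z r w)) = 0) ->
  forall A, measurable A -> A `<=` I -> forall u,
    \int[P]_w cos (u * M A w) = expR (- (fine (lebesgue_measure A) * psi u)) /\
    \int[P]_w sin (u * M A w) = 0.
Proof.
move=> hpsi; apply: itvoc_induction.
- move=> r s r0 rs st u; have [Hc Hs] := hpsi r s u r0 rs st.
  have E := hM.1 r s r0 rs st.
  have [-> ->] := ae_eq_trig u (measurable_funPT (M `]r, s]%classic))
    (measurable_funB (measurable_funPT (Z s)) (measurable_funPT (Z r))) E.
  rewrite Hc Hs lebesgue_measure_itv /= lte_fin; split => //.
  have [rs'|sr] := ltP r s; first by rewrite -EFinB.
  by rewrite (_ : s = r) ?subrr //; apply/eqP; rewrite eq_le sr rs.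
- move=> A mA AI QA u; have [Ac As] := QA u.
  have mIA : measurable (I `\` A) by exact: measurableD.
  have [Ic Is] := hpsi 0 t u (lexx 0) t0 (lexx t).
  have E0 := hM.1 0 t (lexx 0) t0 (lexx t).
  have EU : {ae P, forall w, M A w + M (I `\` A) w = Z t w - Z 0 w}.
    have := random_measureU mA mIA AI (@subDsetl _ _ _) (setDIK _ _).
    rewrite setDUK //; by apply: filterS2 E0 => w -> ->.
  have mM B : measurable_fun setT (M B) by exact: measurable_funPT.
  have mZ : measurable_fun setT (fun w => Z t w - Z 0 w) by exact: measurable_funB.
  have [Ec Es] := @ae_eq_trig _ _ _ P u (fun w => M A w + M (I `\` A) w) _
    (measurable_funD (mM _) (mM _)) mZ EU.
  rewrite {}Ic {}Is subr0 in Ec Es.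
  have [ind _] : mutually_independent P (fun n => M (bigcup2 A (I `\` A) n)) /\
      {ae P, forall w, \sum_(i < n) M (bigcup2 A (I `\` A) i) w @[n --> \oo] -->
        M (\bigcup_i bigcup2 A (I `\` A) i) w}.
    apply: hM.2 => [[|[|i]]|[|[|i]]|] //=; rewrite -?trivIset_bigcup2 ?setDIK //.
  have mul := @mutually_independent_mul _ _ _ P (fun n => M (bigcup2 A (I `\` A) n)) _ _
    (fun i => measurable_funPT _) ind.
  have mc := measurable_cos_scale u (@measurable_id _ R setT).
  have ms := measurable_sin_scale u (@measurable_id _ R setT).
  have bc (y : R) : `|cos (u * y)| <= 1 by exact: cos_max.
  have bs (y : R) : `|sin (u * y)| <= 1 by exact: sin_max.
  have := mul _ _ mc bc mc bc; have := mul _ _ mc bc ms bs.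
  have := mul _ _ ms bs mc bc; have := mul _ _ ms bs ms bs.
  rewrite /= Ac As !mul0r => ss sc cs cc.
  set B := I `\` A in Ec Es ss sc cs cc *.
  have int2 (f g : R -> R) : measurable_fun setT f -> (forall y, `|f y| <= 1) ->
      measurable_fun setT g -> (forall y, `|g y| <= 1) ->
      P.-integrable setT (EFin \o (fun w => f (M A w) * g (M B w))).
    move=> mf bf mg bg; apply: (@bounded_integrable _ _ _ _ _ 1).
      by apply: measurable_funM; exact: measurableT_comp.
    by move=> w; rewrite normrM mulr_ile1.
  have e0 : expR (- (fine (lebesgue_measure A) * psi u)) != 0 by rewrite gt_eqF ?expR_gt0.
  have LA : fine (lebesgue_measure B) = t - fine (lebesgue_measure A).
    have fA := lebesgue_itvoc_fin_num mA AI; have LI := lebesgue_itvoc.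
    have LE : (t%:E = lebesgue_measure A + lebesgue_measure B)%E.
      have := measureU lebesgue_measure mA mIA (setDIK _ _); rewrite setDUK // => <-.
      exact/esym/LI.
    have fB := lebesgue_itvoc_fin_num mIA (@subDsetl _ _ _).
    have := congr1 fine LE; rewrite fineD //= => ->; ring.
  have Ec' : expR (- (t * psi u)) = expR (- (fine (lebesgue_measure A) * psi u)) *
      \int[P]_w cos (u * M B w).
    rewrite -cc -[LHS]Ec -[RHS]subr0 -ss -(RintegralB measurableT (int2 _ _ mc bc mc bc) (int2 _ _ ms bs ms bs)).
    by apply: eq_Rintegral => w _; rewrite mulrDr cosD.
  have Es' : 0 = expR (- (fine (lebesgue_measure A) * psi u)) * \int[P]_w sin (u * M B w).
    rewrite -cs -[LHS]Es -[RHS]addr0 -sc addrC -(RintegralD measurableT (int2 _ _ ms bs mc bc) (int2 _ _ mc bc ms bs)).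
    by apply: eq_Rintegral => w _; rewrite mulrDr sinD.
  split; last by move/esym/eqP: Es'; rewrite mulf_eq0 (negbTE e0) => /eqP.
  apply: (mulfI e0); rewrite -Ec' -expRD LA; congr expR; ring.
- move=> F mF FI tF QF u.
  have [ind cv] := hM.2 F mF FI tF.
  have mM B : measurable_fun setT (M B) by exact: measurable_funPT.
  have csum n := @charfun_sum _ _ _ P (fun i => M (F i)) (fun=> u)
    (fun i => expR (- (fine (lebesgue_measure (F i)) * psi u))) n (fun i => mM _) ind
    (fun i => (QF i u).1) (fun i => (QF i u).2).
  have S n w : \sum_(i < n) u * M (F i) w = u * \sum_(i < n) M (F i) w by rewrite mulr_sumr.
  have mS n : measurable_fun setT (fun w => \sum_(i < n) M (F i) w).
    by apply: measurable_sum => i; exact: mM.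
  have c1 : \int[P]_w cos (u * \sum_(i < n) M (F i) w) @[n --> \oo] -->
      \int[P]_w cos (u * M (\bigcup_n F n) w).
    apply: (@cvg_bounded_expectation _ _ _ _ _ _ 1) => [n||n w|].
    - exact: measurable_cos_scale.
    - exact: measurable_cos_scale.
    - exact: cos_max.
    - apply: filterS cv => w cv; apply: continuous_cvg; first exact: continuous_cos.
      by apply: cvgM => //; exact: cvg_cst.
  have c2 : \int[P]_w sin (u * \sum_(i < n) M (F i) w) @[n --> \oo] -->
      \int[P]_w sin (u * M (\bigcup_n F n) w).
    apply: (@cvg_bounded_expectation _ _ _ _ _ _ 1) => [n||n w|].
    - exact: measurable_sin_scale.
    - exact: measurable_sin_scale.
    - exact: sin_max.
    - apply: filterS cv => w cv; apply: continuous_cvg; first exact: continuous_sin.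
      by apply: cvgM => //; exact: cvg_cst.
  have s0 n : \int[P]_w sin (u * \sum_(i < n) M (F i) w) = 0.
    transitivity (\int[P]_w sin (\sum_(i < n) u * M (F i) w)); last exact: (csum n).2.
    by apply: eq_Rintegral => w _; rewrite S.
  have c0 n : \int[P]_w cos (u * \sum_(i < n) M (F i) w) =
      expR (- ((\sum_(i < n) fine (lebesgue_measure (F i))) * psi u)).
    transitivity (\int[P]_w cos (\sum_(i < n) u * M (F i) w)).
      by apply: eq_Rintegral => w _; rewrite S.
    by rewrite (csum n).1 -expR_sum sumrN mulr_suml.
  split; last first.
    rewrite -(cvg_lim _ c2) //; under eq_fun do rewrite s0.
    by rewrite lim_cst.
  have mUF : measurable (\bigcup_n F n) by exact: bigcup_measurable.
  have UFI : \bigcup_n F n `<=` I by exact: bigcup_sub.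
  have cL : \sum_(i < n) fine (lebesgue_measure (F i)) @[n --> \oo] -->
      fine (lebesgue_measure (\bigcup_n F n)).
    have := @measure_semi_sigma_additive _ _ _ lebesgue_measure F mF tF mUF.
    move=> cvL.
    have cvL' : (\sum_(0 <= i < n) lebesgue_measure (F i))%E @[n --> \oo] -->
        (fine (lebesgue_measure (\bigcup_n F n)))%:E.
      by rewrite fineK //; exact: lebesgue_itvoc_fin_num.
    rewrite (_ : (fun n => _) = fine \o (fun n => \sum_(0 <= i < n) lebesgue_measure (F i))%E).
      exact: fine_cvg cvL'.
    apply/funext => n /=; rewrite big_mkord -sum_fine // => i _.
    exact: lebesgue_itvoc_fin_num.
  rewrite -(cvg_lim _ c1) //; apply: cvg_lim => //; under eq_fun do rewrite c0.
  apply: continuous_cvg; first exact: continuous_expR.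
  by apply: cvgN; apply: cvgM => //; exact: cvg_cst.
Qed.

End random_measure.

(** * Integrals of simple functions against the random measure *)

Section seq_integral.
Import HBSimple.
Context d (Omega : measurableType d) (R : realType) (P : probability Omega R).

Lemma ae_all_seq (T : eqType) (s : seq T) (Q : T -> Omega -> Prop) :
  (forall y, y \in s -> {ae P, forall w, Q y w}) ->
  {ae P, forall w, forall y, y \in s -> Q y w}.
Proof.
elim: s => [|x s IH] H; first exact: aeW.
have H1 := H x (mem_head x s).
have H2 := IH (fun y ys => H y (mem_behead (s := x :: s) ys)).
apply: filterS2 H1 H2 => w h1 h2 y; rewrite inE => /orP[/eqP -> //|]; exact: h2.
Qed.

(* [simple_integral] for a function [f] given with a duplicate-free list [s]
   containing its values. *)
Definition seq_integral (M : set R -> {RV P >-> R}) (A : set R) (f : R -> R) (s : seq R)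
    (w : Omega) : R :=
  \sum_(y <- s) y * M (A `&` f @^-1` [set y]) w.

Lemma measurable_seq_integral M A f s : measurable_fun setT (seq_integral M A f s).
Proof.
apply: measurable_sum => y; apply: measurable_funM => //; exact: measurable_funPT.
Qed.

Lemma simple_integralE (M : set R -> {RV P >-> R}) (A : set R) (phi : {sfun R >-> R}) w :
  simple_integral M A phi w = seq_integral M A phi (finmap.enum_fset (fset_set (range phi))) w.
Proof. by rewrite /simple_integral /seq_integral fsbig_finite. Qed.

Section random_measure.
Variables (Z : R -> {RV P >-> R}) (t : R) (M : set R -> {RV P >-> R}).
Hypotheses (t0 : 0 <= t) (hM : generated_random_measure Z t M).
Local Notation I := (`]0%R, t]%classic : set R).

(** Both measures agree with the increments of [Z] on intervals, and the agreement propagates by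
    [itvoc_induction]. Integrals up to [s] and up to [t], each defined with a measure of its own,
    thereby become comparable. *)
Lemma random_measure_unique (s : R) (M' : set R -> {RV P >-> R}) :
  0 <= s -> s <= t -> generated_random_measure Z s M' ->
  forall A : set R, measurable A -> A `<=` `]0, s]%classic ->
  {ae P, forall w, M' A w = M A w}.
Proof.
move=> s0 st hM'.
have sub (A : set R) : A `<=` `]0, s]%classic -> A `<=` I.
  move=> H x /H /=; rewrite !in_itv /= => /andP[-> xs] /=; exact: le_trans xs st.
apply: (itvoc_induction s0).
- move=> a b a0 ab bs.
  apply: filterS2 (hM'.1 a b a0 ab bs) (hM.1 a b a0 ab (le_trans bs st)).
  by move=> w -> ->.
- move=> A mA As EA.
  have mD : measurable (`]0, s]%classic `\` A) by exact: measurableD.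
  have h1 := random_measureU s0 hM' mA mD As (@subDsetl _ _ _) (setDIK _ _).
  have h2 := random_measureU t0 hM mA mD (sub _ As) (sub _ (@subDsetl _ _ _)) (setDIK _ _).
  rewrite setDUK // in h1 h2.
  have h3 := hM'.1 0 s (lexx 0) s0 (lexx s).
  have h4 := hM.1 0 s (lexx 0) s0 st.
  have h34 : {ae P, forall w, M' `]0, s]%classic w = M `]0, s]%classic w}.
    by apply: filterS2 h3 h4 => w -> ->.
  have h12 : {ae P, forall w, M' A w + M' (`]0, s]%classic `\` A) w =
      M A w + M (`]0, s]%classic `\` A) w}.
    by apply: filterS3 h1 h2 h34 => w <- <- ->.
  by apply: filterS2 h12 EA => w E1 E2; move: E1; rewrite E2 => /addrI.
- move=> F mF Fs tF EF.
  have [_ c1] := hM'.2 F mF Fs tF.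
  have [_ c2] := hM.2 F mF (fun n => sub _ (Fs n)) tF.
  have EA := ae_foralln EF.
  apply: filterS3 c1 c2 EA => w c1 c2 EA.
  rewrite -(cvg_lim _ c1) // -(cvg_lim _ c2) //; congr (lim _).
  by under eq_fun => n do under eq_bigr => i _ do rewrite EA.
Qed.

Lemma random_measure_split (s : seq R) (f : R -> R) (B : set R) :
  uniq s -> (forall x, f x \in s) -> measurable_fun setT f ->
  measurable B -> B `<=` I ->
  {ae P, forall w, M B w = \sum_(y <- s) M (B `&` f @^-1` [set y]) w}.
Proof.
move=> us fs mf mB BI.
pose F i := if (i < size s)%N then B `&` f @^-1` [set nth 0 s i] else set0.
have mF i : measurable (F i).
  rewrite /F; case: ifP => // _; apply: measurableI => //.
  by rewrite -[X in measurable X]setTI; apply: mf => //; exact: measurable_set1.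
have FI i : F i `<=` I.
  rewrite /F; case: ifP => _; last exact: sub0set.
  by apply: subset_trans BI; exact: subIsetl.
have tF : trivIset setT F.
  move=> i j _ _ [x []]; rewrite /F; case: ifP => // si [_ /= xi]; case: ifP => // sj [_ /= xj].
  by apply/eqP; rewrite -(nth_uniq 0 si sj us) -xi -xj.
have UF : \bigcup_i F i = B.
  apply/seteqP; split => [x [i _]|x Bx].
    by rewrite /F; case: ifP => // _ [].
  exists (index (f x) s) => //; rewrite /F index_mem fs; split => //=.
  by rewrite nth_index.
have F0 i : (size s <= i)%N -> F i = set0 by rewrite /F ltnNge => ->.
have := random_measure_sum t0 hM mF FI tF F0; rewrite UF.
apply: filterS => w ->; rewrite (big_nth 0) big_mkord; apply: eq_bigr => i _.
by rewrite /F ltn_ord.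
Qed.

(** The three integrals are rewritten over the common refinement by pairs of values [(y, z)] of [f]
    and [g]; on such a piece [h] can only equal [y - z]. Finitely many additivity relations are
    used, so one null set suffices. *)
Lemma seq_integralB (f g h : R -> R) (s s1 s2 : seq R) : uniq s -> uniq s1 -> uniq s2 ->
  (forall x, f x \in s) -> (forall x, g x \in s1) -> (forall x, h x \in s2) ->
  measurable_fun setT f -> measurable_fun setT g -> measurable_fun setT h ->
  (forall x, h x = f x - g x) ->
  {ae P, forall w, seq_integral M I h s2 w = seq_integral M I f s w - seq_integral M I g s1 w}.
Proof.
move=> us us1 us2 fs gs hs mf mg mh hE.
have pre (k : R -> R) (y : R) : measurable_fun setT k -> measurable (k @^-1` [set y]).
  move=> mk; rewrite -[X in measurable X]setTI; apply: mk => //; exact: measurable_set1.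
have mI : measurable I by exact: measurable_itv.
have A1 : {ae P, forall w, forall y, y \in s -> M (I `&` f @^-1` [set y]) w =
    \sum_(z <- s1) M (I `&` f @^-1` [set y] `&` g @^-1` [set z]) w}.
  apply: ae_all_seq => y _; apply: random_measure_split => //.
  by apply: measurableI => //; exact: pre.
have A2 : {ae P, forall w, forall z, z \in s1 -> M (I `&` g @^-1` [set z]) w =
    \sum_(y <- s) M (I `&` g @^-1` [set z] `&` f @^-1` [set y]) w}.
  apply: ae_all_seq => z _; apply: random_measure_split => //.
  by apply: measurableI => //; exact: pre.
have A3 : {ae P, forall w, forall v, v \in s2 -> M (I `&` h @^-1` [set v]) w =
    \sum_(y <- s) M (I `&` h @^-1` [set v] `&` f @^-1` [set y]) w}.
  apply: ae_all_seq => v _; apply: random_measure_split => //.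
  by apply: measurableI => //; exact: pre.
have A4 : {ae P, forall w, forall v, v \in s2 -> forall y, y \in s ->
    M (I `&` h @^-1` [set v] `&` f @^-1` [set y]) w =
    \sum_(z <- s1) M (I `&` h @^-1` [set v] `&` f @^-1` [set y] `&` g @^-1` [set z]) w}.
  apply: ae_all_seq => v _; apply: ae_all_seq => y _; apply: random_measure_split => //.
    by apply: measurableI; [apply: measurableI => //; exact: pre|exact: pre].
  by rewrite -setIA; exact: subIsetl.
have A0 := random_measure0 t0 hM.
apply: filterS3 A0 (filterI A1 A2) (filterI A3 A4) => w M0 [B1 B2] [B3 B4].
rewrite /seq_integral.
pose E y z := M (I `&` f @^-1` [set y] `&` g @^-1` [set z]) w.
have F1 : \sum_(y <- s) y * M (I `&` f @^-1` [set y]) w = \sum_(y <- s) \sum_(z <- s1) y * E y z.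
  by rewrite big_seq [RHS]big_seq; apply: eq_bigr => y ys; rewrite B1 // mulr_sumr.
have F2 : \sum_(z <- s1) z * M (I `&` g @^-1` [set z]) w = \sum_(y <- s) \sum_(z <- s1) z * E y z.
  rewrite exchange_big /= big_seq [RHS]big_seq; apply: eq_bigr => z zs; rewrite B2 // mulr_sumr.
  by apply: eq_bigr => y _; rewrite /E setIAC.
have F3 : \sum_(v <- s2) v * M (I `&` h @^-1` [set v]) w =
    \sum_(y <- s) \sum_(z <- s1) \sum_(v <- s2)
      v * M (I `&` h @^-1` [set v] `&` f @^-1` [set y] `&` g @^-1` [set z]) w.
  under [RHS]eq_bigr do rewrite exchange_big /=.
  rewrite exchange_big /= big_seq [RHS]big_seq; apply: eq_bigr => v vs.
  rewrite B3 // mulr_sumr big_seq [RHS]big_seq; apply: eq_bigr => y ys.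
  by rewrite B4 // mulr_sumr.
rewrite F1 F2 F3 -sumrB; apply: eq_bigr => y _; rewrite -sumrB; apply: eq_bigr => z _.
rewrite -mulrBl.
have H v : M (I `&` h @^-1` [set v] `&` f @^-1` [set y] `&` g @^-1` [set z]) w =
    if v == y - z then E y z else 0.
  case: eqP => [->|vyz].
    congr (M _ w); apply/seteqP; split => x /=.
      by move=> [[[? _] ?] ?].
    by move=> [[? fx] gx]; split => //; split => //; split => //; rewrite hE fx gx.
  rewrite (_ : _ `&` _ = set0) //; apply/seteqP; split => x //=.
  by move=> [[[_ hx] fx] gx]; apply: vyz; rewrite -hx hE fx gx.
under eq_bigr do rewrite H.
have [yz|yz] := boolP (y - z \in s2).
  rewrite (bigD1_seq _ yz) //= eqxx big1 ?addr0 // => v /negbTE ->; exact: mulr0.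
(* If [y - z] is not in the list for [h], no point carries the pair [(y, z)]: every term over [v] is
   0, and [E y z] is the value of [M] on the empty set. *)
rewrite big1_seq; last first.
  by move=> v /andP[_ vs]; case: eqP => [E0|_]; rewrite ?mulr0 //; rewrite -E0 vs in yz.
rewrite /E (_ : _ `&` _ = set0) ?M0 ?mulr0 //; apply/seteqP; split => x //=.
move=> [[_ fx] gx]; move: yz; have := hs x; rewrite hE fx gx => -> //.
Qed.

(** Cutting [f] off at [s] may create the value 0, hence the enlarged list; that value contributes
    nothing, being multiplied by itself. On the nonzero level sets the two measures agree up to null
    sets. *)
Lemma seq_integral_restrict (s : R) (M' : set R -> {RV P >-> R}) (f : R -> R) (r : seq R) :
  0 <= s -> s <= t -> generated_random_measure Z s M' ->
  uniq r -> measurable_fun setT f ->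
  {ae P, forall w, seq_integral M' `]0, s]%classic f r w =
    seq_integral M I (fun x => f x * \1_(`]0, s]%classic) x) (undup (0 :: r)) w}.
Proof.
move=> s0 st hM' ur mf.
have A : {ae P, forall w, forall y, y \in r ->
    M' (`]0, s]%classic `&` f @^-1` [set y]) w = M (`]0, s]%classic `&` f @^-1` [set y]) w}.
  apply: ae_all_seq => y _; apply: (random_measure_unique s0 st hM'); last exact: subIsetl.
  apply: measurableI; first exact: measurable_itv.
  by rewrite -[X in measurable X]setTI; apply: mf => //; exact: measurable_set1.
apply: filterS A => w E; rewrite /seq_integral.
have -> : \sum_(y <- r) y * M' (`]0, s]%classic `&` f @^-1` [set y]) w =
    \sum_(y <- r) y * M (`]0, s]%classic `&` f @^-1` [set y]) w.
  by rewrite big_seq [RHS]big_seq; apply: eq_bigr => y yr; rewrite E.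
have -> : \sum_(y <- undup (0 :: r)) y * M (I `&` (fun x => f x * \1_(`]0, s]%classic) x) @^-1` [set y]) w
    = \sum_(y <- undup (0 :: r)) y * M (`]0, s]%classic `&` f @^-1` [set y]) w.
  apply: eq_bigr => y _; have [->|y0] := eqVneq y 0; first by rewrite !mul0r.
  congr (_ * M _ w); apply/seteqP; split => x /=; rewrite !in_itv /= indicE.
    case: (boolP (x \in _)) => xs [_].
      by rewrite mulr1 => fx; move/set_mem: xs; rewrite /= in_itv /=.
    by rewrite mulr0 => y00; move: y0; rewrite -y00 eqxx.
  move=> [/andP[x0 xs] fx]; rewrite x0 (le_trans xs st); split => //.
  by rewrite mem_set ?mulr1 //= in_itv /= x0 xs.
by rewrite /=; case: ifP => _; rewrite ?big_cons ?mul0r ?add0r undup_id.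
Qed.

(** The level sets are disjoint, so their random measures are independent and the characteristic
    function is a finite product of exponentials. The list of level sets is padded by empty sets
    into a sequence. Outside [I] both [f] and [psi (u * f)] vanish, so the exponent is an integral
    over the whole line. *)
Lemma charfun_seq_integral (psi : R -> R) :
  (forall A, measurable A -> A `<=` I -> forall u,
    \int[P]_w cos (u * M A w) = expR (- (fine (lebesgue_measure A) * psi u)) /\
    \int[P]_w sin (u * M A w) = 0) ->
  psi 0 = 0 -> forall (f : R -> R) (s : seq R) (u : R),
  uniq s -> (forall x, f x \in s) -> measurable_fun setT f ->
  (forall x, ~ I x -> f x = 0) ->
  [/\ lebesgue_measure.-integrable setT (EFin \o (fun x => psi (u * f x))),
    \int[P]_w cos (u * seq_integral M I f s w) =
      expR (- \int[lebesgue_measure]_x psi (u * f x)) &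
    \int[P]_w sin (u * seq_integral M I f s w) = 0].
Proof.
move=> hpsi psi0 f s u us fs mf f0.
pose F i := if (i < size s)%N then I `&` f @^-1` [set nth 0 s i] else set0.
have pre (y : R) : measurable (I `&` f @^-1` [set y]).
  apply: measurableI; first exact: measurable_itv.
  by rewrite -[X in measurable X]setTI; apply: mf => //; exact: measurable_set1.
have mF i : measurable (F i) by rewrite /F; case: ifP.
have FI i : F i `<=` I by rewrite /F; case: ifP => // _ x [].
have tF : trivIset setT F.
  move=> i j _ _ [x []]; rewrite /F; case: ifP => // si [_ /= xi]; case: ifP => // sj [_ /= xj].
  by apply/eqP; rewrite -(nth_uniq 0 si sj us) -xi -xj.
have [ind _] := hM.2 F mF FI tF.
pose theta i := u * nth 0 s i.
have [Hc Hs] := @charfun_sum _ _ _ P (fun i => M (F i)) theta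
  (fun i => expR (- (fine (lebesgue_measure (F i)) * psi (theta i)))) (size s)
  (fun i => measurable_funPT _) ind
  (fun i => (hpsi _ (mF i) (FI i) (theta i)).1) (fun i => (hpsi _ (mF i) (FI i) (theta i)).2).
have SE w : \sum_(i < size s) theta i * M (F i) w = u * seq_integral M I f s w.
  rewrite /seq_integral mulr_sumr (big_nth 0) big_mkord; apply: eq_bigr => i _.
  by rewrite /theta /F ltn_ord mulrA.
have fI (y : R) := lebesgue_itvoc_fin_num t0 (pre y) (@subIsetl _ I _).
have int1 (y : R) : lebesgue_measure.-integrable setT (EFin \o (\1_(I `&` f @^-1` [set y]) : R -> R)).
  have m1 : measurable_fun setT (\1_(I `&` f @^-1` [set y]) : R -> R).
    exact: measurable_indic.
  apply/integrableP; split; first exact/measurable_EFinP.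
  under eq_integral do rewrite /= ger0_norm //.
  rewrite integral_indic ?setIT //; last exact: pre.
  by rewrite -ge0_fin_numE ?fI ?measure_ge0.
have intI (y : R) : lebesgue_measure.-integrable setT
    (EFin \o (fun x => psi (u * y) * \1_(I `&` f @^-1` [set y]) x)).
  have := @integrableZl _ _ _ lebesgue_measure setT measurableT (psi (u * y)) _ (int1 y).
  exact.
have PE x : psi (u * f x) = \sum_(y <- s) psi (u * y) * \1_(I `&` f @^-1` [set y]) x.
  have [Ix|Ix] := pselect (I x).
    rewrite (bigD1_seq (f x)) //= indicE mem_set // mulr1 big1 ?addr0 // => y yf.
    rewrite indicE memNset ?mulr0 //= => -[_ E]; by rewrite E eqxx in yf.
  rewrite f0 // mulr0 psi0 big1 // => y _.
  by rewrite indicE memNset ?mulr0 // => -[].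
have intS s' : lebesgue_measure.-integrable setT
    (EFin \o (fun x => \sum_(y <- s') psi (u * y) * \1_(I `&` f @^-1` [set y]) x)).
  rewrite (_ : EFin \o _ = fun x =>
    (\sum_(y <- s') (psi (u * y) * \1_(I `&` f @^-1` [set y]) x)%:E)%E).
    by apply: integrable_sum => // y _; exact: intI.
  by apply/funext => x /=; rewrite sumEFin.
have RS s' : \int[lebesgue_measure]_x (\sum_(y <- s') psi (u * y) * \1_(I `&` f @^-1` [set y]) x) =
    \sum_(y <- s') fine (lebesgue_measure (I `&` f @^-1` [set y])) * psi (u * y).
  elim: s' => [|y s' IH].
    rewrite big_nil; under eq_Rintegral do rewrite big_nil.
    by rewrite /Rintegral integral0.
  rewrite big_cons -IH; under eq_Rintegral do rewrite big_cons.
  rewrite (RintegralD measurableT (intI y) (intS s')).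
  congr (_ + _); rewrite RintegralZl //.
  by rewrite mulrC; congr (_ * _); rewrite /Rintegral integral_indic ?setIT //; exact: pre.
have E : (fun x => psi (u * f x)) = fun x =>
    \sum_(y <- s) psi (u * y) * \1_(I `&` f @^-1` [set y]) x by apply/funext.
split.
- by rewrite E; exact: intS.
- under eq_Rintegral do rewrite -SE.
  rewrite Hc -expR_sum sumrN E RS; congr (expR (- _)).
  by rewrite (big_nth 0) big_mkord; apply: eq_bigr => i _; rewrite /F ltn_ord.
- by under eq_Rintegral do rewrite -SE.
Qed.

End random_measure.

End seq_integral.

(** * Passage to the limit in probability *)

Section limits.
Context d (T : measurableType d) (R : realType) (mu : {measure set T -> \bar R}).

Lemma fatou_le (f_ : nat -> T -> R) (f : T -> R) (K_ : nat -> R) (K : R) :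
  (forall n, measurable_fun setT (f_ n)) -> measurable_fun setT f ->
  (forall n x, 0 <= f_ n x) -> (forall x, 0 <= f x) ->
  {ae mu, forall x, f_ n x @[n --> \oo] --> f x} ->
  (\forall n \near \oo, (\int[mu]_x (f_ n x)%:E <= (K_ n)%:E)%E) -> K_ n @[n --> \oo] --> K ->
  (\int[mu]_x (f x)%:E <= K%:E)%E.
Proof.
move=> mf_ mf f_0 f0 cf fK KK.
have mF n : measurable_fun setT (EFin \o f_ n) by exact/measurable_EFinP.
have mfE : measurable_fun setT (EFin \o f) by exact/measurable_EFinP.
have F := @fatou _ _ _ mu setT measurableT _ mF (fun n x _ => f_0 n x).
have -> : (\int[mu]_x (f x)%:E = \int[mu]_x limn_einf ((fun n => EFin \o f_ n) ^~ x))%E.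
  apply: ge0_ae_eq_integral => //.
  - apply: (emeasurable_fun_cvg (fun n x => einfs ((fun n => EFin \o f_ n) ^~ x) n)).
      exact: measurable_fun_einfs.
    by move=> x _; rewrite limn_einf_lim; exact: is_cvg_einfs.
  - by move=> x _; rewrite lee_fin.
  - move=> x _; rewrite limn_einf_lim; apply: lime_ge; first exact: is_cvg_einfs.
    by apply: nearW => n; apply: le_ereal_inf_tmp => _ [m /= nm <-]; rewrite lee_fin.
  - apply: filterS cf => x cx _ /=.
    have cE : ((f_ n x)%:E @[n --> \oo] --> (f x)%:E)%E by apply: cvg_EFin cx; exact: nearW.
    by rewrite is_cvg_limn_einfE; [rewrite (cvg_lim _ cE)|apply/cvg_ex; exists (f x)%:E].
apply: (le_trans F); rewrite limn_einf_lim.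
have cK : ((K_ n)%:E @[n --> \oo] --> K%:E)%E by apply: cvg_EFin KK; exact: nearW.
rewrite -(cvg_lim _ cK) //; apply: lee_lim; [exact: is_cvg_einfs|by apply/cvg_ex; exists K%:E|].
apply: filterS fK => n; apply: le_trans; apply: ereal_inf_lbound; exists n => //=.
Qed.

(** First [e] is chosen to make [e * A] small, then [n]; the factor [c e] may blow up as [e] tends
    to 0, as it does in weighted AM-GM estimates. *)
Lemma squeeze_linear (v err : nat -> R) (l A : R) (c : R -> R) :
  0 <= A -> err n @[n --> \oo] --> 0 ->
  (forall e : R, 0 < e -> 0 < c e /\ \forall n \near \oo, `|v n - l| <= e * A + c e * err n) ->
  v n @[n --> \oo] --> l.
Proof.
move=> A0 e0 H; apply/cvgrPdist_le => eps eps0.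
pose e := eps / (2 * (A + 1)).
have e_gt0 : 0 < e by rewrite divr_gt0 // mulr_gt0 // ltr_wpDl.
have [c0 {}H] := H e e_gt0.
have he : e * A <= eps / 2.
  rewrite /e invfM mulrA -mulrA ler_piMr ?divr_ge0 ?(ltW eps0) //.
  by rewrite mulrC ler_pdivrMr ?mul1r ?lerDl // ltr_wpDl.
have d0 : 0 < eps / 2 / c e by rewrite !divr_gt0.
move/cvgrPdist_le : e0 => /(_ _ d0) E0.
near=> n.
have h1 : `|v n - l| <= e * A + c e * err n by near: n.
have : `|0 - err n| <= eps / 2 / c e by near: n.
rewrite sub0r normrN => /(le_trans (ler_norm _)); rewrite ler_pdivlMr // mulrC => h2.
rewrite distrC (le_trans h1) //; lra.
Unshelve. all: by end_near. Qed.

End limits.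

Section limit_law.
Context d (Omega : measurableType d) (R : realType) (P : probability Omega R).
Context d' (E : measurableType d') (mu : {measure set E -> \bar R}).

(** The squares of the two differences add up to [|exp(ia) - exp(ib)|^2], that is
    [2 * (1 - cos (a - b))]; then [|z| <= e + z^2 / e] linearises. *)
Lemma trig_dist_le (a b e : R) : 0 < e ->
  `|cos a - cos b| <= e + 2 / e * (1 - cos (a - b)) /\
  `|sin a - sin b| <= e + 2 / e * (1 - cos (a - b)).
Proof.
move=> e0; have H : (cos a - cos b) ^+ 2 + (sin a - sin b) ^+ 2 = 2 * (1 - cos (a - b)).
  rewrite cosB; have := cos2Dsin2 a; have := cos2Dsin2 b; set x := cos a; set y := sin a.
  by move=> h1 h2; rewrite !expr2 in h1 h2 *; nra.
have K (z : R) : z ^+ 2 <= 2 * (1 - cos (a - b)) -> `|z| <= e + 2 / e * (1 - cos (a - b)).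
  move=> h; have : `|z| <= e + z ^+ 2 / e.
    rewrite -real_normK ?num_real // -(ler_pM2r e0) mulrDl mulfVK ?gt_eqF //; have := normr_ge0 z; nra.
  move=> /le_trans; apply; by rewrite lerD2l (mulrAC 2) ler_pM2r ?invr_gt0.
split; apply: K; rewrite -H; [rewrite lerDl|rewrite lerDr]; exact: sqr_ge0.
Qed.

Lemma cvg_in_prob_cos (X : nat -> Omega -> R) (Y : Omega -> R) (u : R) :
  (forall n, measurable_fun setT (X n)) -> measurable_fun setT Y -> cvg_in_prob P X Y ->
  \int[P]_w (1 - cos (u * (X n w - Y w))) @[n --> \oo] --> 0.
Proof.
move=> mX mY XY.
have mD n : measurable_fun setT (fun w => X n w - Y w) by exact: measurable_funB.
apply/cvgrPdist_le => eps eps0.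
(* Chosen so that [|X n - Y| <= h] forces [1 - cos <= (u h)^2 <= eps / 2]; the added 1 avoids a
   division by zero at [u = 0]. *)
pose h := Num.sqrt (eps / 2) / (`|u| + 1).
have u1 : 0 < `|u| + 1 by rewrite ltr_wpDl.
have h0 : 0 < h by rewrite divr_gt0 // sqrtr_gt0 divr_gt0.
pose A n := [set w | h <= `|X n w - Y w|].
have mA n : measurable (A n).
  rewrite (_ : A n = (fun w => `|X n w - Y w|) @^-1` `[h, +oo[).
    rewrite -[X in measurable X]setTI; apply: measurableT_comp => //; exact: measurable_itv.
  by apply/seteqP; split => w /=; rewrite in_itv /= andbT.
have key n w : 1 - cos (u * (X n w - Y w)) <= eps / 2 + 2 * \1_(A n) w.
  rewrite indicE; have [Aw|Aw] := pselect (A n w).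
    rewrite mem_set // mulr1; have := cos_geN1 (u * (X n w - Y w)); lra.
  rewrite memNset // mulr0 addr0 (le_trans (one_sub_cos_le _)) //.
  have Ah : `|X n w - Y w| <= h by rewrite leNgt; apply/negP => /ltW.
  rewrite -real_normK ?num_real // normrM.
  have : `|u| * `|X n w - Y w| <= Num.sqrt (eps / 2).
    rewrite (@le_trans _ _ ((`|u| + 1) * h)) //; first by rewrite ler_pM // lerDl.
    by rewrite /h mulrC mulfVK // gt_eqF.
  by rewrite -[X in _ -> _ <= X]sqr_sqrtr ?divr_ge0 ?(ltW eps0) // => ?; rewrite ler_pXn2r // nnegrE ?mulr_ge0 ?sqrtr_ge0.
have bi n := integrable_one_sub_cos_rv P u (mD n).
have bA n : P.-integrable setT (EFin \o (\1_(A n) : Omega -> R)).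
  apply: (@bounded_integrable _ _ _ _ _ 1); first exact: measurable_indic.
  by move=> w; rewrite indicE; case: (_ \in _); rewrite ?normr0 ?normr1.
have bA2 n : P.-integrable setT (EFin \o (fun w => 2 * \1_(A n) w)).
  exact: (@integrableZl _ _ _ P setT measurableT 2 _ (bA n)).
have bc : P.-integrable setT (EFin \o (fun w : Omega => eps / 2)).
  by apply: (@bounded_integrable _ _ _ _ _ (eps / 2)) => // w; rewrite ger0_norm // divr_ge0 ?(ltW eps0).
have I n : \int[P]_w (1 - cos (u * (X n w - Y w))) <= eps / 2 + 2 * fine (P (A n)).
  rewrite (@le_trans _ _ (\int[P]_w (eps / 2 + 2 * \1_(A n) w))) //.
    apply: le_Rintegral => //; exact: (integrableD measurableT bc (bA2 n)).
  rewrite (RintegralD measurableT bc (bA2 n)) Rintegral_cst1 (RintegralZl _ measurableT (bA n)).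
  by rewrite Rintegral_indic.
have /fine_cvgP[_ /cvgrPdist_le F] := XY h h0.
have e4 : 0 < eps / 4 by rewrite divr_gt0.
near=> n.
rewrite sub0r normrN ger0_norm; last first.
  by apply: Rintegral_ge0 => w _; exact: one_sub_cos_ge0.
rewrite (le_trans (I n)) //.
have : `|0 - fine (P (A n))| <= eps / 4 by near: n; exact: F.
by rewrite sub0r normrN => /(le_trans (ler_norm _)); lra.
Unshelve. all: by end_near. Qed.

Variables (psi : R -> R).
Hypotheses (psi_ge0 : forall y, 0 <= psi y) (psi_cont : continuous psi)
  (psi_dist : forall e a b : R, 0 < e ->
     `|psi a - psi b| <= e * psi b + (1 + e^-1) * psi (a - b)).
Variables (X_ : nat -> Omega -> R) (X : Omega -> R) (xi : nat -> E -> R) (f : E -> R).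
Hypotheses (mX_ : forall n, measurable_fun setT (X_ n)) (mX : measurable_fun setT X)
  (mxi : forall n, measurable_fun setT (xi n)) (mf : measurable_fun setT f).
Hypothesis xi_cvg : {ae mu, forall x, xi n x @[n --> \oo] --> f x}.
Hypothesis X_cvg : forall u : R, \int[P]_w (1 - cos (u * (X_ n w - X w))) @[n --> \oo] --> 0.
Hypothesis charfun_diff : forall n m (u : R),
  mu.-integrable setT (EFin \o (fun x => psi (u * (xi n x - xi m x)))) /\
  \int[P]_w cos (u * (X_ n w - X_ m w)) = expR (- \int[mu]_x psi (u * (xi n x - xi m x))).
Hypothesis charfun_n : forall n (u : R),
  [/\ mu.-integrable setT (EFin \o (fun x => psi (u * xi n x))),
    \int[P]_w cos (u * X_ n w) = expR (- \int[mu]_x psi (u * xi n x)) &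
    \int[P]_w sin (u * X_ n w) = 0].

Let err (u : R) n := \int[P]_w (1 - cos (u * (X_ n w - X w))).

Let mpsi (g : E -> R) (u : R) : measurable_fun setT g ->
  measurable_fun setT (fun x => psi (u * g x)).
Proof.
move=> mg; apply: measurableT_comp; first exact: continuous_measurable_fun.
exact: measurable_funM.
Qed.

(* [1 + I <= expR I] turns smallness of [1 - expR (- I)] into smallness of [I]. *)
Lemma charfun_diff_le n m (u : R) : err u n + err u m <= 4^-1 ->
  \int[mu]_x psi (u * (xi n x - xi m x)) <= 4 * err u n + 4 * err u m.
Proof.
(* Here [q] is [expR (- D)]. As [x + y <= 1/4], [q >= 1/2], and [q * D <= 1 - q] gives
   [D <= 2 (1 - q) <= 4 x + 4 y]. *)
have aux (x y q D : R) : 1 - q <= 2 * x + 2 * y -> x + y <= 4^-1 -> 0 <= D ->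
    q * (1 + D) <= 1 -> D <= 4 * x + 4 * y by nra.
move=> enm; have [ip ch] := charfun_diff n m u.
set D := \int[mu]_x _ in ch *.
have D0 : 0 <= D by apply: Rintegral_ge0.
have mB k : measurable_fun setT (fun w => X_ k w - X w) by exact: measurable_funB.
have h1 : 1 - expR (- D) <= 2 * err u n + 2 * err u m.
  rewrite -ch -{1}(Rintegral_cst1 P 1) -RintegralB //; last 2 first.
  - by apply: (@bounded_integrable _ _ _ _ _ 1) => // w; rewrite normr1.
  - apply: (@bounded_integrable _ _ _ _ _ 1); last by move=> w; exact: cos_max.
    by apply: measurable_cos_scale; exact: measurable_funB.
  have i1 k : P.-integrable setT (EFin \o (fun w => 2 * (1 - cos (u * (X_ k w - X w))))).
    exact: (@integrableZl _ _ _ P setT measurableT 2 _ (integrable_one_sub_cos_rv P u (mB k))).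
  have i0 k : P.-integrable setT (EFin \o (fun w => 1 - cos (u * (X_ k w - X w)))).
    exact: integrable_one_sub_cos_rv.
  rewrite /err -(RintegralZl _ measurableT (i0 n)) -(RintegralZl _ measurableT (i0 m)).
  rewrite -(RintegralD measurableT (i1 n) (i1 m)); apply: le_Rintegral => //.
  - by apply: integrable_one_sub_cos_rv; exact: measurable_funB.
  - exact: (integrableD measurableT (i1 n) (i1 m)).
  - move=> w _; rewrite (_ : u * (X_ n w - X_ m w) = u * (X_ n w - X w) - u * (X_ m w - X w)).
      exact: one_sub_cosB_le.
    by ring.
have h2 : expR (- D) * expR D = 1 by rewrite -expRD addNr expR0.
have h3 := expR_ge1Dx D; have h4 := expR_gt0 (- D).
have h5 : expR (- D) * (1 + D) <= expR (- D) * expR D by rewrite ler_pM2l.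
by move: h5; rewrite h2; exact: aux.
Qed.

(** The second index goes to infinity in [charfun_diff_le]. The threshold 1/8 leaves another 1/8 for
    [err u m], which holds for all large [m]. *)
Lemma charfun_limit_le n (u : R) : err u n <= 8^-1 ->
  (\int[mu]_x (psi (u * (xi n x - f x)))%:E <= (4 * err u n)%:E)%E.
Proof.
move=> en.
apply: (@fatou_le _ _ _ mu (fun m x => psi (u * (xi n x - xi m x))) _
  (fun m => 4 * err u n + 4 * err u m)).
- by move=> m; apply: mpsi; exact: measurable_funB.
- by apply: mpsi; exact: measurable_funB.
- by [].
- by [].
- apply: filterS xi_cvg => x cx; apply: continuous_cvg; first exact: psi_cont.
  by apply: cvgM; [exact: cvg_cst|apply: cvgB => //; exact: cvg_cst].
- have e8 : 0 < 8^-1 :> R by rewrite invr_gt0.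
  have /cvgrPdist_le /(_ _ e8) E8 := X_cvg u.
  apply: filterS E8 => m; rewrite sub0r normrN => /(le_trans (ler_norm _)) em.
  rewrite -EFin_Rintegral; last exact: (charfun_diff n m u).1.
  by rewrite lee_fin; apply: charfun_diff_le; rewrite /err in en em *; lra.
- rewrite -[X in _ --> X]addr0; apply: cvgD; first exact: cvg_cst.
  by rewrite -[X in _ --> X](mulr0 4); apply: cvgM; [exact: cvg_cst|exact: X_cvg].
Qed.

(** No function dominates [psi (u * xi n x)], so the convergence of the exponents is quantitative:
    [psi_dist] bounds their difference by a small multiple of the limit plus a multiple of the
    integral of [psi (u * (xi n x - f x))]. *)
Lemma charfun_limit (u : R) :
  [/\ mu.-integrable setT (EFin \o (fun x => psi (u * f x))),
    \int[P]_w cos (u * X w) = expR (- \int[mu]_x psi (u * f x)) &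
    \int[P]_w sin (u * X w) = 0].
Proof.
have e8 : 0 < 8^-1 :> R by rewrite invr_gt0.
have near8 : \forall n \near \oo, err u n <= 8^-1.
  have /cvgrPdist_le /(_ _ e8) := X_cvg u; apply: filterS => m.
  by rewrite sub0r normrN => /(le_trans (ler_norm _)).
have intD n : err u n <= 8^-1 ->
    mu.-integrable setT (EFin \o (fun x => psi (u * (xi n x - f x)))).
  move=> en; apply: integrable_ge0 => //; first by apply: mpsi; exact: measurable_funB.
  exact: le_lt_trans (charfun_limit_le en) (ltry _).
have intZ (c : R) (h : E -> R) : mu.-integrable setT (EFin \o h) ->
    mu.-integrable setT (EFin \o (fun x => c * h x)).
  by move=> ih; exact: (@integrableZl _ _ _ mu setT measurableT c _ ih).
have distE n (e : R) x : 0 < e -> `|psi (u * xi n x) - psi (u * f x)| <=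
    e * psi (u * f x) + (1 + e^-1) * psi (u * (xi n x - f x)).
  by move=> e0; rewrite mulrBr; exact: psi_dist.
have intf : mu.-integrable setT (EFin \o (fun x => psi (u * f x))).
  have [n en] : exists n, err u n <= 8^-1 by case: near8 => N _ /(_ N (leqnn N)); exists N.
  (* The constants 2 and 6 come from solving [psi_dist] with [e = 1/2] for the term
     [psi (u * f x)]. *)
  have i1 := intZ 2 _ (let: And3 h _ _ := charfun_n n u in h).
  have i2 := intZ 6 _ (intD n en).
  apply: (integrable_normr_le (g := fun x => 2 * psi (u * xi n x) + 6 * psi (u * (xi n x - f x)))).
  - exact: mpsi.
  - move=> x; rewrite ger0_norm //; have h2 : 0 < 2^-1 :> R by rewrite invr_gt0.
    have := distE n 2^-1 x h2; rewrite invrK ler_norml => /andP[h _].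
    have := psi_ge0 (u * (xi n x - f x)); lra.
  - exact: (integrableD measurableT i1 i2).
have psi_cvg : \int[mu]_x psi (u * xi n x) @[n --> \oo] --> \int[mu]_x psi (u * f x).
  apply: (@squeeze_linear _ _ (err u) _ (\int[mu]_x psi (u * f x)) (fun e => (1 + e^-1) * 4)).
  - exact: Rintegral_ge0.
  - exact: X_cvg.
  - move=> e e0; have c0 : 0 < 1 + e^-1 by rewrite addr_gt0 // invr_gt0.
    split; first by rewrite mulr_gt0.
    apply: filterS near8 => n en.
    have [in1 _ _] := charfun_n n u.
    have i1 := intZ e _ intf; have i2 := intZ (1 + e^-1) _ (intD n en).
    rewrite -(RintegralB measurableT in1 intf).
    apply: (@le_trans _ _ (\int[mu]_x (e * psi (u * f x) + (1 + e^-1) * psi (u * (xi n x - f x))))).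
      apply: normr_Rintegral_le.
      - exact: (integrableB measurableT in1 intf).
      - exact: (integrableD measurableT i1 i2).
      - by move=> x; exact: distE.
    rewrite (RintegralD measurableT i1 i2) (RintegralZl _ measurableT intf).
    rewrite (RintegralZl _ measurableT (intD n en)) lerD2l -mulrA ler_pM2l //.
    by rewrite -lee_fin EFin_Rintegral ?charfun_limit_le //; exact: intD.
have mB k : measurable_fun setT (fun w => X_ k w - X w) by exact: measurable_funB.
have trig_cvg (h : R -> R) : measurable_fun setT h -> (forall y, `|h y| <= 1) ->
    (forall a b e : R, 0 < e -> `|h a - h b| <= e + 2 / e * (1 - cos (a - b))) ->
    \int[P]_w h (u * X_ n w) @[n --> \oo] --> \int[P]_w h (u * X w).
  move=> mh h1 hd.
  have ih (Y : Omega -> R) : measurable_fun setT Y -> P.-integrable setT (EFin \o (fun w => h (u * Y w))).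
    move=> mY; apply: (@bounded_integrable _ _ _ _ _ 1) => //.
    by apply: measurableT_comp => //; exact: measurable_funM.
  apply: (@squeeze_linear _ _ (err u) _ 1 (fun e => 2 / e)) => //; first exact: X_cvg.
  move=> e e0; split; first by rewrite divr_gt0.
  apply: nearW => n.
  have ie : P.-integrable setT (EFin \o (fun w : Omega => e)).
    by apply: (@bounded_integrable _ _ _ _ _ e) => // w; rewrite ger0_norm // ltW.
  have ic := integrable_one_sub_cos_rv P u (mB n).
  have i2 : P.-integrable setT (EFin \o (fun w => 2 / e * (1 - cos (u * (X_ n w - X w))))).
    exact: (@integrableZl _ _ _ P setT measurableT (2 / e) _ ic).
  rewrite -(RintegralB measurableT (ih _ (mX_ n)) (ih _ mX)).
  apply: (@le_trans _ _ (\int[P]_w (e + 2 / e * (1 - cos (u * (X_ n w - X w)))))).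
    apply: normr_Rintegral_le.
    - exact: (integrableB measurableT (ih _ (mX_ n)) (ih _ mX)).
    - exact: (integrableD measurableT ie i2).
    - by move=> w; have := hd (u * X_ n w) (u * X w) e e0; rewrite -mulrBr.
  by rewrite (RintegralD measurableT ie i2) (RintegralZl _ measurableT ic) Rintegral_cst1 mulr1.
have mcos : measurable_fun [set: R] (@cos R).
  by apply: continuous_measurable_fun; exact: continuous_cos.
have msin : measurable_fun [set: R] (@sin R).
  by apply: continuous_measurable_fun; exact: continuous_sin.
have Ec : (fun n => \int[P]_w cos (u * X_ n w)) =
    fun n => expR (- \int[mu]_x psi (u * xi n x)).
  by apply/funext => n; have [] := charfun_n n u.
have Es : (fun n => \int[P]_w sin (u * X_ n w)) = cst 0.
  by apply/funext => n; have [] := charfun_n n u.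
have c1 := trig_cvg cos mcos (@cos_max R) (fun a b e e0 => (trig_dist_le a b e0).1).
have s1 := trig_cvg sin msin (@sin_max R) (fun a b e e0 => (trig_dist_le a b e0).2).
have c2 : expR (- \int[mu]_x psi (u * xi n x)) @[n --> \oo] -->
    expR (- \int[mu]_x psi (u * f x)).
  by apply: continuous_cvg; [exact: continuous_expR|exact: cvgN].
split=> //.
- by rewrite -(cvg_lim _ c1) // Ec; exact: cvg_lim.
- by rewrite -(cvg_lim _ s1) // Es; apply: cvg_lim => //; exact: cvg_cst.
Qed.

End limit_law.

(** * The Levy symbol and the law of an increment of the integral *)

Section levy_symbol_properties.
Context (R : realType) (nu : {measure set R -> \bar R}).
Hypothesis hnu : levy_measure nu.
Local Notation trunc := (fun x : R => Num.min (x ^+ 2) 1).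

Lemma measurable_trunc : measurable_fun setT trunc.
Proof. by apply: measurable_minr => //; exact: exprn_measurable. Qed.

Lemma trunc_ge0 (x : R) : 0 <= Num.min (x ^+ 2) 1.
Proof. by rewrite le_min sqr_ge0 ler01. Qed.

Lemma integrable_trunc : nu.-integrable setT (EFin \o trunc).
Proof. by apply: integrable_ge0 hnu.2; [exact: measurable_trunc|exact: trunc_ge0]. Qed.

Lemma one_sub_cos_le_trunc (u x : R) : 1 - cos (u * x) <= 2 * (1 + u ^+ 2) * Num.min (x ^+ 2) 1.
Proof.
apply: (le_trans (one_sub_cos_le_min _)); rewrite -mulrA ler_pM2l // exprMn.
have u0 := sqr_ge0 u; have x0 := sqr_ge0 x.
have [x1|x1] := leP (x ^+ 2) 1; last by rewrite mulr1 ge_min lerDl u0.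
by rewrite ge_min; apply/orP; right; rewrite ler_wpM2r // lerDr.
Qed.

Lemma integrable_levy_symbol (u : R) :
  nu.-integrable setT (EFin \o (fun x => 1 - cos (u * x))).
Proof.
apply: (integrable_normr_le (g := fun x : R => 2 * (1 + u ^+ 2) * Num.min (x ^+ 2) 1)).
- by apply: measurable_funB => //; exact: measurable_cos_scale.
- by move=> x; rewrite ger0_norm ?one_sub_cos_ge0 ?one_sub_cos_le_trunc.
- exact: (@integrableZl _ _ _ nu setT measurableT (2 * (1 + u ^+ 2)) _ integrable_trunc).
Qed.

Lemma levy_symbol_ge0 (u : R) : 0 <= levy_symbol nu u.
Proof. by apply: Rintegral_ge0 => x _; exact: one_sub_cos_ge0. Qed.

Lemma levy_symbol0 : levy_symbol nu 0 = 0.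
Proof.
rewrite /levy_symbol; under eq_Rintegral do rewrite mul0r cos0 subrr.
by rewrite /Rintegral integral0.
Qed.

Lemma levy_symbol_dist (e a b : R) : 0 < e -> `|levy_symbol nu a - levy_symbol nu b| <=
  e * levy_symbol nu b + (1 + e^-1) * levy_symbol nu (a - b).
Proof.
move=> e0; have ia := integrable_levy_symbol a; have ib := integrable_levy_symbol b.
have iab := integrable_levy_symbol (a - b).
have i1 := @integrableZl _ _ _ nu setT measurableT e _ ib.
have i2 := @integrableZl _ _ _ nu setT measurableT (1 + e^-1) _ iab.
rewrite /levy_symbol -(RintegralB measurableT ia ib) -(RintegralZl _ measurableT ib).
rewrite -(RintegralZl _ measurableT iab) -(RintegralD measurableT i1 i2).
apply: normr_Rintegral_le.
- exact: (integrableB measurableT ia ib).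
- exact: (integrableD measurableT i1 i2).
- move=> x; rewrite (_ : _ - _ = - (cos (a * x) - cos (b * x))); last by ring.
  by rewrite normrN (mulrBl x); exact: normr_cosB_le.
Qed.

Lemma continuous_levy_symbol : continuous (levy_symbol nu).
Proof.
move=> a; have aI : a \in (`](a - 1), (a + 1)[%classic : set R).
  by rewrite inE /= in_itv /=; lra.
apply: (@continuity_under_integral R _ _ nu (fun u x => 1 - cos (u * x)) setT measurableT
  (a - 1) (a + 1) _ _ (fun x => 2 * (1 + (`|a| + 1) ^+ 2) * Num.min (x ^+ 2) 1) _ _ a aI).
- by move=> u _; exact: integrable_levy_symbol.
- apply: aeW => x _ u _; apply: cvgB; first exact: cvg_cst.
  apply: continuous_comp; last exact: continuous_cos.
  by apply: cvgM; [exact: cvg_id|exact: cvg_cst].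
- exact: (@integrableZl _ _ _ nu setT measurableT _ _ integrable_trunc).
- move=> u /=; rewrite in_itv /= => /andP[u1 u2]; apply: aeW => x _.
  rewrite ger0_norm ?one_sub_cos_ge0 // (le_trans (one_sub_cos_le_trunc u x)) //.
  rewrite ler_wpM2r ?trunc_ge0 // ler_pM2l // lerD2l -real_normK ?num_real //.
  rewrite ler_pXn2r ?nnegrE // ?addr_ge0 // ler_norml.
  by have := ler_norm a; have := ler_norm (- a); rewrite normrN; lra.
Qed.

(** Markov's inequality for [min(x^2, 1)] bounds the mass away from the origin, and the origin
    itself is a null set. Tonelli's theorem on the product with Lebesgue measure rests on this. *)
Lemma levy_measure_sigma_finite : sigma_finite setT nu.
Proof.
pose A n := [set x : R | n.+1%:R^-1 <= Num.min (x ^+ 2) 1].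
have mA n : measurable (A n).
  rewrite (_ : A n = trunc @^-1` `[n.+1%:R^-1, +oo[).
    rewrite -[X in measurable X]setTI; apply: measurable_trunc => //; exact: measurable_itv.
  by apply/seteqP; split => w /=; rewrite in_itv /= andbT.
exists (fun n => [set 0] `|` A n).
  apply/seteqP; split => // x _; have [->|x0] := eqVneq x 0; first by exists 0%N => //; left.
  have y0 : 0 < Num.min (x ^+ 2) 1 by rewrite lt_min ltr01 andbT exprn_even_gt0.
  exists (Num.bound (Num.min (x ^+ 2) 1)^-1) => //; right; rewrite /A /=.
  rewrite -[leRHS]invrK lef_pV2 ?posrE ?invr_gt0 //.
  apply: ltW; apply: (lt_le_trans (archi_boundP _)); first by rewrite invr_ge0 ltW.
  by rewrite ler_nat.
move=> n; split; first exact: measurableU.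
apply: (@le_lt_trans _ _ (nu [set 0%R] + nu (A n))%E); first exact: measureU2.
rewrite hnu.1 add0e.
have n0 : 0 < n.+1%:R^-1 :> R by rewrite invr_gt0.
have : (n.+1%:R^-1%:E * nu (A n) < +oo)%E.
  apply: le_lt_trans hnu.2.
  rewrite -[X in nu X]setIT -integral_indic //.
  have mi : measurable_fun setT (\1_(A n) : R -> R) by exact: measurable_indic.
  rewrite -(ge0_integralZl_fin _ (ltW n0)) //.
  apply: ge0_le_integral => //.
  - by apply/measurable_EFinP; exact: measurable_funM.
  - by apply/measurable_EFinP; exact: measurable_trunc.
  - move=> x _; rewrite lee_fin indicE; have [Ax|Ax] := pselect (A n x).
      by rewrite mem_set // mulr1.
    by rewrite memNset // mulr0 trunc_ge0.
have := measure_ge0 nu (A n); case: (nu (A n)) => [r| |] //= _.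
  by move=> _; rewrite ltry.
by rewrite gt0_muley.
Qed.

Lemma levy_measure_sigma_finite_measure :
  exists nu' : {sigma_finite_measure set R -> \bar R}, (nu' : set R -> \bar R) = nu.
Proof.
pose H1 := isSFinite.Build _ _ _ _ (sfinite_measure_sigma_finite levy_measure_sigma_finite).
pose H2 := isSigmaFinite.Build _ _ _ _ levy_measure_sigma_finite.
by exists (HB.pack_for {sigma_finite_measure set R -> \bar R} (Measure.sort nu) H1 H2).
Qed.

End levy_symbol_properties.

Section levy_integral_law.
Import HBSimple.
Context d (Omega : measurableType d) (R : realType) (P : probability Omega R).
Variables (T : R) (Z : R -> {RV P >-> R}) (nu : {measure set R -> \bar R}).
Hypotheses (hZ : levy_process T Z) (hT : has_triplet T Z 0 0 nu) (hnu : levy_measure nu)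
  (snu : symmetric_measure nu).
Local Notation itv t := (`]0%R, t]%classic : set R).

Lemma measurable_restrict_itv (t : R) (f : R -> R) : measurable_fun (itv t) f ->
  measurable_fun setT (fun x => f x * \1_(itv t) x).
Proof.
move=> mf; rewrite (_ : (fun x => _) = f \_ (itv t)).
  by apply/(measurable_restrictT f) => //; exact: measurable_itv.
by apply/funext => x; rewrite patchE indicE; case: ifP; rewrite ?mulr1 ?mulr0.
Qed.

Lemma measurable_simple_integral (M : set R -> {RV P >-> R}) A (phi : {sfun R >-> R}) :
  measurable_fun setT (simple_integral M A phi).
Proof.
rewrite (_ : simple_integral _ _ _ =
    seq_integral M A phi (finmap.enum_fset (fset_set (range phi)))).
  exact: measurable_seq_integral.
by apply/funext => w; exact: simple_integralE.
Qed.

(** The increment is exhibited as a limit of integrals against the single measure [Mt], namely those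
    of the differences of the two approximating sequences, each cut off at its own endpoint. *)
Lemma levy_integral_increment_charfun (s t : R) (gs gt : R -> R) (Ys Yt : {RV P >-> R}) :
  0 <= s -> s <= t -> t <= T -> is_levy_integral Z s gs Ys -> is_levy_integral Z t gt Yt ->
  let f x := gt x * \1_(itv t) x - gs x * \1_(itv s) x in
  measurable_fun setT f /\ forall u : R,
  [/\ lebesgue_measure.-integrable setT (EFin \o (fun x => levy_symbol nu (u * f x))),
    \int[P]_w cos (u * (Yt w - Ys w)) = expR (- \int[lebesgue_measure]_x levy_symbol nu (u * f x)) &
    \int[P]_w sin (u * (Yt w - Ys w)) = 0].
Proof.
move=> s0 st tT [Ms hMs [mgs [phis [cphis _ Is]]]] [Mt hMt [mgt [phit [cphit _ It]]]] f.
have t0 : 0 <= t := le_trans s0 st.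
have mf : measurable_fun setT f.
  by apply: measurable_funB; exact: measurable_restrict_itv.
split => // u0; move: u0.
pose vs n : seq R := finmap.enum_fset (fset_set (range (phis n))).
pose vt n : seq R := finmap.enum_fset (fset_set (range (phit n))).
pose xs n x := phis n x * \1_(itv s) x.
pose xt n x := phit n x * \1_(itv t) x.
pose xi n x := xt n x - xs n x.
pose ws n := undup (0 :: vs n).
pose wt n := undup (0 :: vt n).
pose wi n := undup [seq a - b | a <- wt n, b <- ws n].
have in_vs n x : phis n x \in vs n.
  by rewrite /vs in_fset_set // inE; exists x.
have in_vt n x : phit n x \in vt n.
  by rewrite /vt in_fset_set // inE; exists x.
have in_ws n x : xs n x \in ws n.
  rewrite mem_undup inE /xs indicE; case: (_ \in _); last by rewrite mulr0 eqxx.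
  by rewrite mulr1 in_vs orbT.
have in_wt n x : xt n x \in wt n.
  rewrite mem_undup inE /xt indicE; case: (_ \in _); last by rewrite mulr0 eqxx.
  by rewrite mulr1 in_vt orbT.
have in_wi n x : xi n x \in wi n.
  by rewrite mem_undup; exact: allpairs_f.
have mxs n : measurable_fun setT (xs n).
  by apply: measurable_restrict_itv; exact: measurable_funS (measurable_funPT _).
have mxt n : measurable_fun setT (xt n).
  by apply: measurable_restrict_itv; exact: measurable_funS (measurable_funPT _).
have mxi n : measurable_fun setT (xi n) by exact: measurable_funB.
pose X_ n := seq_integral Mt (itv t) (xi n) (wi n).
have hpsi := random_measure_charfun t0 hMt (fun r s u r0 rs st =>
  levy_increment_charfun u hZ hT snu r0 rs (le_trans st tT)).
have hch := charfun_seq_integral t0 hMt hpsi (levy_symbol0 nu).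
(* Here [Ms] is exchanged for [Mt], up to a null set; the same restriction lemma, with [s] replaced
   by [t], also cuts off the simple functions of [Yt]. *)
have aeX n : {ae P, forall w, X_ n w =
    simple_integral Mt (itv t) (phit n) w - simple_integral Ms (itv s) (phis n) w}.
  have h1 := seq_integralB t0 hMt (undup_uniq _) (undup_uniq _) (undup_uniq _)
    (in_wt n) (in_ws n) (in_wi n) (mxt n) (mxs n) (mxi n) (fun x => erefl).
  have h2 := seq_integral_restrict t0 hMt t0 (lexx t) hMt (finmap.fset_uniq (fset_set (range (phit n))))
    (measurable_funPT (phit n)).
  have h3 := seq_integral_restrict t0 hMt s0 st hMs (finmap.fset_uniq (fset_set (range (phis n))))
    (measurable_funPT (phis n)).
  by apply: filterS3 h1 h2 h3 => w E1 E2 E3; rewrite !simple_integralE [LHS]E1 E2 E3.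
have xi0 n x : ~ itv t x -> xi n x = 0.
  move=> tx; rewrite /xi /xt /xs !indicE memNset // memNset ?mulr0 ?subrr //.
  by move=> sx; apply: tx; move: sx; rewrite /= !in_itv /= => /andP[-> /le_trans]; exact.
apply: (@charfun_limit _ _ _ P _ _ lebesgue_measure (levy_symbol nu) (levy_symbol_ge0 nu)
  (continuous_levy_symbol hnu) (fun e a b => levy_symbol_dist hnu a b) X_ (fun w => Yt w - Ys w) xi f).
- by move=> n; exact: measurable_seq_integral.
- by apply: measurable_funB; exact: measurable_funPT.
- exact: mxi.
- exact: mf.
- have FF : Filter (almost_everywhere (@lebesgue_measure R)).
    exact: ae_filter_ringOfSetsType.
  apply: (@filterS2 _ _ FF _ _ _ _ cphit cphis) => x ct cs; rewrite /xi /f; apply: cvgB.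
    rewrite /xt indicE; have [tx|tx] := pselect (itv t x).
      by rewrite mem_set //; apply: cvgM; [exact: ct|exact: cvg_cst].
    by rewrite memNset // mulr0; under eq_fun do rewrite mulr0; exact: cvg_cst.
  rewrite /xs indicE; have [tx|tx] := pselect (itv s x).
    by rewrite mem_set //; apply: cvgM; [exact: cs|exact: cvg_cst].
  by rewrite memNset // mulr0; under eq_fun do rewrite mulr0; exact: cvg_cst.
- move=> u.
  have cs := cvg_in_prob_cos u (fun n => measurable_simple_integral Ms (itv s) (phis n)) (measurable_funPT Ys) Is.
  have ct := cvg_in_prob_cos u (fun n => measurable_simple_integral Mt (itv t) (phit n)) (measurable_funPT Yt) It.
  (* The two approximations combine through [one_sub_cosB_le], at the level of means of
     [1 - cos]. *)
  have cc : 2 * \int[P]_w (1 - cos (u * (simple_integral Mt (itv t) (phit n) w - Yt w))) +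
      2 * \int[P]_w (1 - cos (u * (simple_integral Ms (itv s) (phis n) w - Ys w)))
      @[n --> \oo] --> 0.
    rewrite [X in _ --> X](_ : 0 = 2 * 0 + 2 * 0); last by rewrite mulr0 addr0.
    by apply: cvgD; apply: cvgMl_tmp.
  apply: (squeeze_cvgr _ (cvg_cst 0) cc); apply: nearW => n.
  apply/andP; split; first by apply: Rintegral_ge0 => w _; exact: one_sub_cos_ge0.
  have mDt : measurable_fun setT (fun w => simple_integral Mt (itv t) (phit n) w - Yt w).
    by apply: measurable_funB; [exact: measurable_simple_integral|exact: measurable_funPT].
  have mDs : measurable_fun setT (fun w => simple_integral Ms (itv s) (phis n) w - Ys w).
    by apply: measurable_funB; [exact: measurable_simple_integral|exact: measurable_funPT].
  have it := integrable_one_sub_cos_rv P u mDt; have is_ := integrable_one_sub_cos_rv P u mDs.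
  have it2 := @integrableZl _ _ _ P setT measurableT 2 _ it.
  have is2 := @integrableZl _ _ _ P setT measurableT 2 _ is_.
  have -> : \int[P]_w (1 - cos (u * (X_ n w - (Yt w - Ys w)))) =
      \int[P]_w (1 - cos (u * ((simple_integral Mt (itv t) (phit n) w - Yt w) -
        (simple_integral Ms (itv s) (phis n) w - Ys w)))).
    congr fine; apply: ae_eq_integral => //.
    - apply/measurable_EFinP; apply: measurable_funB => //; apply: measurable_cos_scale.
      apply: measurable_funB; first exact: measurable_seq_integral.
      by apply: measurable_funB; exact: measurable_funPT.
    - apply/measurable_EFinP; apply: measurable_funB => //; apply: measurable_cos_scale.
      exact: measurable_funB.
    - apply: filterS (aeX n) => w E _ /=; rewrite E; congr (1 - cos (u * _))%:E; ring.
  rewrite -(RintegralZl _ measurableT it) -(RintegralZl _ measurableT is_).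
  rewrite -(RintegralD measurableT it2 is2); apply: le_Rintegral => //.
  - by apply: integrable_one_sub_cos_rv; exact: measurable_funB.
  - exact: (integrableD measurableT it2 is2).
  - by move=> w _; rewrite (mulrBr u); exact: one_sub_cosB_le.
- move=> n m u; pose x x := xi n x - xi m x.
  pose w := undup [seq a - b | a <- wi n, b <- wi m].
  have xw y : x y \in w by rewrite mem_undup; exact: allpairs_f.
  have mx : measurable_fun setT x by exact: measurable_funB.
  have x0 y : ~ itv t y -> x y = 0 by move=> ty; rewrite /x !xi0 // subrr.
  have [i1 c1 _] := hch x w u (undup_uniq _) xw mx x0.
  split; first exact: i1.
  rewrite -c1; apply: (ae_eq_trig u _ _ _).1.
  - by apply: measurable_funB; exact: measurable_seq_integral.
  - exact: measurable_seq_integral.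
  - have := seq_integralB t0 hMt (undup_uniq _) (undup_uniq _) (undup_uniq _)
      (in_wi n) (in_wi m) xw (mxi n) (mxi m) mx (fun x => erefl).
    by apply: filterS => y ->.
- by move=> n u; exact: (hch _ _ u (undup_uniq _) (in_wi n) (mxi n) (xi0 n)).
Qed.

End levy_integral_law.

(** * Moments of integrals with intensity Lebesgue times Levy measure *)

Section product_sigma_finite.
Context (R : realType) d1 (S : measurableType d1) d2 (V : measurableType d2).

Lemma sigma_finite_product (mu : {sigma_finite_measure set S -> \bar R})
    (nu : {sigma_finite_measure set V -> \bar R}) : sigma_finite setT (mu \x nu)%E.
Proof.
have /sigma_finiteP[F [TF ndF Foo]] := sigma_finiteT mu.
have /sigma_finiteP[G [TG ndG Goo]] := sigma_finiteT nu.
exists (fun n => F n `*` G n).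
  rewrite -setXTT TF TG; apply/seteqP; split => [[x y] [/= [n _ Fx] [k _ Gy]]|[x y] [n _ [/= ? ?]]].
    exists (maxn n k) => //; split => /=.
      by have /subsetPset := ndF _ _ (leq_maxl n k); apply.
    by have /subsetPset := ndG _ _ (leq_maxr n k); apply.
  by split; exists n.
move=> k; have [? ?] := Foo k; have [? ?] := Goo k; split; first exact: measurableX.
by rewrite product_measure1E // lte_mul_pinfty // ge0_fin_numE.
Qed.

Lemma product_sigma_finite_measure (mu : {sigma_finite_measure set S -> \bar R})
    (nu : {sigma_finite_measure set V -> \bar R}) :
  exists rho : {sigma_finite_measure set (S * V)%type -> \bar R},
    (rho : set (S * V) -> \bar R) = (mu \x nu)%E.
Proof.
pose H1 := isSFinite.Build _ _ _ _ (sfinite_measure_sigma_finite (sigma_finite_product mu nu)).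
pose H2 := isSigmaFinite.Build _ _ _ _ (sigma_finite_product mu nu).
by exists (HB.pack_for {sigma_finite_measure set (S * V)%type -> \bar R} (mu \x nu)%E H1 H2).
Qed.

End product_sigma_finite.

Section levy_integral_moments.
Context d (Omega : measurableType d) (R : realType) (P : probability Omega R).
Context d' (S : measurableType d') (leb : {sigma_finite_measure set S -> \bar R}).
Variables (nu : {sigma_finite_measure set R -> \bar R}).
Hypothesis hnu : levy_measure nu.
Variable rho : {sigma_finite_measure set (S * R)%type -> \bar R}.
Hypothesis rhoE : (rho : set (S * R) -> \bar R) = (leb \x nu)%E.
Local Notation kernel f := (fun z : S * R => f z.1 * z.2).

Lemma integral_product (F : S * R -> \bar R) : measurable_fun setT F -> (forall z, 0 <= F z)%E ->
  (\int[rho]_z F z = \int[leb]_x \int[nu]_y F (x, y))%E.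
Proof.
move=> mF F0; rewrite -[RHS](fubini_tonelli1 F mF F0).
by apply: eq_measure_integral => A _ _; exact: (congr1 (fun m => m A) rhoE).
Qed.

Lemma measurable_kernel (f : S -> R) : measurable_fun setT f -> measurable_fun setT (kernel f).
Proof. by move=> mf; apply: measurable_funM => //; exact: measurableT_comp. Qed.

(** At a fixed first coordinate the symbol is itself an integral over jumps of [1 - cos (u f y)], so
    Tonelli turns the exponent into one integral over the product, with kernel [f z.1 * z.2]. *)
Lemma symmetric_id_law_kernel (X : Omega -> R) (f : S -> R) :
  measurable_fun setT X -> measurable_fun setT f ->
  (forall u : R, [/\ leb.-integrable setT (EFin \o (fun x => levy_symbol nu (u * f x))),
    \int[P]_w cos (u * X w) = expR (- \int[leb]_x levy_symbol nu (u * f x)) &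
    \int[P]_w sin (u * X w) = 0]) ->
  symmetric_id_law P rho X (kernel f).
Proof.
move=> mX mf H; split => //; first exact: measurable_kernel.
  move=> u; have [iu -> _] := H u; congr (expR (- fine _)).
  rewrite (integral_product (F := fun z : S * R => (1 - cos (u * (f z.1 * z.2)))%:E)) /=.
  - apply: eq_integral => x _; rewrite EFin_Rintegral; last exact: integrable_levy_symbol.
    by apply: eq_integral => y _; rewrite mulrA.
  - apply/measurable_EFinP; apply: measurable_funB => //.
    by apply: measurable_cos_scale; exact: measurable_kernel.
  - by move=> z; rewrite lee_fin one_sub_cos_ge0.
by move=> u; have [] := H u.
Qed.

Lemma integral_kernel_powR (f : S -> R) (q : R) : measurable_fun setT f ->
  (\int[nu]_x (`|x| `^ q)%:E < +oo)%E ->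
  (\int[rho]_z (`|f z.1 * z.2| `^ q)%:E =
   (fine (\int[nu]_x (`|x| `^ q)%:E))%:E * \int[leb]_x (`|f x| `^ q)%:E)%E.
Proof.
move=> mf nuq.
have N0 : (0 <= \int[nu]_x (`|x| `^ q)%:E)%E by apply: integral_ge0 => x _; rewrite lee_fin powR_ge0.
have fN : (\int[nu]_x (`|x| `^ q)%:E)%E \is a fin_num by rewrite ge0_fin_numE.
rewrite (integral_product (F := fun z : S * R => (`|f z.1 * z.2| `^ q)%:E)) /=.
- rewrite -ge0_integralZl_fin ?fine_ge0 //.
  + apply: eq_integral => x _; rewrite EFinM fineK // muleC -ge0_integralZl_fin ?powR_ge0 //.
      by apply: eq_integral => y _; rewrite normrM powRM.
    by apply: measurable_normr_powR; exact: measurable_id.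
  + exact: measurable_normr_powR.
- by apply/measurable_EFinP; apply: measurable_normr_powR; exact: measurable_kernel.
- by move=> z; rewrite lee_fin powR_ge0.
Qed.

Lemma sqr_normr_powR (x : R) : `|x| `^ 2 = x ^+ 2.
Proof. by rewrite powR_mulrn // real_normK // num_real. Qed.

(** Small jumps are handled by the defining condition of a Levy measure, large ones by the moment of
    order [p >= 2]. *)
Lemma levy_integral_sqr_lty (p : R) : 2 <= p ->
  (\int[nu]_x (`|x| `^ p)%:E < +oo)%E -> (\int[nu]_x (`|x| `^ 2)%:E < +oo)%E.
Proof.
move=> p2 nup; have mp q : measurable_fun [set: R] (fun x : R => `|x| `^ q).
  by apply: measurable_normr_powR; exact: measurable_id.
apply: (@le_lt_trans _ _ (\int[nu]_x ((Num.min (x ^+ 2) 1)%:E + (`|x| `^ p)%:E))%E).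
  apply: ge0_le_integral => //.
  - by apply/measurable_EFinP.
  - apply/measurable_EFinP; apply: measurable_funD => //; exact: measurable_trunc.
  - move=> x _; rewrite -EFinD lee_fin sqr_normr_powR.
    have [x1|x1] := leP (x ^+ 2) 1; first by rewrite lerDl powR_ge0.
    apply: (@le_trans _ _ (`|x| `^ p)); last by rewrite lerDr.
    rewrite -sqr_normr_powR ler_powR //.
    by rewrite -(@ler_pXn2r _ 2) ?nnegrE // expr1n real_normK ?num_real // ltW.
have mt : measurable_fun [set: R] (fun x : R => (Num.min (x ^+ 2) 1)%:E).
  by apply/measurable_EFinP; exact: measurable_trunc.
have mpE : measurable_fun [set: R] (fun x : R => (`|x| `^ p)%:E) by exact/measurable_EFinP.
rewrite (ge0_integralD nu measurableT _ mt _ mpE); last 2 first.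
- by move=> x _; rewrite lee_fin trunc_ge0.
- by move=> x _; rewrite lee_fin powR_ge0.
by rewrite lte_add_pinfty // hnu.2.
Qed.

Lemma powR_inv (K p : R) : 0 < K -> 0 < p -> (K `^ (- p^-1)) `^ p = K^-1.
Proof. by move=> K0 p0; rewrite -powRrM mulNr mulVf ?gt_eqF // powRN powRr1 // ltW. Qed.

(* The moment inequality is not homogeneous in the integrand for [p > 2]; it is
   made so by rescaling, [A] having finite measure. *)
Lemma levy_integral_moment_le (A : set S) (T p : R) : measurable A -> (leb A <= T%:E)%E -> 0 <= T -> 0 < p ->
  (\int[nu]_x (`|x| `^ p)%:E < +oo)%E ->
  exists2 C : R, 0 <= C & forall (X : Omega -> R) (f : S -> R),
  (forall x, ~ A x -> f x = 0) -> measurable_fun setT f ->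
  symmetric_id_law P rho X (kernel f) ->
  forall K : R, 0 < K -> (\int[leb]_x (`|f x| `^ p)%:E <= K%:E)%E ->
  (\int[P]_w (`|X w| `^ p)%:E <= (C * K)%:E)%E.
Proof.
move=> mA AT T0 p0 nup; pose N q := fine (\int[nu]_x (`|x| `^ q)%:E)%E.
have N0 q : 0 <= N q.
  by apply: fine_ge0; apply: integral_ge0 => x _; rewrite lee_fin powR_ge0.
have [p2|p2] := ltP p 2.
  have [c cE] : exists c : R, c = (1 - cos 1) ^+ 1 * 2 `^ (-1 - p) by eexists.
  have [c' c'E] : exists c' : R, c' = 2 * ((2 * 1%:R - p)^-1 + p^-1) by eexists.
  have c0 : 0 < c by rewrite cE mulr_gt0 ?powR_gt0 // exprn_gt0 // cos1_lt1.
  have c'0 : 0 <= c' by rewrite c'E mulr_ge0 // addr_ge0 // invr_ge0; [lra|exact: ltW].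
  exists (c^-1 * (c' * N p)); first by apply: mulr_ge0; [rewrite invr_ge0 ltW|exact: mulr_ge0].
  move=> X f f0 mf XL K K0 fK; have [mX _ _ _] := XL.
  have := moment_lt2 XL p0 p2; rewrite integral_kernel_powR // -cE -c'E -/(N p).
  move=> /(@le_trans _ _ _ _ (c' * (N p * K))%:E) H.
  have {H} : (c%:E * \int[P]_w (`|X w| `^ p)%:E <= (c' * (N p * K))%:E)%E.
    by apply: H; rewrite EFinM lee_wpmul2l ?lee_fin // EFinM lee_wpmul2l ?lee_fin.
  rewrite -lee_pdivlMl // => /le_trans; apply; rewrite -EFinM lee_fin.
  by rewrite !mulrA.
have nu2 := levy_integral_sqr_lty p2 nup.
(* After rescaling, [|g|^p] has integral at most 1, and [g^2 <= 1 + |g|^p] on [A] gives at most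
   [T + 1] for the square; so [K0] bounds both kernel integrals independently of [f]. *)
pose K0 := Num.max ((T + 1) * N 2) (N p).
have K00 : 0 <= K0 by rewrite le_max N0 orbT.
have pN : p <= 2 * (Num.bound p)%:R by have := archi_boundP (ltW p0); lra.
have [C HC] := @moment_bound_exists _ _ _ P _ _ rho p K0 p2 K00 _ _ p0 pN (lexx p).
exists (Num.max C 0); first by rewrite le_max lexx orbT.
move=> X f f0 mf XL K KK fK; have [mX _ _ _] := XL.
pose c := K `^ (- p^-1).
have c0 : 0 < c by rewrite powR_gt0.
have cp : c `^ p = K^-1 by rewrite powR_inv.
pose g x := c * f x.
have mg : measurable_fun setT g by exact: measurable_funM.
have YL : symmetric_id_law P rho (fun w => c * X w) (kernel g).
  have := symmetric_id_law_scale c XL.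
  by rewrite (_ : (fun x => c * _) = kernel g) //; apply/funext => z; rewrite mulrA.
have mpw q (h : S -> R) : measurable_fun setT h -> measurable_fun setT (fun x => `|h x| `^ q).
  exact: measurable_normr_powR.
have gp : (\int[leb]_x (`|g x| `^ p)%:E <= 1%:E)%E.
  have -> : (\int[leb]_x (`|g x| `^ p)%:E = K^-1%:E * \int[leb]_x (`|f x| `^ p)%:E)%E.
    rewrite -ge0_integralZl_fin ?invr_ge0 ?(ltW KK) //; last exact: mpw.
    by apply: eq_integral => x _; rewrite /g normrM powRM // (gtr0_norm c0) cp.
  by rewrite lee_pdivrMl // mule1.
have g2 : (\int[leb]_x (`|g x| `^ 2)%:E <= (T + 1)%:E)%E.
  apply: (@le_trans _ _ (\int[leb]_x ((\1_A x)%:E + (`|g x| `^ p)%:E))%E).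
    apply: ge0_le_integral => //.
    - by apply/measurable_EFinP; exact: mpw.
    - apply/measurable_EFinP; apply: measurable_funD; last exact: mpw.
      exact: measurable_indic.
    - move=> x _; rewrite -EFinD lee_fin indicE; have [xT|xT] := pselect (A x).
        rewrite mem_set // mulr1n; have [g1|g1] := leP `|g x| 1.
          rewrite (@le_trans _ _ 1) ?lerDl ?powR_ge0 //.
          by rewrite sqr_normr_powR -real_normK ?num_real // expr_le1.
        by rewrite (@le_trans _ _ (`|g x| `^ p)) ?lerDr // ler_powR // ltW.
      by rewrite memNset // add0r /g f0 // mulr0 normr0 !powR0 ?gt_eqF // ltr0n.
  rewrite ge0_integralD //; last 2 first.
  - by apply/measurable_EFinP; exact: measurable_indic.
  - by apply/measurable_EFinP; exact: mpw.
  by rewrite integral_indic ?setIT // EFinD leeD.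
have := HC _ _ YL.
have k2 : (\int[rho]_z ((kernel g) z ^+ 2)%:E <= K0%:E)%E.
  under eq_integral do rewrite -sqr_normr_powR.
  rewrite integral_kernel_powR // -/(N 2).
  apply: (@le_trans _ _ ((N 2)%:E * (T + 1)%:E)%E); first by rewrite lee_wpmul2l ?lee_fin.
  by rewrite -EFinM lee_fin le_max mulrC lexx.
have kp : (\int[rho]_z (`|(kernel g) z| `^ p)%:E <= K0%:E)%E.
  rewrite integral_kernel_powR // -/(N p).
  apply: (@le_trans _ _ ((N p)%:E * 1)%E); first by rewrite lee_wpmul2l ?lee_fin.
  by rewrite mule1 lee_fin le_max lexx orbT.
move=> /(_ k2 kp).
have -> : (\int[P]_w (`|c * X w| `^ p)%:E = K^-1%:E * \int[P]_w (`|X w| `^ p)%:E)%E.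
  rewrite -ge0_integralZl_fin ?invr_ge0 ?(ltW KK) //; last exact: measurable_normr_powR.
  by apply: eq_integral => w _; rewrite normrM powRM // (gtr0_norm c0) cp.
rewrite lee_pdivrMl // => /le_trans; apply.
by rewrite -EFinM lee_fin mulrC ler_pM2r // le_max lexx.
Qed.

End levy_integral_moments.

(** * Kernel estimates and moments of increments *)

Section kernel_estimates.
Context {R : realType}.
Implicit Types s t u b c : R.
Local Notation mu := (@lebesgue_measure R).

Lemma measurable_powR_comp (D : set R) (f : R -> R) c : measurable_fun D f ->
  measurable_fun D (fun u => f u `^ c).
Proof. by move=> mf; apply: (measurableT_comp (measurable_powR c)). Qed.

(** The sign of the exponent decides which end of [[d / 2, d]] is the worst; the factor covers both
    cases. *)
Lemma powR_half_le (d x c : R) : 0 < d -> d / 2 <= x -> x <= d ->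
  x `^ c <= (1 + 2 `^ (- c)) * d `^ c.
Proof.
move=> d0 dx xd; have x0 : 0 < x by lra.
have [c0|c0] := leP 0 c.
  rewrite (@le_trans _ _ (d `^ c)) ?ge0_ler_powR ?nnegrE ?(ltW x0) ?(ltW d0) //.
  by rewrite ler_peMl ?powR_ge0 // lerDl powR_ge0.
rewrite (@le_trans _ _ ((d / 2) `^ c)) //.
  rewrite -[c]opprK !(powRN _ (- c)) lef_pV2 ?posrE ?powR_gt0 ?divr_gt0 //.
  by rewrite ge0_ler_powR ?nnegrE ?oppr_ge0 ?(ltW c0) ?(ltW x0) // divr_ge0 // ltW.
rewrite powRM ?invr_ge0 ?(ltW d0) // mulrC ler_wpM2r ?powR_ge0 //.
by rewrite -powR_inv1 // -powRrM mulN1r lerDr.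
Qed.

(** On each half of the interval the nonsingular factor is comparable with a power of the length,
    and the other factor is integrated explicitly; the two halves give the two terms of the
    constant. *)
Lemma integral_beta_le s t b c : s < t -> -1 < b -> -1 < c ->
  (\int[mu]_(u in `]s, t[) ((u - s) `^ b * (t - u) `^ c)%:E <=
   (((1 + 2 `^ (- c)) / (b + 1) + (1 + 2 `^ (- b)) / (c + 1)) * (t - s) `^ (b + c + 1))%:E)%E.
Proof.
move=> st b1 c1; pose d := t - s; have d0 : 0 < d by rewrite subr_gt0.
pose kb := 1 + 2 `^ (- b); pose kc := 1 + 2 `^ (- c).
have kb0 : 0 <= kb by rewrite addr_ge0 ?powR_ge0.
have kc0 : 0 <= kc by rewrite addr_ge0 ?powR_ge0.
have mI : measurable (`]s, t[%classic : set R) by exact: measurable_itv.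
have ms e : measurable_fun (`]s, t[%classic : set R) (fun u => (u - s) `^ e).
  by apply: measurable_powR_comp; exact: measurable_funB.
have mt e : measurable_fun (`]s, t[%classic : set R) (fun u => (t - u) `^ e).
  by apply: measurable_powR_comp; exact: measurable_funB.
have mst : measurable_fun (`]s, t[%classic : set R) (fun u => (u - s) `^ b * (t - u) `^ c).
  exact: measurable_funM (ms b) (mt c).
have m1 : measurable_fun (`]s, t[%classic : set R) (fun u => kc * d `^ c * (u - s) `^ b).
  exact: measurable_funM.
have m2 : measurable_fun (`]s, t[%classic : set R) (fun u => kb * d `^ b * (t - u) `^ c).
  exact: measurable_funM.
have scal (k : R) (f : R -> R) : 0 <= k -> measurable_fun (`]s, t[%classic : set R) f -> (forall x, 0 <= f x) ->
    (\int[mu]_(u in `]s, t[) (k * f u)%:E = k%:E * \int[mu]_(u in `]s, t[) (f u)%:E)%E.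
  move=> k0 mf f0; rewrite -ge0_integralZl_EFin //; last by apply/measurable_EFinP.
  by move=> x _; rewrite lee_fin.
apply: (@le_trans _ _ (\int[mu]_(u in `]s, t[) ((kc * d `^ c * (u - s) `^ b)%:E +
    (kb * d `^ b * (t - u) `^ c)%:E))%E).
  apply: ge0_le_integral => //.
  - by move=> u _; rewrite lee_fin mulr_ge0 ?powR_ge0.
  - exact/measurable_EFinP.
  - by apply/measurable_EFinP; exact: measurable_funD m1 m2.
  - move=> u; rewrite /= in_itv /= => /andP[su ut]; rewrite -EFinD lee_fin.
    have [um|um] := leP (u - s) (d / 2).
      have : (t - u) `^ c <= kc * d `^ c by apply: powR_half_le => //; rewrite /d in um *; lra.
      move=> h; rewrite (@le_trans _ _ (kc * d `^ c * (u - s) `^ b)) //.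
        by rewrite mulrC ler_wpM2r ?powR_ge0.
      by rewrite lerDl !mulr_ge0 ?powR_ge0.
    have : (u - s) `^ b <= kb * d `^ b by apply: powR_half_le => //; rewrite /d in um *; lra.
    move=> h; rewrite (@le_trans _ _ (kb * d `^ b * (t - u) `^ c)) //.
      by rewrite ler_wpM2r ?powR_ge0.
    by rewrite lerDr !mulr_ge0 ?powR_ge0.
rewrite ge0_integralD //; first last.
- exact/measurable_EFinP.
- by move=> u _; rewrite lee_fin !mulr_ge0 ?powR_ge0.
- exact/measurable_EFinP.
- by move=> u _; rewrite lee_fin !mulr_ge0 ?powR_ge0.
rewrite !scal ?mulr_ge0 ?powR_ge0 //; try by move=> x; rewrite powR_ge0.
apply: (@le_trans _ _ ((kc * d `^ c)%:E * (d `^ (b + 1) / (b + 1))%:E +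
    (kb * d `^ b)%:E * (d `^ (c + 1) / (c + 1))%:E)%E).
  apply: leeD; rewrite lee_wpmul2l ?lee_fin ?mulr_ge0 ?powR_ge0 //.
    exact: integral_powR_subl_le.
  exact: integral_powR_subr_le.
rewrite -!EFinM -EFinD lee_fin -/d !(powRD_gt0 _ _ d0).
rewrite le_eqVlt; apply/orP; left; apply/eqP; rewrite /kb /kc; ring.
Qed.

(** From [u / t >= (u - s) / (t - s)] a negative power of [u] is controlled by the same power of
    [u - s], while a positive one is bounded by [t^b]; hence [b' = min(b, 0)]. After the Beta
    estimate [b'] cancels and [t^(a+b) (t-s)^(c+1)] remains. Now [t >= t - s] if [a + b < 0], and
    [t <= T] otherwise: this is the origin of the two cases of [kappa]. *)
Lemma integral_kernel_le (T a b c : R) : 0 < T -> -1 < b -> -1 < c -> -1 < a + b + c ->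
  exists2 C, 0 <= C & forall s t, 0 <= s -> s < t -> t <= T ->
  (\int[mu]_(u in `]s, t[) (t `^ a * u `^ b * (t - u) `^ c)%:E <=
   (C * (t - s) `^ ((if a + b < 0 then a + b + c else c) + 1))%:E)%E.
Proof.
move=> T0 b1 c1 abc; pose b' := Num.min b 0.
have b'1 : -1 < b' by rewrite /b' lt_min b1 /=; lra.
have b'0 : b' <= 0 by rewrite ge_min lexx orbT.
pose B := (1 + 2 `^ (- c)) / (b' + 1) + (1 + 2 `^ (- b')) / (c + 1).
have B0 : 0 <= B.
  have b0 : 0 <= b' + 1 by lra.
  have c0 : 0 <= c + 1 by lra.
  by rewrite addr_ge0 // divr_ge0 // addr_ge0 ?powR_ge0.
exists (B * (1 + T `^ (a + b))) => [|s t s0 st tT].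
  by rewrite mulr_ge0 // addr_ge0 ?powR_ge0.
pose d := t - s; have d0 : 0 < d by rewrite subr_gt0.
have t0 : 0 < t := le_lt_trans s0 st.
have key u : s < u -> u < t -> u `^ b <= t `^ b * d `^ (- b') * (u - s) `^ b'.
  move=> su ut; have u0 : 0 < u := le_lt_trans s0 su.
  have us0 : 0 < u - s by rewrite subr_gt0.
  rewrite /b'; have [b0|b0] := leP b 0; last first.
    rewrite oppr0 !powRr0 !mulr1.
    by rewrite ge0_ler_powR ?nnegrE ?(ltW b0) ?(ltW u0) ?(ltW t0) ?(ltW ut).
  have h : t * d^-1 * (u - s) <= u.
    rewrite mulrAC ler_pdivrMr //; rewrite /d; nra.
  have h0 : 0 < t * d^-1 * (u - s) by rewrite !mulr_gt0 ?invr_gt0.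
  have -> : t `^ b * d `^ (- b) * (u - s) `^ b = (t * d^-1 * (u - s)) `^ b.
    rewrite !powRM ?mulr_ge0 ?invr_ge0 ?(ltW d0) ?(ltW t0) ?(ltW us0) //.
    by rewrite -powR_inv1 ?(ltW d0) // -powRrM mulN1r.
  rewrite -[b]opprK !(powRN _ (- b)) lef_pV2 ?posrE ?powR_gt0 //.
  by rewrite ge0_ler_powR ?nnegrE ?oppr_ge0 ?(ltW u0) ?(ltW h0).
have mI : measurable (`]s, t[%classic : set R) by exact: measurable_itv.
have mpw (f : R -> R) (e : R) : measurable_fun (`]s, t[%classic : set R) f ->
    measurable_fun (`]s, t[%classic : set R) (fun u => f u `^ e).
  by move=> mf; exact: measurable_powR_comp.
have mB : measurable_fun (`]s, t[%classic : set R) (fun u => (u - s) `^ b' * (t - u) `^ c).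
  by apply: measurable_funM; apply: mpw; exact: measurable_funB.
pose K := t `^ (a + b) * d `^ (- b').
have K0 : 0 <= K by rewrite mulr_ge0 ?powR_ge0.
apply: (@le_trans _ _ (\int[mu]_(u in `]s, t[) (K%:E * ((u - s) `^ b' * (t - u) `^ c)%:E))%E).
  apply: ge0_le_integral => //.
  - by move=> u _; rewrite lee_fin !mulr_ge0 ?powR_ge0.
  - apply/measurable_EFinP; apply: measurable_funM; last by apply: mpw; exact: measurable_funB.
    by apply: measurable_funM => //; exact: mpw.
  - by apply/measurable_EFinP; exact: measurable_funM.
  - move=> u; rewrite /= in_itv /= => /andP[su ut]; rewrite -EFinM lee_fin mulrA.
    rewrite ler_wpM2r ?powR_ge0 // /K (powRD_gt0 _ _ t0) -!mulrA ler_wpM2l ?powR_ge0 //.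
    by rewrite mulrA; exact: key.
rewrite ge0_integralZl_EFin //; last 2 first.
- by move=> u _; rewrite lee_fin mulr_ge0 ?powR_ge0.
- exact/measurable_EFinP.
apply: (@le_trans _ _ (K%:E * (B * d `^ (b' + c + 1))%:E)%E).
  by rewrite lee_wpmul2l ?lee_fin //; exact: integral_beta_le.
rewrite -EFinM lee_fin /K -/d.
have -> : t `^ (a + b) * d `^ (- b') * (B * d `^ (b' + c + 1)) = B * (t `^ (a + b) * d `^ (c + 1)).
  rewrite -addrA (powRD_gt0 b' (c + 1) d0) powRN.
  by field; rewrite gt_eqF // powR_gt0.
rewrite -mulrA ler_wpM2l //; case: ifPn => ab.
  rewrite -[a + b + c + 1]addrA (powRD_gt0 (a + b) (c + 1) d0) mulrA ler_wpM2r ?powR_ge0 //.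
  rewrite (@le_trans _ _ (d `^ (a + b))) ?ler_peMl ?powR_ge0 ?lerDl ?powR_ge0 //.
  rewrite -[a + b]opprK !(powRN _ (- (a + b))) lef_pV2 ?posrE ?powR_gt0 //.
  rewrite ge0_ler_powR ?nnegrE ?oppr_ge0 ?(ltW ab) ?(ltW d0) ?(ltW t0) //.
  by rewrite /d lerBlDr lerDl.
rewrite ler_wpM2r ?powR_ge0 // (@le_trans _ _ (T `^ (a + b))) ?lerDr //.
by rewrite ge0_ler_powR ?nnegrE ?(ltW T0) ?(ltW t0) // leNgt.
Qed.

Lemma powR_le_min (T x a m : R) : 0 < x -> x <= T -> m <= a ->
  x `^ a <= T `^ (a - m) * x `^ m.
Proof.
move=> x0 xT ma; rewrite -{1}(subrK m a) (powRD_gt0 _ _ x0) ler_wpM2r ?powR_ge0 //.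
by rewrite ge0_ler_powR ?nnegrE ?subr_ge0 ?(ltW x0) // (le_trans (ltW x0)).
Qed.

(** On []0, s[] both kernels are present and their difference is estimated; on []s, t[] only the
    later one is. *)
Lemma integral_powR_split_le (p s t a : R) (f h k : R -> R) : 0 <= s -> s < t -> 0 < p -> 0 <= a ->
  measurable_fun setT f -> measurable_fun (`]0, s[%classic : set R) h ->
  measurable_fun (`]s, t[%classic : set R) k -> (forall x, 0 <= k x) ->
  (forall x, ~ (`]0, t]%classic : set R) x -> f x = 0) ->
  (forall x, 0 < x -> x < s -> `|f x| <= a * h x) ->
  (forall x, s < x -> x < t -> `|f x| `^ p <= k x) ->
  (\int[mu]_x (`|f x| `^ p)%:E <=
   (a `^ p)%:E * \int[mu]_(u in `]0%R, s[) (`|h u| `^ p)%:E + \int[mu]_(u in `]s, t[) (k u)%:E)%E.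
Proof.
move=> s0 st p0 a0 mf mh mk k0 f0 fh fk.
have m0s : measurable (`]0, s[%classic : set R) by exact: measurable_itv.
have mst : measurable (`]s, t[%classic : set R) by exact: measurable_itv.
pose F1 := (fun u => (a `^ p)%:E * (`|h u| `^ p)%:E)%E.
pose F2 := fun u => (k u)%:E.
have mF1 : measurable_fun (`]0, s[%classic : set R) F1.
  apply/measurable_EFinP; apply: measurable_funM => //.
  by apply: measurable_powR_comp; exact: measurableT_comp.
have mF2 : measurable_fun (`]s, t[%classic : set R) F2 by exact/measurable_EFinP.
have F10 u : (0 <= F1 u)%E by rewrite /F1 -EFinM lee_fin mulr_ge0 ?powR_ge0.
have F20 u : (0 <= F2 u)%E by rewrite lee_fin.
rewrite -ge0_integralZl_EFin ?powR_ge0 //; last first.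
  by apply/measurable_EFinP; apply: measurable_powR_comp; exact: measurableT_comp.
apply: (@le_trans _ _ (\int[mu]_x (F1 \_ `]0%R, s[) x + \int[mu]_x (F2 \_ `]s, t[) x)%E); last first.
  by rewrite -!integral_mkcond.
have r1 : measurable_fun setT (F1 \_ `]0, s[) by apply/(measurable_restrictT _ m0s).
have r2 : measurable_fun setT (F2 \_ `]s, t[) by apply/(measurable_restrictT _ mst).
have r10 u : (0 <= (F1 \_ `]0%R, s[) u)%E by rewrite patchE; case: ifP.
have r20 u : (0 <= (F2 \_ `]s, t[) u)%E by rewrite patchE; case: ifP.
rewrite -ge0_integralD //.
apply: ae_ge0_le_integral => //.
- by apply/measurable_EFinP; exact: measurable_normr_powR.
- by move=> u _; rewrite adde_ge0.
- exact: emeasurable_funD.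
(* The bounds on [f] are assumed strictly inside the two intervals; the common endpoint and the
   right end form a null set. *)
exists [set s; t]; split.
- by apply: measurableU; exact: measurable_set1.
- have s1 (x : R) : mu [set x] = 0%E by exact: lebesgue_measure_set1.
  apply/eqP; rewrite eq_le measure_ge0 andbT -(adde0 0%E) -{1}(s1 s) -(s1 t).
  by apply: measureU2; exact: measurable_set1.
move=> x /= H; apply: contrapT => xst; apply: H => _.
have xs : x != s by apply/eqP => xs; apply: xst; left.
have xt : x != t by apply/eqP => xt; apply: xst; right.
have [x0|x0] := leP x 0.
  rewrite f0; last by rewrite /= in_itv /= ltNge x0.
  by rewrite normr0 powR0 ?gt_eqF // adde_ge0.
have [tx|tx] := ltP t x.
  rewrite f0; last by rewrite /= in_itv /= x0 leNgt tx.
  by rewrite normr0 powR0 ?gt_eqF // adde_ge0.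
have {}tx : x < t by rewrite lt_neqAle xt.
have [sx|sx] := ltP x s.
  rewrite -[leLHS]adde0; apply: leeD => //; rewrite patchE mem_set /= ?in_itv /= ?x0 //.
  rewrite /F1 -EFinM lee_fin -powRM //.
  rewrite ge0_ler_powR ?nnegrE ?mulr_ge0 ?(ltW p0) // (le_trans (fh x x0 sx)) //.
  by rewrite ler_wpM2l // ler_norm.
have {}sx : s < x by rewrite lt_neqAle eq_sym xs.
rewrite -[leLHS]add0e; apply: leeD => //; rewrite patchE mem_set /= ?in_itv /= ?sx //.
by rewrite lee_fin fk.
Qed.

End kernel_estimates.

Section increment_moments.
Context d (Omega : measurableType d) (R : realType) (P : probability Omega R).
Context (T p : R) (nu : {measure set R -> \bar R}) (Z Y : R -> {RV P >-> R}) (g : R -> R -> R).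
Context (alpha beta gamma delta : R).
Hypotheses (T0 : 0 < T) (hZ : levy_process T Z) (hT : has_triplet T Z 0 0 nu)
  (hnu : levy_measure nu) (snu : symmetric_measure nu)
  (hY : forall t : R, 0 <= t <= T -> is_levy_integral Z t (g t) (Y t))
  (p0 : 0 < p) (nup : (\int[nu]_x (`|x| `^ p)%:E < +oo)%E).
Local Notation leb := (@lebesgue_measure R).

(** The law of the increment meets the moment bound here. The measures are replaced by bundled
    sigma-finite copies with the same values, to which the integrals are transported. *)
Lemma levy_integral_increment_moment_le : exists2 C : R, 0 <= C &
  forall s t : R, 0 <= s -> s <= t -> t <= T ->
  let f x := g t x * \1_(`]0, t]%classic : set R) x - g s x * \1_(`]0, s]%classic : set R) x in
  measurable_fun setT f /\
  forall K : R, 0 < K -> (\int[leb]_x (`|f x| `^ p)%:E <= K%:E)%E ->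
  (\int[P]_w (`|Y t w - Y s w| `^ p)%:E <= (C * K)%:E)%E.
Proof.
have [nu' nu'E] := levy_measure_sigma_finite_measure hnu.
have nuA A : nu' A = nu A by exact: (congr1 (fun m => m A) nu'E).
have nuI (F : R -> \bar R) : (\int[nu']_x F x = \int[nu]_x F x)%E.
  by apply: eq_measure_integral => A _ _; exact: nuA.
have hnu' : levy_measure nu' by split; [rewrite -[RHS]hnu.1; exact: nuA|
  have := hnu.2; rewrite -nuI; exact].
have nup' : (\int[nu']_x (`|x| `^ p)%:E < +oo)%E by have := nup; rewrite -nuI; exact.
have symE u : levy_symbol nu' u = levy_symbol nu u by congr fine; exact: nuI.
have [leb' lebE] : exists leb' : {sigma_finite_measure set (measurableTypeR R) -> \bar R},
    (leb' : set (measurableTypeR R) -> \bar R) = leb.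
  by exists [the {sigma_finite_measure set (measurableTypeR R) -> \bar R} of leb].
have lebI (F : R -> \bar R) : (\int[leb']_x F x = \int[leb]_x F x)%E.
  by apply: eq_measure_integral => A _ _; exact: (congr1 (fun m => m A) lebE).
have [rho rhoE] := product_sigma_finite_measure leb' nu'.
have mA : measurable (`]0, T]%classic : set (measurableTypeR R)) by exact: measurable_itv.
have AT : (leb' (`]0%R, T]%classic : set R) <= T%:E)%E.
  by rewrite lebE lebesgue_itvoc // ltW.
have [C C0 HC] := levy_integral_moment_le P hnu' rhoE mA AT (ltW T0) p0 nup'.
exists C => // s t s0 st tT f.
have t0 : 0 <= t := le_trans s0 st.
have sT : 0 <= s <= T by rewrite s0 (le_trans st tT).
have tT' : 0 <= t <= T by rewrite t0.
have [mf ch] := levy_integral_increment_charfun hZ hT hnu snu s0 st tT (hY sT) (hY tT').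
split => // K K0 fK.
apply: (HC (fun w => Y t w - Y s w) f) => //.
- move=> x xT; rewrite /f !indicE !memNset ?mulr0 ?subrr // => xs; apply: xT; move: xs;
    rewrite /= !in_itv /= => /andP[-> /le_trans]; apply => //; exact: le_trans st tT.
- apply: (symmetric_id_law_kernel hnu' rhoE) => //.
    by apply: measurable_funB; exact: measurable_funPT.
  move=> u; have [iu cu su] := ch u; split => //.
  + have -> : (fun x => levy_symbol nu' (u * f x)) = fun x => levy_symbol nu (u * f x).
      by apply/funext => x; exact: symE.
    apply/integrableP; split; first by move/integrableP: iu => [].
    by rewrite lebI; move/integrableP: iu => [].
  + rewrite cu; congr (expR (- fine _)); rewrite -lebI.
    by apply: eq_integral => x _; rewrite symE.
- by rewrite lebI.
Qed.

Hypotheses (beta_gt : - p^-1 < beta) (gamma_gt : - p^-1 < gamma)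
  (sum_gt : - p^-1 < alpha + beta + gamma).
Variables (C : R) (h : R -> R -> R -> R).
Hypothesis g_le : forall t u : R, 0 < u -> u < t -> t <= T ->
  `|g t u| <= C * t `^ alpha * u `^ beta * (t - u) `^ gamma.
Hypotheses (mh : forall t s : R, 0 < s -> s < t -> t <= T -> measurable_fun `]0, s[ (h t s))
  (hle : forall t s u : R, 0 < u -> u < s -> s < t -> t <= T ->
    `|g t u - g s u| <= `|t - s| `^ delta * h t s u)
  (hsup : (ereal_sup
    [set \int[lebesgue_measure]_(u in `]0%R, st.1[) (`|h st.2 st.1 u| `^ p)%:E
    | st in [set st : R * R | (0 < st.1 < st.2)%R /\ (st.2 <= T)%R]] < +oo)%E).
Local Notation kappa := (if alpha + beta < 0 then alpha + beta + gamma else gamma).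

Lemma increment_moment_le : exists2 C' : R, 0 <= C' & forall s t : R, 0 <= s -> s < t -> t <= T ->
  (\int[P]_w (`|Y t w - Y s w| `^ p)%:E <=
   (C' * (t - s) `^ Num.min (kappa * p + 1) (delta * p))%:E)%E.
Proof.
set m := Num.min _ _.
have [C1 C10 H1] := levy_integral_increment_moment_le.
have mulp x : - p^-1 < x -> -1 < x * p.
  by rewrite -(ltr_pM2r p0) mulNr mulVf ?gt_eqF.
have sump : -1 < alpha * p + beta * p + gamma * p by rewrite -!mulrDl mulp.
have [C2 C20 H2] := integral_kernel_le T0 (mulp _ beta_gt) (mulp _ gamma_gt) sump.
have kE : (if alpha * p + beta * p < 0 then alpha * p + beta * p + gamma * p else gamma * p) =
    kappa * p.
  by rewrite -mulrDl pmulr_llt0 //; case: ifP; rewrite ?mulrDl.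
have [H H0 hH] : exists2 H : R, 0 <= H & forall s t : R, 0 <= s -> s < t -> t <= T ->
    (\int[leb]_(u in `]0%R, s[) (`|h t s u| `^ p)%:E <= H%:E)%E.
  move: hsup; set S := ereal_sup _ => Soo.
  (* The maximum with 0 makes the bound a finite number and serves [s = 0], where the interval is
     empty and the supremum says nothing. *)
  exists (fine (Order.max S 0%E)); first by rewrite fine_ge0 // le_max lexx orbT.
  have fS : Order.max S 0%E \is a fin_num.
    rewrite ge0_fin_numE; first by rewrite gt_max Soo ltry.
    by rewrite le_max lexx orbT.
  move=> s t s0 st tT; rewrite fineK //.
  have [s00|s00] := eqVneq s 0.
    by rewrite s00 set_itvoo0 integral_set0 le_max lexx orbT.
  rewrite le_max; apply/orP; left; apply: ereal_sup_ubound.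
  by exists (s, t) => //=; rewrite lt_neqAle eq_sym s00 s0.
(* The powers of [T] bring both exponents down to their minimum [m]; the final 1 makes [K] positive,
   as the rescaled moment bound demands. *)
pose K := H * T `^ (delta * p - m) + `|C| `^ p * (C2 * T `^ (kappa * p + 1 - m)) + 1.
have K0 : 0 < K.
  by rewrite ltr_wpDl // addr_ge0 // ?mulr_ge0 ?powR_ge0.
exists (C1 * K) => [|s t s0 st tT]; first by rewrite mulr_ge0 // ltW.
have d0 : 0 < t - s by rewrite subr_gt0.
have dT : t - s <= T by lra.
have [mf] := H1 s t s0 (ltW st) tT; set f := (fun x => _) in mf * => H3.
rewrite -mulrA; apply: H3; first by rewrite mulr_gt0 // powR_gt0.
have t0 : 0 < t := le_lt_trans s0 st.
pose k u := `|C| `^ p * (t `^ (alpha * p) * u `^ (beta * p) * (t - u) `^ (gamma * p)).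
have mIk : measurable_fun (`]s, t[%classic : set R)
    (fun u => t `^ (alpha * p) * u `^ (beta * p) * (t - u) `^ (gamma * p)).
  apply: measurable_funM.
    by apply: measurable_funM => //; exact: measurable_powR_comp.
  by apply: measurable_powR_comp; exact: measurable_funB.
have mk : measurable_fun (`]s, t[%classic : set R) k by exact: measurable_funM.
have mhs : measurable_fun (`]0, s[%classic : set R) (h t s).
  have [s00|s00] := eqVneq s 0; first by rewrite s00 set_itvoo0; exact: measurable_fun_set0.
  by apply: mh => //; rewrite lt_neqAle eq_sym s00 s0.
have a0 : 0 <= `|t - s| `^ delta by exact: powR_ge0.
apply: (le_trans (integral_powR_split_le s0 st p0 a0 mf mhs mk _ _ _ _)).
- by move=> u; rewrite !mulr_ge0 ?powR_ge0.
- move=> x xt; rewrite /f !indicE !memNset ?mulr0 ?subrr //.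
  by move=> xs; apply: xt; move: xs; rewrite /= !in_itv /= => /andP[-> /le_trans]; apply; exact: ltW.
- move=> x x0 xs; rewrite /f !indicE !mem_set /= ?in_itv /= ?x0 ?(ltW xs) ?mulr1 //.
    exact: hle.
  by rewrite (le_trans (ltW xs) (ltW st)).
- move=> x sx xt; have x0 : 0 < x := le_lt_trans s0 sx.
  rewrite /f !indicE mem_set /= ?in_itv /= ?x0 ?(ltW xt) // memNset /=; last first.
    by rewrite in_itv /= x0 leNgt sx.
  rewrite mulr1 mulr0 subr0 /k !powRrM -!powRM ?mulr_ge0 ?powR_ge0 ?subr_ge0 ?(ltW xt) ?(ltW x0) ?(ltW t0) //.
  rewrite ge0_ler_powR ?nnegrE ?(ltW p0) ?mulr_ge0 ?powR_ge0 //.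
  rewrite (le_trans (g_le x0 xt tT)) // !mulrA.
  by rewrite !ler_wpM2r ?powR_ge0 // ler_norm.
have Ek : (\int[leb]_(u in `]s, t[) (k u)%:E <=
    (`|C| `^ p * (C2 * (t - s) `^ (kappa * p + 1)))%:E)%E.
  under eq_integral do rewrite EFinM.
  rewrite ge0_integralZl_EFin ?powR_ge0 //; last 2 first.
  - by move=> u _; rewrite lee_fin !mulr_ge0 ?powR_ge0.
  - exact/measurable_EFinP.
  by rewrite EFinM lee_wpmul2l ?lee_fin ?powR_ge0 // -kE H2.
apply: (@le_trans _ _ (((t - s) `^ (delta * p) * H)%:E + (`|C| `^ p * (C2 * (t - s) `^ (kappa * p + 1)))%:E)%E).
  apply: leeD => //; rewrite EFinM gtr0_norm // -powRrM.
  by rewrite lee_wpmul2l ?lee_fin ?powR_ge0 // hH.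
rewrite -EFinD lee_fin /K !mulrDl mul1r.
have e1 : (t - s) `^ (delta * p) <= T `^ (delta * p - m) * (t - s) `^ m.
  by apply: powR_le_min => //; rewrite ge_min lexx orbT.
have e2 : (t - s) `^ (kappa * p + 1) <= T `^ (kappa * p + 1 - m) * (t - s) `^ m.
  by apply: powR_le_min => //; rewrite ge_min lexx.
rewrite -[leLHS]addr0 lerD ?powR_ge0 // lerD //.
  by rewrite mulrC -mulrA ler_wpM2l.
by rewrite -!mulrA ler_wpM2l ?powR_ge0 // ler_wpM2l.
Qed.

End increment_moments.

(** * Kolmogorov continuity *)

Section dyadic_paths.
Context {R : realType}.
Variables (y : nat -> nat -> R) (K q : R).
Hypotheses (K0 : 0 <= K) (q0 : 0 < q) (q1 : q < 1).
Hypothesis y_double : forall n k, y n.+1 k.*2 = y n k.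
Hypothesis y_step : forall n k, (k < 2 ^ n)%N -> `|y n k.+1 - y n k| <= K * q ^+ n.

Definition dyadic_path n (x : R) : R := y n (Num.truncn (2 ^+ n * x)).

Lemma truncn_bounds n (x : R) : 0 <= x -> x <= 1 -> let j := Num.truncn (2 ^+ n * x) in
  [/\ j%:R <= 2 ^+ n * x, 2 ^+ n * x < j%:R + 1 & (j <= 2 ^ n)%N].
Proof.
move=> x0 x1 j; have x2 : 0 <= 2 ^+ n * x by rewrite mulr_ge0 // exprn_ge0.
have := truncn_itv x2; rewrite -/j -[j.+1%:R]natr1 => /andP[j1 j2]; split => //.
by rewrite -(ler_nat R) natrX (le_trans j1) // ler_piMr // exprn_ge0.
Qed.

(** The index at level [n + 1] is twice the index at level [n], or one more; the grid point is thus
    either unchanged or moved by one step of the finer grid. *)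
Lemma dyadic_pathS n (x : R) : 0 <= x -> x <= 1 ->
  `|dyadic_path n.+1 x - dyadic_path n x| <= K * q ^+ n.+1.
Proof.
move=> x0 x1; have [j1 j2 j3] := truncn_bounds n x0 x1.
have [i1 i2 i3] := truncn_bounds n.+1 x0 x1.
rewrite /dyadic_path; move: (Num.truncn _) (Num.truncn _) j1 j2 j3 i1 i2 i3 => i j j1 j2 j3 i1 i2 i3.
have ij1 : (j.*2 <= i)%N.
  rewrite -ltnS -(ltr_nat R) -natr1 -mul2n natrM; move: i2; rewrite exprS -mulrA; lra.
have ij2 : (i <= j.*2.+1)%N.
  rewrite -ltnS -(ltr_nat R) -!natr1 -mul2n natrM; move: i1; rewrite exprS -mulrA; lra.
have : (i == j.*2) || (i == j.*2.+1).
  by move: ij2; rewrite leq_eqVlt ltnS [(i <= _)%N]leq_eqVlt => /or3P[->|->|]; rewrite ?orbT // ltnNge ij1.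
move=> /orP[] /eqP E.
  by rewrite E y_double subrr normr0 mulr_ge0 // exprn_ge0 // ltW.
by rewrite E -(y_double n j); apply: y_step; rewrite -E.
Qed.

Lemma dyadic_path_dist n m (x : R) : 0 <= x -> x <= 1 ->
  `|dyadic_path (n + m) x - dyadic_path n x| <= K * q ^+ n.+1 / (1 - q).
Proof.
move=> x0 x1; have q1' : 0 < 1 - q by rewrite subr_gt0.
(* The exact partial geometric sum is what the induction on [m] carries. *)
suff H : `|dyadic_path (n + m) x - dyadic_path n x| <=
    K * (q ^+ n.+1 - q ^+ (n + m).+1) / (1 - q).
  apply: (le_trans H); rewrite ler_pM2r ?invr_gt0 // ler_wpM2l // lerBlDr lerDl.
  by rewrite exprn_ge0 // ltW.
elim: m => [|m IH]; first by rewrite addn0 !subrr normr0 mulr0 mul0r.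
rewrite addnS -(subrK (dyadic_path (n + m) x) (dyadic_path (n + m).+1 x)) -addrA.
apply: (le_trans (ler_normD _ _)).
apply: (@le_trans _ _ (K * q ^+ (n + m).+1 + K * (q ^+ n.+1 - q ^+ (n + m).+1) / (1 - q))).
  by apply: lerD => //; exact: dyadic_pathS.
rewrite le_eqVlt; apply/orP; left; apply/eqP; rewrite !exprS.
by field; rewrite gt_eqF.
Qed.

Lemma geometric_small (B e : R) : 0 <= B -> 0 < e -> exists N, B * q ^+ N < e.
Proof.
move=> B0 e0; have c : `|q| < 1 by rewrite gtr0_norm.
have := @cvg_expr R q c; move/cvgrPdist_lt => /(_ (e / (B + 1))).
have B1 : 0 < B + 1 by rewrite ltr_wpDl.
move=> /(_ (divr_gt0 e0 B1)) [N _ /(_ N (leqnn N))] /=.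
rewrite sub0r normrN gtr0_norm ?exprn_gt0 // ltr_pdivlMr // => h; exists N.
apply: le_lt_trans h; rewrite mulrC ler_wpM2l ?lerDl //.
by rewrite exprn_ge0 // ltW.
Qed.

Definition dyadic_limit (x : R) : R := limn (dyadic_path ^~ x).

Lemma cvg_dyadic_path (x : R) : 0 <= x -> x <= 1 ->
  dyadic_path n x @[n --> \oo] --> dyadic_limit x.
Proof.
move=> x0 x1; apply/cauchy_cvgP/cauchy_exP => e e0.
have q1' : 0 < 1 - q by rewrite subr_gt0.
have B0 : 0 <= K * q / (1 - q) by rewrite divr_ge0 ?mulr_ge0 // ltW.
have [N hN] := geometric_small B0 e0; exists (dyadic_path N x).
exists N => // n /= Nn; rewrite -ball_normE /= distrC -(subnKC Nn).
apply: (le_lt_trans (dyadic_path_dist _ _ x0 x1)); move: hN.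
by rewrite exprS mulrA mulrAC.
Qed.

Lemma dyadic_limit_dist n (x : R) : 0 <= x -> x <= 1 ->
  `|dyadic_limit x - dyadic_path n x| <= K * q ^+ n.+1 / (1 - q).
Proof.
move=> x0 x1; apply/ler_addgt0Pr => e e0.
have /cvgrPdist_lt /(_ e e0) [N _ HN] := cvg_dyadic_path x0 x1.
have h := HN (n + N)%N (leq_addl n N).
apply: (le_trans (ler_distD (dyadic_path (n + N) x) _ _)).
by rewrite addrC lerD ?dyadic_path_dist // ltW.
Qed.

(** Two points at distance at most [2^-n] have equal or adjacent indices at level [n]. *)
Lemma dyadic_path_close n (x x' : R) : 0 <= x -> x <= x' -> x' <= 1 ->
  2 ^+ n * (x' - x) <= 1 -> `|dyadic_path n x' - dyadic_path n x| <= K * q ^+ n.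
Proof.
move=> x0 xx' x'1 xn; have [j1 j2 j3] := truncn_bounds n x0 (le_trans xx' x'1).
have [i1 i2 i3] := truncn_bounds n (le_trans x0 xx') x'1.
have m : 2 ^+ n * x <= 2 ^+ n * x' by rewrite ler_wpM2l // exprn_ge0.
rewrite mulrBr in xn.
rewrite /dyadic_path; move: (Num.truncn _) (Num.truncn _) j1 j2 j3 i1 i2 i3 => i j j1 j2 j3 i1 i2 i3.
have ij1 : (j <= i)%N by rewrite -ltnS -(ltr_nat R) -natr1; lra.
have ij2 : (i <= j.+1)%N by rewrite -ltnS -(ltr_nat R) -!natr1; lra.
move: ij2; rewrite leq_eqVlt => /orP[/eqP E|ij2].
  by rewrite E; apply: y_step; rewrite -E.
have -> : i = j by apply/eqP; rewrite eqn_leq ij1 andbT -ltnS.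
by rewrite subrr normr0 mulr_ge0 // exprn_ge0 // ltW.
Qed.

Lemma dyadic_limit_holder (r : R) : 0 < r -> q = 2 `^ (- r) ->
  exists2 L : R, 0 <= L & forall x x', 0 <= x -> x <= x' -> x' <= 1 ->
    `|dyadic_limit x' - dyadic_limit x| <= L * (x' - x) `^ r.
Proof.
move=> r0 qr; have q1' : 0 < 1 - q by rewrite subr_gt0.
pose A := K + 2 * (K * q / (1 - q)).
have A0 : 0 <= A by rewrite addr_ge0 // mulr_ge0 // divr_ge0 ?mulr_ge0 // ltW.
exists (A * 2 `^ r) => [|x x' x0 xx' x'1]; first by rewrite mulr_ge0 ?powR_ge0.
move: xx'; rewrite le_eqVlt => /orP[/eqP <-|xx'].
  by rewrite subrr normr0 mulr_ge0 ?mulr_ge0 ?powR_ge0.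
have d0 : 0 < x' - x by rewrite subr_gt0.
(* The least such [n] is the scale of the pair: [x' - x] is at most [2^-n] by minimality, and [2^-n]
   is less than [2 (x' - x)], whence the factor [2^r]. The constant [A] counts one step at level [n]
   and two geometric tails. *)
have ex : exists n, 1 < 2 ^+ n.+1 * (x' - x).
  have h : `|2^-1 : R| < 1 by rewrite ger0_norm; lra.
  have /cvgrPdist_lt /(_ (x' - x) d0) [N _ /(_ N (leqnn N))] := @cvg_expr R 2^-1 h.
  rewrite /= sub0r normrN normrX ger0_norm // exprVn => hN; exists N.
  rewrite -ltr_pdivrMl ?exprn_gt0 // mulr1 (le_lt_trans _ hN) // lef_pV2 ?posrE ?exprn_gt0 //.
  by rewrite exprS ler_peMl ?exprn_ge0 // ler1n.
case: (ex_minnP ex) => n hn nmin.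
have hn' : 2 ^+ n * (x' - x) <= 1.
  case: n hn nmin => [|n] hn nmin; first by rewrite expr0 mul1r; lra.
  by rewrite leNgt; apply/negP => /nmin; rewrite ltnn.
have x1 : x <= 1 := le_trans (ltW xx') x'1.
have x'0 : 0 <= x' := le_trans x0 (ltW xx').
have e1 := dyadic_limit_dist n x0 x1; have e2 := dyadic_limit_dist n x'0 x'1.
have e3 := dyadic_path_close x0 (ltW xx') x'1 hn'.
have e4 : `|dyadic_limit x' - dyadic_limit x| <= A * q ^+ n.
  rewrite (_ : _ - _ = (dyadic_limit x' - dyadic_path n x') + (dyadic_path n x' - dyadic_path n x) +
    - (dyadic_limit x - dyadic_path n x)); last by ring.
  apply: (le_trans (ler_normD _ _)); rewrite normrN.
  apply: (@le_trans _ _ (K * q ^+ n.+1 / (1 - q) + K * q ^+ n + K * q ^+ n.+1 / (1 - q))).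
    by apply: lerD => //; apply: (le_trans (ler_normD _ _)); exact: lerD.
  by rewrite /A exprS; rewrite le_eqVlt; apply/orP; left; apply/eqP; field; rewrite gt_eqF.
apply: (le_trans e4); rewrite -mulrA ler_wpM2l //.
rewrite qr -powR_mulrn ?powR_ge0 // -powRrM mulrC mulrN -mulNr mulrC.
rewrite -powRM // ?(ltW d0) //.
have -> : 2 `^ (r * - n%:R) = (2 ^- n) `^ r.
  by rewrite mulrC powRrM powRN powR_mulrn.
rewrite ge0_ler_powR ?nnegrE ?(ltW r0) ?mulr_ge0 ?(ltW d0) ?invr_ge0 ?exprn_ge0 //.
rewrite -[2 ^- n]mulr1 ler_pdivrMl ?exprn_gt0 // mulrA -exprSr.
exact: ltW.
Qed.

End dyadic_paths.

Lemma powR2N_lt1 (R : realType) (x : R) : 0 < x -> 2 `^ (- x) < 1 :> R.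
Proof.
move=> x0; rewrite powRN invf_lt1 ?powR_gt0 //.
by have := gt0_ltr_powR x0 (x := 1) (y := 2); rewrite powR1 !nnegrE ltr1n; apply.
Qed.

Lemma cvg_normr_powR (R : realType) (u : nat -> R) (l p : R) : 0 < p ->
  u n @[n --> \oo] --> l -> `|u n| `^ p @[n --> \oo] --> `|l| `^ p.
Proof.
move=> p0 ul; have [l0|l0] := eqVneq l 0; last first.
  have lp : 0 < `|l| by rewrite normr_gt0.
  apply: (@continuous_cvg _ _ _ _ _ _ (@powR R ^~ p)); last exact: cvg_norm.
  apply: differentiable_continuous; apply/derivable1_diffP; apply: derivable_powR.
  by rewrite in_itv /= lp.
rewrite l0 normr0 powR0 ?gt_eqF //; apply/cvgrPdist_le => e e0.
have d0 : 0 < e `^ p^-1 by rewrite powR_gt0.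
move/cvgrPdist_le : ul => /(_ _ d0); apply: filterS => n.
rewrite l0 !sub0r !normrN [`|_ `^ p|]ger0_norm ?powR_ge0 // => h.
rewrite -[leRHS]powRr1 ?(ltW e0) // -(mulVf (lt0r_neq0 p0)) powRrM.
by rewrite ge0_ler_powR ?nnegrE ?powR_ge0 ?(ltW p0).
Qed.

Section kolmogorov_continuity.
Context d (Omega : measurableType d) (R : realType) (P : probability Omega R).
Variables (T p C rho : R) (Y : R -> {RV P >-> R}).
Hypotheses (T0 : 0 < T) (p0 : 0 < p) (C0 : 0 <= C) (rho0 : 0 < rho).
Hypothesis increment_le : forall s t : R, 0 <= s -> s < t -> t <= T ->
  (\int[P]_w (`|Y t w - Y s w| `^ p)%:E <= (C * (t - s) `^ (1 + p * rho))%:E)%E.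

Local Notation grid n k := (T * (k%:R / 2 ^+ n)).
Local Notation path w := (fun n k => Y (grid n k) w).

Lemma grid_double n k : grid n.+1 k.*2 = grid n k.
Proof. by rewrite -mul2n natrM exprS; congr (_ * _); field; rewrite expf_neq0. Qed.

Lemma measurable_increment_powR (s t c : R) :
  measurable_fun setT (fun w => (`|Y t w - Y s w| / c) `^ p).
Proof.
apply: (measurableT_comp (measurable_powR p)); apply: measurable_funM => //; apply: measurableT_comp => //.
by apply: measurable_funB; exact: measurable_funPT.
Qed.

(** The random constant is explicit: the [p]-th powers of all normalised dyadic increments are
    summed over all levels. The sum has finite mean, hence is finite almost everywhere, and its root
    of order [p] bounds each normalised increment. *)
Lemma dyadic_increments_ae (r : R) : 0 < r -> r < rho ->
  {ae P, forall w, exists2 K : R, 0 <= K & forall n k, (k < 2 ^ n)%N ->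
    `|path w n k.+1 - path w n k| <= K * (2 `^ (- r)) ^+ n}.
Proof.
move=> r0 rrho; pose q : R := 2 `^ (- r); have q0 : 0 < q by exact: powR_gt0.
pose W n w := \sum_(k < 2 ^ n) (`|path w n k.+1 - path w n k| / q ^+ n) `^ p.
have W0 n w : 0 <= W n w by apply: sumr_ge0 => k _; exact: powR_ge0.
have mW n : measurable_fun setT (W n).
  by apply: measurable_sum => k; exact: measurable_increment_powR.
have mWE n : measurable_fun setT (EFin \o W n) by exact/measurable_EFinP.
pose m := 1 + p * rho.
(* Level [n] has [2^n] increments, each of moment at most [C (T / 2^n)^(1 + p rho)]; the count
   absorbs the 1 in the exponent, and the normalisation by [q^n] costs [2^(n r p)], leaving
   [b^n]. *)
pose b : R := 2 `^ (- (p * (rho - r))).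
have b0 : 0 < b by exact: powR_gt0.
have b1 : b < 1 by apply: powR2N_lt1; rewrite mulr_gt0 // subr_gt0.
pose A := C * T `^ m.
have A0 : 0 <= A by rewrite mulr_ge0 ?powR_ge0.
have EW n : (\int[P]_w (W n w)%:E <= (A * b ^+ n)%:E)%E.
  rewrite /W; under eq_integral do rewrite -sumEFin.
  rewrite ge0_integral_sum //; last 2 first.
  - by move=> k; apply/measurable_EFinP; exact: measurable_increment_powR.
  - by move=> k w _; rewrite lee_fin powR_ge0.
  have qn0 : 0 < q ^+ n by rewrite exprn_gt0.
  have n0 : 0 < 2 ^+ n :> R by rewrite exprn_gt0.
  apply: (@le_trans _ _ (\sum_(k < 2 ^ n) (((q ^+ n) `^ (- p)) * (C * (T / 2 ^+ n) `^ m))%:E)%E).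
    apply: lee_sum => k _.
    have -> : (\int[P]_w ((`|path w n k.+1 - path w n k| / q ^+ n) `^ p)%:E =
        ((q ^+ n) `^ (- p))%:E * \int[P]_w (`|path w n k.+1 - path w n k| `^ p)%:E)%E.
      rewrite -ge0_integralZl_fin ?powR_ge0 //.
        apply: eq_integral => w _; congr EFin.
        by rewrite powRM ?invr_ge0 ?(ltW qn0) // mulrC -[(q ^+ n)^-1]powR_inv1 ?(ltW qn0) // -powRrM mulN1r.
      apply: measurable_normr_powR.
      by apply: measurable_funB; exact: measurable_funPT.
    rewrite EFinM lee_wpmul2l ?lee_fin ?powR_ge0 //.
    have -> : T / 2 ^+ n = grid n k.+1 - grid n k.
      by rewrite -mulrBr -mulrBl -[k.+1%:R]natr1 addrAC subrr add0r mul1r.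
    apply: increment_le.
    - by rewrite mulr_ge0 ?(ltW T0) // divr_ge0 // ltW.
    - by rewrite ltr_pM2l // ltr_pM2r ?invr_gt0 // ltr_nat.
    - by rewrite ler_piMr ?(ltW T0) // ler_pdivrMr // mul1r -natrX ler_nat ltn_ord.
  rewrite sumEFin lee_fin sumr_const card_ord -[leLHS]mulr_natl natrX.
  rewrite le_eqVlt; apply/orP; left; apply/eqP; rewrite /A.
  rewrite powRM ?invr_ge0 ?(ltW T0) ?(ltW n0) //.
  have -> : (2 ^+ n)^-1 `^ m = 2 `^ (- (n%:R * m)) :> R.
    by rewrite -powR_mulrn // -powRN -powRrM mulNr.
  have -> : (q ^+ n) `^ (- p) = 2 `^ (n%:R * (r * p)).
    rewrite -powR_mulrn ?(ltW q0) // /q -!powRrM; congr (_ `^ _); ring.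
  have -> : b ^+ n = 2 `^ n%:R * 2 `^ (n%:R * (r * p)) * 2 `^ (- (n%:R * m)).
    rewrite -powR_mulrn ?(ltW b0) // /b -powRrM -!powRD_gt0 //; congr (_ `^ _); rewrite /m; ring.
  rewrite powR_mulrn //; ring.
have Wint : (\int[P]_w (\sum_(n <oo) (W n w)%:E) < +oo)%E.
  rewrite (integral_nneseries P measurableT mWE); last by move=> n w _; rewrite lee_fin.
  apply: (@le_lt_trans _ _ (A / (1 - b))%:E); last exact: ltry.
  apply: lime_le.
    by apply: is_cvg_nneseries => n _ _; apply: integral_ge0 => w _; rewrite lee_fin.
  apply: nearW => N.
  apply: (@le_trans _ _ (\sum_(0 <= n < N) (A * b ^+ n)%:E)%E); first by apply: lee_sum => i _; exact: EW.
  rewrite sumEFin lee_fin -mulr_sumr ler_wpM2l //.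
  rewrite big_mkord -[leRHS]mul1r ler_pdivlMr ?subr_gt0 // mulrC.
  by rewrite -[X in X <= _]opprK -mulNr opprB -subrX1 opprB lerBlDr lerDl exprn_ge0 // ltW.
have mS : measurable_fun setT (fun w => \sum_(n <oo) (W n w)%:E)%E.
  by apply: ge0_emeasurable_sum => [n w _ _|n _]; [rewrite lee_fin|exact: mWE].
have iS : P.-integrable setT (fun w => \sum_(n <oo) (W n w)%:E)%E.
  apply/integrableP; split => //.
  rewrite (eq_integral (fun w => \sum_(n <oo) (W n w)%:E)%E) // => w _.
  by rewrite gee0_abs //; apply: nneseries_ge0 => n _ _; rewrite lee_fin.
have := integrable_ae measurableT iS; apply: filterS => w /(_ I) fw.
set S := (\sum_(n <oo) (W n w)%:E)%E in fw.
have S0 : (0 <= S)%E by apply: nneseries_ge0 => n _ _; rewrite lee_fin.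
have S0' : 0 <= fine S by exact: fine_ge0.
exists (fine S `^ p^-1); first exact: powR_ge0.
move=> n k kn; have qn0 : 0 < q ^+ n by rewrite exprn_gt0.
rewrite -ler_pdivrMr //.
have WS : W n w <= fine S.
  rewrite -lee_fin fineK //; apply: le_trans (nneseries_lim_ge n.+1 _) => /=; last first.
    by move=> i _; rewrite lee_fin.
  by rewrite big_nat_recr //= leeDr // sume_ge0 // => i _; rewrite lee_fin.
have kW : (`|path w n k.+1 - path w n k| / q ^+ n) `^ p <= fine S.
  apply: le_trans WS; rewrite /W (bigD1 (Ordinal kn)) //= lerDl.
  by apply: sumr_ge0 => i _; exact: powR_ge0.
have c0 : 0 <= `|path w n k.+1 - path w n k| / q ^+ n by rewrite divr_ge0 // ltW.
rewrite -/q; move: kW c0; move: (`|_| / _) => v vS v0.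
have -> : v = (v `^ p) `^ p^-1 by rewrite -powRrM mulfV ?gt_eqF // powRr1.
by rewrite ge0_ler_powR ?nnegrE ?powR_ge0 ?invr_ge0 ?(ltW p0).
Qed.

Lemma kolmogorov_continuity : exists2 Y' : R -> {RV P >-> R}, is_modification `[0, T] Y' Y &
  {ae P, forall w, holder_up_to `[0, T] rho (fun t => Y' t w)}.
Proof.
(* Countably many orders increasing to [rho] suffice, so a single null set [N] serves all of them;
   the shift by 2 keeps [r_ 0] positive. *)
pose r_ j := rho - rho / j.+2%:R.
have r_gt0 j : 0 < r_ j.
  by rewrite /r_ subr_gt0 ltr_pdivrMr // ltr_pMr // ltr1n.
have r_lt j : r_ j < rho by rewrite /r_ ltrBlDr ltrDl divr_gt0.
have [N [mN PN HN]] : {ae P, forall w, forall j, exists2 K : R, 0 <= K & forall n k, (k < 2 ^ n)%N ->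
    `|path w n k.+1 - path w n k| <= K * (2 `^ (- r_ j)) ^+ n}.
  by apply: ae_foralln => j; exact: dyadic_increments_ae.
have good w : ~ N w -> forall j, exists2 K : R, 0 <= K & forall n k, (k < 2 ^ n)%N ->
    `|path w n k.+1 - path w n k| <= K * (2 `^ (- r_ j)) ^+ n.
  by move=> Nw; apply: contrapT => H; apply: Nw; exact: HN.
have q0 j : 0 < 2 `^ (- r_ j) :> R by exact: powR_gt0.
have q1 j : 2 `^ (- r_ j) < 1 :> R by exact: powR2N_lt1.
have dbl w n k : path w n.+1 k.*2 = path w n k by rewrite grid_double.
pose A n t w := dyadic_path (path w) n (t / T) * \1_(~` N) w.
(* The limit is the same for every order [r_ j], only the Hoelder constant changes; on the null set
   the path is put equal to 0. *)
pose L t w := dyadic_limit (path w) (t / T) * \1_(~` N) w.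
have tT t : 0 <= t <= T -> 0 <= t / T /\ t / T <= 1.
  by move=> /andP[t0 t1]; rewrite divr_ge0 ?(ltW T0) // ler_pdivrMr // mul1r.
have cA t w : 0 <= t <= T -> A n t w @[n --> \oo] --> L t w.
  move=> /tT[t0 t1]; rewrite /A /L indicE; have [Nw|Nw] := pselect (N w).
    by rewrite memNset ?mulr0; [under eq_fun do rewrite mulr0; exact: cvg_cst|case].
  rewrite mem_set // mulr1; under eq_fun do rewrite mulr1.
  have [K K0 yK] := good w Nw 0%N.
  exact: (cvg_dyadic_path K0 (q0 0%N) (q1 0%N) (dbl w) yK t0 t1).
have mA n t : measurable_fun setT (A n t).
  apply: measurable_funM; first exact: measurable_funPT.
  by apply: measurable_indic; exact: measurableC.
have mL t : 0 <= t <= T -> measurable_fun setT (L t).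
  move=> t0T; apply: (measurable_fun_cvg (fun n => mA n t)) => w _; exact: cA.
(* A random variable is needed for every real [t]; convergence, hence measurability of [L t], is
   established on [[0, T]], and [Y t] is the fallback where [L t] is not measurable. *)
pose Y' t : {RV P >-> R} := if pselect (measurable_fun setT (L t)) is left m
  then mfun_Sub (mem_set m) else Y t.
have Y'E t : 0 <= t <= T -> Y' t = L t :> (Omega -> R).
  by move=> t0T; rewrite /Y'; case: pselect => [m|/(_ (mL t t0T)) //]; rewrite mfun_valP.
exists Y'.
- move=> t; rewrite /= in_itv /= => t0T; have [x0 x1] := tT t t0T.
  pose m := 1 + p * rho; have m0 : 0 < m by rewrite addr_gt0 // mulr_gt0.
  have nN : {ae P, forall w, ~ N w} by exists N; split => // w /= /contrapT.
  have mD (V : Omega -> R) : measurable_fun setT V -> measurable_fun setT (fun w => `|Y t w - V w| `^ p).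
    by move=> mV; apply: measurable_normr_powR; apply: measurable_funB => //; exact: measurable_funPT.
  (* The grid point used at level [n] is within [T / 2^n] of [t], so the moments of [Y t - A n t]
     tend to 0, and Fatou's lemma identifies the limit with [Y t] almost everywhere. *)
  have E0 : (\int[P]_w (`|Y t w - L t w| `^ p)%:E <= 0%:E)%E.
    apply: (@fatou_le _ _ _ P (fun n w => `|Y t w - A n t w| `^ p) _
      (fun n => C * T `^ m * (2 `^ (- m)) ^+ n)).
    + by move=> n; exact: mD.
    + by apply: mD; exact: mL.
    + by move=> n w; exact: powR_ge0.
    + by move=> w; exact: powR_ge0.
    + apply: aeW => w; apply: cvg_normr_powR => //; apply: cvgB; [exact: cvg_cst|exact: cA].
    + apply: nearW => n; set j := Num.truncn (2 ^+ n * (t / T)).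
      have [j1 j2 j3] := truncn_bounds n x0 x1; rewrite -/j in j1 j2 j3.
      have n0 : 0 < 2 ^+ n :> R by rewrite exprn_gt0.
      have -> : (\int[P]_w (`|Y t w - A n t w| `^ p)%:E = \int[P]_w (`|Y t w - Y (grid n j) w| `^ p)%:E)%E.
        apply: ae_eq_integral => //.
        * by apply/measurable_EFinP; exact: mD.
        * by apply/measurable_EFinP; apply: mD; exact: measurable_funPT.
        * apply: filterS nN => w Nw _ /=; rewrite /A indicE mem_set // mulr1 //.
      have g0 : 0 <= grid n j by rewrite mulr_ge0 ?(ltW T0) // divr_ge0 // ltW.
      have gt : grid n j <= t.
        rewrite mulrC -ler_pdivlMr // ler_pdivrMr // mulrC //.
      have gd : t - grid n j <= T / 2 ^+ n.
        have -> : t - grid n j = T / 2 ^+ n * (2 ^+ n * (t / T) - j%:R).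
          by field; rewrite !gt_eqF.
        by rewrite ler_piMr ?divr_ge0 ?(ltW T0) ?(ltW n0) //; lra.
      have b0 : 0 <= C * T `^ m * 2 `^ (- m) ^+ n.
        by rewrite !mulr_ge0 ?powR_ge0 // exprn_ge0 // powR_ge0.
      move: gt; rewrite le_eqVlt => /orP[/eqP <-|gt].
        under eq_integral do rewrite subrr normr0 powR0 ?gt_eqF //.
        by rewrite integral0 lee_fin.
      case/andP: t0T => t0 tT'.
      apply: (le_trans (increment_le g0 gt tT')); rewrite lee_fin -mulrA ler_wpM2l // -/m.
      rewrite (@le_trans _ _ ((T / 2 ^+ n) `^ m)) ?ge0_ler_powR ?nnegrE ?(ltW m0) ?subr_ge0 ?(ltW gt) //.
        by rewrite divr_ge0 // ltW.
      rewrite powRM ?invr_ge0 ?(ltW T0) ?(ltW n0) //.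
      by rewrite -!powR_mulrn ?powR_ge0 // -powRN -!powRrM !mulNr [m * _]mulrC.
    + rewrite -[X in _ --> X](mulr0 (C * T `^ m)); apply: cvgMl_tmp; apply: cvg_expr.
      by rewrite ger0_norm ?powR_ge0 // powR2N_lt1.
  have mLE : measurable_fun setT (fun w => (`|Y t w - L t w| `^ p)%:E).
    by apply/measurable_EFinP; apply: mD; exact: mL.
  have /(ae_eq_integral_abs _ measurableT mLE) : (\int[P]_w `|(`|Y t w - L t w| `^ p)%:E| = 0)%E.
    apply/eqP; rewrite eq_le integral_ge0 ?andbT; last by move=> w _; exact: abse_ge0.
    by under eq_integral do rewrite gee0_abs ?lee_fin ?powR_ge0 //.
  apply: filterS => w /(_ I) /= [] /powR_eq0_eq0 /normr0_eq0 /subr0_eq ->.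
  by rewrite Y'E.
- have nN : {ae P, forall w, ~ N w} by exists N; split => // w /= /contrapT.
  apply: filterS nN => w Nw r r0 rrho.
  (* This makes [rho / (j + 2) <= rho - r]. Lowering the order from [r_ j] to [r] is then harmless
     because [|t - s| / T <= 1]. *)
  pose j := Num.bound (rho / (rho - r)).
  have rj : r <= r_ j.
    have rr : 0 < rho - r by rewrite subr_gt0.
    rewrite /r_ lerBrDr addrC -lerBrDr ler_pdivrMr // mulrC -ler_pdivrMr //.
    have := archi_boundP (ltW (divr_gt0 rho0 rr)); rewrite -/j => /ltW /le_trans; apply.
    by rewrite ler_nat -addn2 leq_addr.
  have [K K0 yK] := good w Nw j.
  have [B B0 HB] := dyadic_limit_holder K0 (q0 j) (q1 j) (dbl w) yK (r_gt0 j) erefl.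
  have main s t : 0 <= s -> s <= t -> t <= T -> `|L t w - L s w| <= B * T^-1 `^ r * `|t - s| `^ r.
    move=> s0 st tT'; have t0 : 0 <= t := le_trans s0 st.
    have [xs0 _] : 0 <= s / T /\ s / T <= 1 by apply: tT; rewrite s0 (le_trans st).
    have [_ xt1] : 0 <= t / T /\ t / T <= 1 by apply: tT; rewrite t0.
    rewrite /L indicE mem_set // !mulr1.
    apply: (le_trans (HB _ _ xs0 _ xt1)); first by rewrite ler_pM2r // invr_gt0.
    rewrite -mulrA ler_wpM2l // ger0_norm ?subr_ge0 // -mulrBl mulrC.
    rewrite -powRM ?invr_ge0 ?subr_ge0 ?(ltW T0) //.
    move: st; rewrite le_eqVlt => /orP[/eqP ->|st].
      by rewrite subrr mulr0 !powR0 // gt_eqF.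
    have y0 : 0 < T^-1 * (t - s) by rewrite mulr_gt0 ?invr_gt0 // subr_gt0.
    have y1 : T^-1 * (t - s) <= 1 by rewrite ler_pdivrMl // mulr1; lra.
    by have := powR_le_min y0 y1 rj; rewrite powR1 mul1r.
  exists (B * T^-1 `^ r) => s t; rewrite /= !in_itv /= => sT tT'.
  rewrite !Y'E //; case/andP: (sT) => s0 _; case/andP: (tT') => t0 _.
  have [st|/ltW ts] := leP s t; first by apply: main => //; case/andP: tT'.
  by rewrite distrC [`|t - s|]distrC; apply: main => //; case/andP: sT.
Qed.

End kolmogorov_continuity.

Theorem lemma4 (d : measure_display) (Omega : measurableType d) (R : realType)
    (P : probability Omega R) (T a p : R) (nu : {measure set R -> \bar R})
    (Z Y : R -> {RV P >-> R}) (g : R -> R -> R)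
    (alpha beta gamma delta : R) :
  0 < T ->
  levy_process T Z -> has_triplet T Z a 0 nu ->
  0 <= a -> levy_measure nu -> symmetric_measure nu ->
  measurable_fun [set tu : R * R | 0 < tu.2 < tu.1 /\ tu.1 <= T]
    (fun tu : R * R => g tu.1 tu.2) ->
  (forall t : R, 0 <= t <= T -> is_levy_integral Z t (g t) (Y t)) ->
  1 <= p -> a = 0 ->
  (\int[nu]_x (`|x| `^ p)%:E < +oo)%E ->
  0 < delta -> - p^-1 < beta -> - p^-1 < gamma ->
  - p^-1 < alpha + beta + gamma ->
  (exists C : R, forall t u : R, 0 < u -> u < t -> t <= T ->
     `|g t u| <= C * t `^ alpha * u `^ beta * (t - u) `^ gamma) ->
  (exists h : R -> R -> R -> R,
     [/\ forall t s : R, 0 < s -> s < t -> t <= T ->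
           measurable_fun `]0, s[ (h t s),
         forall t s u : R, 0 < u -> u < s -> s < t -> t <= T ->
           `|g t u - g s u| <= `|t - s| `^ delta * h t s u
       & (ereal_sup
           [set \int[lebesgue_measure]_(u in `]0%R, st.1[)
                  (`|h st.2 st.1 u| `^ p)%:E
           | st in [set st : R * R | (0 < st.1 < st.2)%R /\ (st.2 <= T)%R]]
          < +oo)%E]) ->
  let kappa := if alpha + beta < 0 then alpha + beta + gamma else gamma in
  (exists C : R, forall s t : R, 0 <= s -> s < t -> t <= T ->
     ('E_P[(fun w => `|Y t w - Y s w| `^ p)%R]
      <= (C * (t - s) `^ Num.min (kappa * p + 1) (delta * p))%:E)%E) /\
  (0 < kappa -> p^-1 < delta ->
   exists2 Y' : R -> {RV P >-> R}, is_modification `[0, T] Y' Y &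
     {ae P, forall w,
        holder_up_to `[0, T] (Num.min kappa (delta - p^-1))
          (fun t => Y' t w)}).
Proof.
move=> T0 hZ hT _ hnu snu _ hY p1 a0 nup _ bgt ggt sgt [C gC] [h [mh hle hsup]] kappa.
rewrite a0 in hT.
have p0 : 0 < p := lt_le_trans ltr01 p1.
have [C' C'0 H] := increment_moment_le T0 hZ hT hnu snu hY p0 nup bgt ggt sgt gC mh hle hsup.
split=> [|k0 pd]; first by exists C' => s t s0 st tT; rewrite unlock; exact: H.
have rho0 : 0 < Num.min kappa (delta - p^-1) by rewrite lt_min k0 subr_gt0.
apply: (kolmogorov_continuity T0 p0 C'0 rho0) => s t s0 st tT.
(* Kolmogorov's criterion wants the exponent in the form [1 + p * rho]; solving for [rho] yields the
   announced Hoelder order, the term [delta * p] losing [1 / p] and [kappa * p + 1] nothing. *)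
suff <- : Num.min (kappa * p + 1) (delta * p) = 1 + p * Num.min kappa (delta - p^-1) by exact: H.
rewrite minr_pMr ?(ltW p0) // addr_minr mulrBr mulfV ?gt_eqF // addrCA subrr addr0.
by rewrite addrC ![p * _]mulrC.
Qed.
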